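(* Let $X$ be a smooth projective variety and $L$ an ample line bundle on $X$. There is a countable union $V$ of proper closed subsets of $X$ such that every subvariety $Y\subset X$ satisfying $a(Y,L)>a(X,L)$ is contained in $V$.
   Context: The ground field is algebraically closed of characteristic zero. A variety is an irreducible reduced scheme of finite type over this field; subvarieties are closed and, so that the invariants below are defined, positive-dimensional. For a smooth projective variety $X$, $\mathrm{NS}(X,\mathbb{R})=\mathrm{NS}(X)\otimes\mathbb{R}$ is the N\'eron–Severi space and $\Lambda_{\mathrm{eff}}(X)\subset \mathrm{NS}(X,\mathbb{R})$ is the cone of pseudo-effective divisors, i.e. the closure of the cone of effective $\mathbb{R}$-divisors. For $L$ big on $X$, put $$a(X,L)=\min\{t\in\mathbb{R}\mid t[L]+[K_X]\in\Lambda_{\mathrm{eff}}(X)\}.$$ This is a birational invariant; for a singular projective variety $Y$ with $L$ big on $Y$ one sets $a(Y,L):=a(\tilde Y,\beta^*L)$ for any resolution of singularities $\beta:\tilde Y\to Y$. For a subvariety $Y\subset X$, $a(Y,L)$ means $a(Y,L|_Y)$. *)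

(* Defs.v *)
From HB Require Import structures.
From mathcomp Require Import all_boot all_order all_algebra.
From mathcomp Require Import all_classical all_reals all_analysis.
From mathcomp Require mpoly.
Import -(notations) mpoly.
Set Implicit Arguments.
Unset Strict Implicit.
Unset Printing Implicit Defensive.
Import Order.TTheory GRing.Theory Num.Theory.
Import numFieldNormedType.Exports.
Local Open Scope classical_set_scope.
Local Open Scope ring_scope.

(* Over an algebraically closed field k, a reduced scheme of
   finite type is encoded by its set of closed points with the Zariski topology
   and its sheaf of regular functions, which are honest k-valued functions. *)

(* Functions are total; [reg U f] only constrains the values of f on U. *)
Record kspace (k : fieldType) := KSpace {
  carrier :> topologicalType;
  reg : set carrier -> (carrier -> k) -> Prop;
  reg_local : forall (U : set carrier) (f : carrier -> k), open U ->
    (forall p, U p -> exists W : set carrier, exists g : carrier -> k,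
        [/\ open W, W p, reg W g & forall q, W q -> U q -> f q = g q]) ->
    reg U f;
  reg_cst : forall (U : set carrier) (c : k), open U -> reg U (fun=> c);
  reg_add : forall (U : set carrier) (f g : carrier -> k), open U ->
    reg U f -> reg U g -> reg U (fun p => f p + g p);
  reg_mul : forall (U : set carrier) (f g : carrier -> k), open U ->
    reg U f -> reg U g -> reg U (fun p => f p * g p);
  reg_inv : forall (U : set carrier) (f : carrier -> k), open U -> reg U f ->
    open (U `&` [set p | f p != 0]) /\
    reg (U `&` [set p | f p != 0]) (fun p => (f p)^-1)
}.

Arguments reg {k} S U f : rename.

Lemma reg_sub (k : fieldType) (S : kspace k) (U V : set S) (f : S -> k) :
  open U -> open V -> V `<=` U -> reg S U f -> reg S V f.
Proof.
by move=> oU oV VU rf; apply: reg_local => // p Vp; exists U, f; split=> //; exact: VU.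
Qed.

Record morphism (k : fieldType) (S T : kspace k) := Morphism {
  mor_fun :> S -> T;
  mor_open : forall W : set T, open W -> open (mor_fun @^-1` W);
  mor_reg : forall (W : set T) (g : T -> k), open W -> reg T W g ->
    reg S (mor_fun @^-1` W) (g \o mor_fun)
}.

(* Projective space: lines through 0 in k^(n+1). *)

Definition proj_pt (k : fieldType) (n : nat) : Type :=
  {l : {vspace 'rV[k]_n.+1} | \dim l == 1%N}.

HB.instance Definition _ (k : fieldType) (n : nat) :=
  Choice.copy (proj_pt k n) {l : {vspace 'rV[k]_n.+1} | \dim l == 1%N}.

Section ProjectiveSpace.
Variables (k : fieldType) (n : nat).
Local Notation P := (proj_pt k n).
Local Notation poly := (mpoly.mpoly n.+1 k).

(* Homogeneous coordinates of a line, for some choice of a nonzero vector on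
   it; everything below is independent of that choice. *)
Definition hcoord (l : P) (i : 'I_n.+1) : k := vpick (sval l) 0 i.

Definition heval (G : poly) (l : P) : k := mpoly.meval (hcoord l) G.

Definition homog (d : nat) (G : poly) : bool :=
  G \is mpoly.ishomog1 d (@mpoly.mdeg n.+1).

Definition zariski_open (U : set P) : Prop :=
  exists I : set poly,
    (forall G, I G -> exists d, homog d G) /\
    U = [set l | exists2 G, I G & heval G l != 0].

Lemma zariski_openT : zariski_open setT.
Proof.
exists [set 1]; split=> [_ ->|]; first by exists 0%N; exact: mpoly.dhomog1.
apply/seteqP; split=> // l _; exists 1 => //.
by rewrite /heval mpoly.meval1 oner_neq0.
Qed.

Lemma zariski_openI : setI_closed zariski_open.
Proof.
move=> _ _ [I [hI ->]] [J [hJ ->]].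
exists [set G | exists A B, [/\ I A, J B & G = A * B]]; split.
  move=> _ [A [B [/hI [d hA] /hJ [e hB] ->]]].
  by exists (d + e)%N; exact: mpoly.dhomogM.
apply/seteqP; split=> l /=.
  move=> [[A IA nA] [B JB nB]]; exists (A * B); first by exists A, B.
  by rewrite /heval mpoly.mevalM mulf_neq0.
move=> [_ [A [B [IA JB ->]]]]; rewrite /heval mpoly.mevalM mulf_eq0 negb_or.
by case/andP=> nA nB; split; [exists A|exists B].
Qed.

Lemma zariski_open_bigU (I : Type) (f : I -> set P) :
  (forall i, zariski_open (f i)) -> zariski_open (\bigcup_i f i).
Proof.
move=> of_; exists [set G | (exists d, homog d G) /\
   [set l | heval G l != 0] `<=` \bigcup_i f i]; split; first by move=> G [].
apply/seteqP; split=> l; last by move=> [G [_ sG] nG]; exact: sG.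
move=> [i _ fil]; have [J [hJ fE]] := of_ i.
move: (fil); rewrite fE => -[G JG nG]; exists G => //; split; first exact: hJ.
by move=> m nGm; exists i => //; rewrite fE; exists G.
Qed.

HB.instance Definition _ := isOpenTopological.Build P
  zariski_openT zariski_openI zariski_open_bigU.

Lemma proj_openE (U : set P) : open U = zariski_open U.
Proof. by []. Qed.

Definition proj_reg (U : set P) (f : P -> k) : Prop :=
  forall l, U l -> exists W : set P, exists d, exists G H : poly,
    [/\ open W, W l, homog d G /\ homog d H &
        forall m, W m -> U m -> heval H m != 0 /\ f m = heval G m / heval H m].

Lemma proj_reg_local (U : set P) (f : P -> k) : open U ->
  (forall p, U p -> exists W : set P, exists g : P -> k,
      [/\ open W, W p, proj_reg W g & forall q, W q -> U q -> f q = g q]) ->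
  proj_reg U f.
Proof.
move=> oU h l Ul; have [W [g [oW Wl rg fg]]] := h l Ul.
have [W' [d [G [H [oW' W'l hGH gE]]]]] := rg l Wl.
exists (W `&` W'), d, G, H; split=> //; first exact: openI.
by move=> m [Wm W'm] Um; rewrite fg //; exact: gE.
Qed.

Lemma proj_reg_cst (U : set P) (c : k) : open U -> proj_reg U (fun=> c).
Proof.
move=> oU l Ul; exists U, 0%N, (mpoly.mpolyC _ c), 1; split=> //.
  split; last exact: mpoly.dhomog1.
  by rewrite -mpoly.alg_mpolyC; apply: mpoly.dhomogZ; exact: mpoly.dhomog1.
by move=> m _ _; rewrite /heval mpoly.meval1 mpoly.mevalC divr1 oner_neq0.
Qed.

Lemma proj_reg_add (U : set P) (f g : P -> k) : open U ->
  proj_reg U f -> proj_reg U g -> proj_reg U (fun p => f p + g p).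
Proof.
move=> oU rf rg l Ul.
have [W [d [A [B [oW Wl [hA hB] fE]]]]] := rf l Ul.
have [W' [e [C [D [oW' W'l [hC hD] gE]]]]] := rg l Ul.
exists (W `&` W'), (d + e)%N, (A * D + C * B), (B * D); split=> //.
- exact: openI.
- split; last exact: mpoly.dhomogM.
  by apply: mpoly.dhomogD; [|rewrite addnC]; exact: mpoly.dhomogM.
move=> m [Wm W'm] Um; have [nB ->] := fE m Wm Um; have [nD ->] := gE m W'm Um.
rewrite /heval mpoly.mevalD !mpoly.mevalM; split; first exact: mulf_neq0.
by rewrite addf_div.
Qed.

Lemma proj_reg_mul (U : set P) (f g : P -> k) : open U ->
  proj_reg U f -> proj_reg U g -> proj_reg U (fun p => f p * g p).
Proof.
move=> oU rf rg l Ul.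
have [W [d [A [B [oW Wl [hA hB] fE]]]]] := rf l Ul.
have [W' [e [C [D [oW' W'l [hC hD] gE]]]]] := rg l Ul.
exists (W `&` W'), (d + e)%N, (A * C), (B * D); split=> //.
- exact: openI.
- by split; exact: mpoly.dhomogM.
move=> m [Wm W'm] Um; have [nB ->] := fE m Wm Um; have [nD ->] := gE m W'm Um.
rewrite /heval !mpoly.mevalM; split; first exact: mulf_neq0.
by rewrite mulf_div.
Qed.

Lemma proj_open_neq0 (d : nat) (G : poly) :
  homog d G -> open [set l : P | heval G l != 0].
Proof.
move=> hG; rewrite proj_openE; exists [set G]; split=> [_ ->|]; first by exists d.
by apply/seteqP; split=> l /= => [nG|[_ -> //]]; exists G.
Qed.

Lemma proj_reg_inv (U : set P) (f : P -> k) : open U -> proj_reg U f ->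
  open (U `&` [set p | f p != 0]) /\
  proj_reg (U `&` [set p | f p != 0]) (fun p => (f p)^-1).
Proof.
move=> oU rf; split.
  rewrite openE => l [Ul nf] /=.
  have [W [d [A [B [oW Wl [hA hB] fE]]]]] := rf l Ul.
  rewrite /interior nbhsE /=.
  exists (U `&` W `&` [set p | heval A p != 0]).
    split; first by apply: openI; [exact: openI | exact: (proj_open_neq0 hA)].
    split=> //=; have [nB] := fE l Wl Ul; move: nf; rewrite /= => /[swap] ->.
    by rewrite mulf_eq0 negb_or => /andP[].
  move=> m [[Um Wm] nA]; split=> //=; have [nB ->] := fE m Wm Um.
  by rewrite mulf_neq0 // invr_neq0.
move=> l [Ul /= nf]; have [W [d [A [B [oW Wl [hA hB] fE]]]]] := rf l Ul.
exists W, d, B, A; split=> // m Wm [Um /=].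
have [nB ->] := fE m Wm Um; rewrite mulf_eq0 negb_or => /andP[nA _].
by split=> //; rewrite invf_div.
Qed.

Definition projsp : kspace k :=
  KSpace proj_reg_local proj_reg_cst proj_reg_add proj_reg_mul proj_reg_inv.

End ProjectiveSpace.

Definition irreducible_set (T : topologicalType) (A : set T) : Prop :=
  A !=set0 /\ forall B C : set T, closed B -> closed C ->
    A `<=` B `|` C -> A `<=` B \/ A `<=` C.

Definition has_chain (T : topologicalType) (d : nat) : Prop :=
  exists Z : nat -> set T,
    (forall i, (i <= d)%N -> closed (Z i) /\ irreducible_set (Z i)) /\
    (forall i, (i < d)%N -> Z i `<` Z i.+1).

Definition krull_dim (T : topologicalType) (d : nat) : Prop :=
  has_chain T d /\ ~ has_chain T d.+1.

(* isomorphism onto a subset of T with its induced reduced structure *)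
Definition immersion (k : fieldType) (S T : kspace k) (f : morphism S T) : Prop :=
  [/\ injective f,
      forall U : set S, open U -> exists2 W : set T, open W & U = f @^-1` W &
      forall (U : set S) (h : S -> k), open U -> reg S U h ->
        forall p, U p -> exists W : set T, exists g : T -> k,
          [/\ open W, W (f p), reg T W g &
              forall q, U q -> W (f q) -> h q = g (f q)]].

Definition closed_immersion (k : fieldType) (S T : kspace k)
    (f : morphism S T) : Prop :=
  immersion f /\ closed (range f).

Definition quasi_projective (k : fieldType) (S : kspace k) : Prop :=
  exists n (f : morphism S (projsp k n)), immersion f /\
    exists U Z : set (projsp k n), [/\ open U, closed Z & range f = U `&` Z].

Definition projective_variety (k : fieldType) (S : kspace k) : Prop :=
  irreducible_set [set: S] /\
  exists n (f : morphism S (projsp k n)), closed_immersion f.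

Definition positive_dimensional (k : fieldType) (S : kspace k) : Prop :=
  exists2 d, krull_dim S d & (0 < d)%N.

Definition reg_at (k : fieldType) (S : kspace k) (p : S) (f : S -> k) : Prop :=
  exists U : set S, [/\ open U, U p & reg S U f].

(* the germ of f at p lies in the square of the maximal ideal of p *)
Definition in_max_sq (k : fieldType) (S : kspace k) (p : S) (f : S -> k) : Prop :=
  exists U : set S, exists m, exists g h : 'I_m -> S -> k,
    [/\ open U, U p,
        forall i, [/\ reg S U (g i), reg S U (h i), g i p = 0 & h i p = 0] &
        forall q, U q -> f q = \sum_(i < m) g i q * h i q].

(* df = \sum_a v_a dx_a in the cotangent space m_p / m_p^2, where df is the
   class of f - f(p) *)
Definition diff_expand (k : fieldType) (S : kspace k) (d : nat) (p : S)
    (x : 'I_d -> S -> k) (f : S -> k) (v : 'rV[k]_d) : Prop :=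
  in_max_sq p (fun q => f q - f p - \sum_(a < d) v 0 a * (x a q - x a p)).

(* dx_1, ..., dx_d is a basis of m_p / m_p^2 *)
Definition local_coordinates (k : fieldType) (S : kspace k) (d : nat) (p : S)
    (x : 'I_d -> S -> k) : Prop :=
  (forall a, reg_at p (x a)) /\
  (forall f, reg_at p f -> exists! v, diff_expand p x f v).

(* The local ring at every closed point is regular, which over
   an algebraically closed field is smoothness *)
Definition smooth_variety (k : fieldType) (S : kspace k) : Prop :=
  exists2 d, krull_dim S d &
    forall p : S, exists x : 'I_d -> S -> k, local_coordinates p x.

(* Line bundles, given by transition functions: a section is a family of
    functions s_i on lb_cov i with s_i = (lb_trans i j) * s_j *)

Record line_bundle (k : fieldType) (S : kspace k) := LineBundle {
  lb_idx : Type;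
  lb_cov : lb_idx -> set S;
  lb_trans : lb_idx -> lb_idx -> S -> k;
  lb_open : forall i, open (lb_cov i);
  lb_cover : forall p, exists i, lb_cov i p;
  lb_reg : forall i j, reg S (lb_cov i `&` lb_cov j) (lb_trans i j);
  lb_neq0 : forall i j p, lb_cov i p -> lb_cov j p -> lb_trans i j p != 0;
  lb_cocycle : forall i j l p, lb_cov i p -> lb_cov j p -> lb_cov l p ->
    lb_trans i j p * lb_trans j l p = lb_trans i l p
}.

Definition lb_iso (k : fieldType) (S : kspace k) (L M : line_bundle S) : Prop :=
  exists h : lb_idx L -> lb_idx M -> S -> k,
    [/\ forall i a, reg S (lb_cov i `&` lb_cov a) (h i a),
        forall i a p, lb_cov i p -> lb_cov a p -> h i a p != 0 &
        forall i j a b p, lb_cov i p -> lb_cov j p -> lb_cov a p -> lb_cov b p ->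
          h i a p * lb_trans a b p = lb_trans i j p * h j b p].

Section TensorPullback.
Variables (k : fieldType) (S : kspace k).

Section Tensor.
Variables L M : line_bundle S.
Let cov (ia : lb_idx L * lb_idx M) : set S := lb_cov ia.1 `&` lb_cov ia.2.
Let trans (ia jb : lb_idx L * lb_idx M) (p : S) : k :=
  lb_trans ia.1 jb.1 p * lb_trans ia.2 jb.2 p.

Let cov_open ia : open (cov ia).
Proof. by apply: openI; exact: lb_open. Qed.

Let cov_cover p : exists ia, cov ia p.
Proof.
by have [i ip] := lb_cover L p; have [a ap] := lb_cover M p; exists (i, a).
Qed.

Let trans_reg ia jb : reg S (cov ia `&` cov jb) (trans ia jb).
Proof.
apply: reg_mul; first by apply: openI; exact: cov_open.
  apply: (@reg_sub _ _ (lb_cov ia.1 `&` lb_cov jb.1)); last exact: lb_reg.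
  - by apply: openI; exact: lb_open.
  - by apply: openI; exact: cov_open.
  - by move=> p [[? ?] [? ?]].
apply: (@reg_sub _ _ (lb_cov ia.2 `&` lb_cov jb.2)); last exact: lb_reg.
- by apply: openI; exact: lb_open.
- by apply: openI; exact: cov_open.
- by move=> p [[? ?] [? ?]].
Qed.

Let trans_neq0 ia jb p : cov ia p -> cov jb p -> trans ia jb p != 0.
Proof. by move=> [? ?] [? ?]; rewrite mulf_neq0 // lb_neq0. Qed.

Let trans_cocycle ia jb lc p : cov ia p -> cov jb p -> cov lc p ->
  trans ia jb p * trans jb lc p = trans ia lc p.
Proof. by move=> [? ?] [? ?] [? ?]; rewrite /trans mulrACA !lb_cocycle. Qed.

Definition lb_tensor : line_bundle S :=
  LineBundle cov_open cov_cover trans_reg trans_neq0 trans_cocycle.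
End Tensor.

(* L^(m+1) *)
Definition lb_powS (L : line_bundle S) (m : nat) : line_bundle S :=
  iter m (lb_tensor L) L.

Section Pullback.
Variables (T : kspace k) (f : morphism S T) (L : line_bundle T).
Let cov (i : lb_idx L) : set S := f @^-1` lb_cov i.
Let trans (i j : lb_idx L) : S -> k := lb_trans i j \o f.

Let cov_open i : open (cov i).
Proof. exact/mor_open/lb_open. Qed.

Let cov_cover p : exists i, cov i p.
Proof. exact: (lb_cover L (f p)). Qed.

Let trans_reg i j : reg S (cov i `&` cov j) (trans i j).
Proof.
apply: (@mor_reg _ _ _ f (lb_cov i `&` lb_cov j)); last exact: lb_reg.
by apply: openI; exact: lb_open.
Qed.

Let trans_neq0 i j p : cov i p -> cov j p -> trans i j p != 0.
Proof. exact: lb_neq0. Qed.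

Let trans_cocycle i j l p : cov i p -> cov j p -> cov l p ->
  trans i j p * trans j l p = trans i l p.
Proof. exact: lb_cocycle. Qed.

Definition lb_pullback : line_bundle S :=
  LineBundle cov_open cov_cover trans_reg trans_neq0 trans_cocycle.
End Pullback.
End TensorPullback.

Section TautologicalBundle.
Variables (k : fieldType) (n : nat).
Let P := projsp k n.
Let cov (i : 'I_n.+1) : set P := [set l : P | hcoord l i != 0].
(* a linear form s has s_i = s / x_i *)
Let trans (i j : 'I_n.+1) (l : P) : k := hcoord l j / hcoord l i.

Let homogX (i : 'I_n.+1) : homog 1 (mpoly.mpolyX k (mpoly.mnm1 i)).
Proof. by rewrite /homog mpoly.dhomogX; apply/eqP; exact: mpoly.mdeg1. Qed.

Let cov_open i : open (cov i).
Proof.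
have -> : cov i = [set l : P | heval (mpoly.mpolyX k (mpoly.mnm1 i)) l != 0].
  by apply/seteqP; split=> l /=; rewrite /cov /= /heval mpoly.mevalXU.
exact: (proj_open_neq0 (homogX i)).
Qed.

Let cov_cover p : exists i, cov i p.
Proof.
have nz : vpick (sval p) != 0.
  rewrite vpick0; apply/eqP => l0; have := svalP p.
  by rewrite l0 dimv0.
by have /rV0Pn [i hi] := nz; exists i.
Qed.

Let trans_reg i j : reg P (cov i `&` cov j) (trans i j).
Proof.
move=> l [il jl]; exists (cov i), 1%N,
  (mpoly.mpolyX k (mpoly.mnm1 j)), (mpoly.mpolyX k (mpoly.mnm1 i)).
split; [exact: cov_open | by [] | by split; exact: homogX | ].
by move=> m im _; rewrite /heval !mpoly.mevalXU.
Qed.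

Let trans_neq0 i j p : cov i p -> cov j p -> trans i j p != 0.
Proof. by move=> ip jp; rewrite mulf_neq0 // invr_neq0. Qed.

Let trans_cocycle i j l p : cov i p -> cov j p -> cov l p ->
  trans i j p * trans j l p = trans i l p.
Proof. by move=> ip jp lp; rewrite /trans mulrC mulrA divfK. Qed.

Definition lb_O1 : line_bundle P :=
  LineBundle cov_open cov_cover trans_reg trans_neq0 trans_cocycle.
End TautologicalBundle.

Definition ample (k : fieldType) (S : kspace k) (L : line_bundle S) : Prop :=
  exists m n (f : morphism S (projsp k n)),
    closed_immersion f /\ lb_iso (lb_powS L m) (lb_pullback f (lb_O1 k n)).

(* K is the bundle of top-degree forms: a top-degree form is s_i dx_i on
   lb_cov i, where dx_i = dx_(i,1) /\ ... /\ dx_(i,d), and if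
   dx_(j,b) = \sum_a A_(b,a) dx_(i,a) then dx_j = \det A dx_i, so that
   s_i = \det A * s_j. *)
Definition canonical_bundle (k : fieldType) (S : kspace k)
    (K : line_bundle S) : Prop :=
  exists2 d, krull_dim S d &
  exists x : lb_idx K -> 'I_d -> S -> k,
    [/\ forall i a, reg S (lb_cov i) (x i a),
        forall i p, lb_cov i p -> local_coordinates p (x i) &
        forall i j p (A : 'M[k]_d), lb_cov i p -> lb_cov j p ->
          (forall b, diff_expand p (x i) (x j b) (row b A)) ->
          lb_trans i j p = \det A].

(* M = O(D) for the effective Cartier divisor D with local equations s_i = 0;
   the s_i are nonzero on every nonempty open set, i.e. nonzerodivisors. *)
Definition effective_divisor_bundle (k : fieldType) (S : kspace k)
    (M : line_bundle S) : Prop :=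
  exists s : lb_idx M -> S -> k,
    [/\ forall i, reg S (lb_cov i) (s i),
        forall i (W : set S), open W -> W !=set0 -> W `<=` lb_cov i ->
          exists2 p, W p & s i p != 0 &
        forall i j p, lb_cov i p -> lb_cov j p ->
          s i p = lb_trans i j p * s j p].

(* P is the product of S and T in the category of quasi-projective spaces *)
Definition is_product (k : fieldType) (S T P : kspace k)
    (pS : morphism P S) (pT : morphism P T) : Prop :=
  quasi_projective P /\
  forall (Z : kspace k), quasi_projective Z ->
    forall (f : morphism Z S) (g : morphism Z T),
      (exists h : morphism Z P, forall z, pS (h z) = f z /\ pT (h z) = g z) /\
      (forall h h' : morphism Z P,
         (forall z, pS (h z) = pS (h' z) /\ pT (h z) = pT (h' z)) -> h =1 h').

(* L1 and L2 are the fibres over two points t1, t2 of a variety T of a line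
   bundle E on S x T; f_i is the inclusion of S x {t_i}. *)
Definition alg_equiv (k : fieldType) (S : kspace k) (L1 L2 : line_bundle S) : Prop :=
  exists (T P : kspace k) (pS : morphism P S) (pT : morphism P T)
    (E : line_bundle P) (t1 t2 : T) (f1 f2 : morphism S P),
  [/\ quasi_projective T /\ irreducible_set [set: T], is_product pS pT,
      forall q, pS (f1 q) = q /\ pT (f1 q) = t1,
      forall q, pS (f2 q) = q /\ pT (f2 q) = t2 &
      lb_iso (lb_pullback f1 E) L1 /\ lb_iso (lb_pullback f2 E) L2].

(* phi induces a group homomorphism NS(S) = Pic(S)/(algebraic equivalence) -> W *)
Definition NS_hom (k : fieldType) (S : kspace k) (W : zmodType)
    (phi : line_bundle S -> W) : Prop :=
  (forall L M, phi (lb_tensor L M) = phi L + phi M) /\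
  (forall L M, alg_equiv L M -> phi L = phi M).

(* 'rV[R]_r, together with the class map c, is the tensor product of NS(S) with
   R, by the universal property of extension of scalars. *)
Definition NS_space (R : realType) (k : fieldType) (S : kspace k) (r : nat)
    (c : line_bundle S -> 'rV[R]_r) : Prop :=
  NS_hom c /\
  forall (W : lmodType R) (phi : line_bundle S -> W), NS_hom phi ->
    (exists psi : {linear 'rV[R]_r -> W}, forall L, psi (c L) = phi L) /\
    (forall psi psi' : {linear 'rV[R]_r -> W},
       (forall L, psi (c L) = psi' (c L)) -> psi =1 psi').

Definition effective_cone (R : realType) (k : fieldType) (S : kspace k) (r : nat)
    (c : line_bundle S -> 'rV[R]_r) : set 'rV[R]_r :=
  [set v | exists m (a : 'I_m -> R) (M : 'I_m -> line_bundle S),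
     [/\ forall i, 0 <= a i, forall i, effective_divisor_bundle (M i) &
         v = \sum_(i < m) a i *: c (M i)]].

Definition psef_cone (R : realType) (k : fieldType) (S : kspace k) (r : nat)
    (c : line_bundle S -> 'rV[R]_r) : set 'rV[R]_r :=
  closure (effective_cone c).

(* a(S, L) = t, for S smooth projective; that NS(S, R) has finite dimension r
   is the theorem of the base. *)
Definition is_a_smooth (R : realType) (k : fieldType) (S : kspace k)
    (L : line_bundle S) (t : R) : Prop :=
  exists r (c : line_bundle S -> 'rV[R]_r) (K : line_bundle S),
    [/\ NS_space c, canonical_bundle K,
        psef_cone c (t *: c L + c K) &
        forall s, psef_cone c (s *: c L + c K) -> t <= s].

Definition birational (k : fieldType) (S T : kspace k) (f : morphism S T) : Prop :=
  exists U : set S,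
    [/\ open U, U !=set0, {in U &, injective f} &
        forall W : set S, open W -> W `<=` U ->
          open (f @` W) /\
          forall h, reg S W h ->
            exists2 g, reg T (f @` W) g & forall p, W p -> h p = g (f p)].

Definition resolution (k : fieldType) (S T : kspace k) (f : morphism S T) : Prop :=
  [/\ projective_variety S, smooth_variety S & birational f].

(* a(Y, L) = t, for Y a possibly singular projective variety *)
Definition is_a (R : realType) (k : fieldType) (Y : kspace k)
    (L : line_bundle Y) (t : R) : Prop :=
  exists (Y' : kspace k) (f : morphism Y' Y),
    resolution f /\ is_a_smooth (lb_pullback f L) t.

(* Y is contained in the union of the V i, as sets of points of the scheme X:
   its points are the generic points of the irreducible closed sets P, and the
   generic point of P lies in a closed set Z iff P is a subset of Z.  (With
   closed points only, the condition would be void over a countable field.) *)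
Definition contained_in_union (X : topologicalType) (Y : set X)
    (V : nat -> set X) : Prop :=
  forall P : set X, closed P -> irreducible_set P -> P `<=` Y ->
    exists i, P `<=` V i.

(* Main.v *)
(** Write f : S -> X for a resolution of Y followed by the inclusion of Y in X.
    It suffices to show, when f(S) is not contained in any member of V, that
    K_S = f^*K_X + E with E effective and that f^* keeps a(X,L) L + K_X
    pseudo-effective. The second point holds as soon as V contains the supports
    of countably many effective divisors approximating a(X,L) L + K_X; pulling
    back numerical classes requires pulling back algebraic equivalences, hence
    products, which the Segre embedding provides.

    For the first point, let k0 be a countable subring of k over which X is
    defined, and let V contain all proper closed subsets of X cut out over k0. If
    k is uncountable, some point q of S has f(q) outside V and f an immersion at
    q. A derivation D of k killing k0 gives at every point p of X a tangent
    vector D(p), the derivative of its coordinates. With d = dim S and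
    d + e = dim X, the determinant whose columns are the image of T_q S and
    D_1(f(q)), ..., D_e(f(q)) is a regular section of K_S - f^*K_X: locally each
    D_c lifts to the structure sheaf of S, so D_c(f(q)) is regular modulo T_q S.
    At a point f(q) generic over k0 the vectors D(f(q)) exhaust the tangent
    space, because derivations extend to k in characteristic zero; so D_1, ...,
    D_e can be chosen to make the section nonzero. If k is countable, take
    k0 = k; then Y = X and e = 0. *)
Require Import Defs.
From mathcomp Require Import all_boot all_order all_algebra.
From mathcomp Require Import all_classical all_reals all_analysis.
From mathcomp Require mpoly.
From mathcomp Require Import ring zify.
Import -(notations) mpoly.
Set Implicit Arguments.
Unset Strict Implicit.
Unset Printing Implicit Defensive.
Import Order.TTheory GRing.Theory Num.Theory.
Local Open Scope classical_set_scope.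
Local Open Scope ring_scope.

(** * Germs of regular functions and cotangent expansions *)

(** The determinant encodes a deformation argument. As X is defined over the constants of D, the
    conjugate of Y under the infinitesimal automorphism 1 + eps D of k is a first-order deformation
    of Y inside X, and q |-> D(f(q)) modulo T_q S is its section of the normal sheaf of f. Where f
    is an immersion, K_S - f^*K_X is the determinant of that sheaf, so e normal sections independent
    at one point give a nonzero section of it. Derivations of the ground field thus take the place
    of families of subvarieties sweeping out X, and no parameter space of subvarieties has to be
    constructed.

    The obstacle is that q |-> D(h(q)) is not regular, D not being k-linear. It is corrected twice.
    On X, subtracting the effect of D on the coefficients of h ([Dgerm]) leaves a k-linear tangent
    vector ([tau]). On S, the remaining irregular part is a combination of the D(y_b(q)), y_b local
    coordinates, and such a combination lies along T_q S, hence disappears from the determinant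
    ([jac_reg]). *)

Section Germs.
Variables (k : fieldType) (S : kspace k).
Implicit Types (p q : S) (f g h : S -> k) (U W : set S).

Lemma near_open p (P : set S) :
  (\forall q \near p, P q) <-> exists W, [/\ open W, W p & W `<=` P].
Proof.
rewrite /prop_near1 nbhsE /=; split.
  by case=> W [oW Wp] sW; exists W.
by case=> W [oW Wp sW]; exists W.
Qed.

Lemma near_of_open p U : open U -> U p -> \forall q \near p, U q.
Proof. by move=> oU Up; apply/near_open; exists U; split=> // q. Qed.

Lemma near_all p (P : set S) : (forall q, P q) -> \forall q \near p, P q.
Proof. by move=> h; apply: nearW. Qed.

Lemma near_sub p (P Q : set S) : (forall q, P q -> Q q) ->
  (\forall q \near p, P q) -> \forall q \near p, Q q.
Proof. by move=> h; apply: filterS. Qed.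

Lemma near_sub2 p (P Q R : set S) : (forall q, P q -> Q q -> R q) ->
  (\forall q \near p, P q) -> (\forall q \near p, Q q) -> \forall q \near p, R q.
Proof. by move=> h; apply: filterS2. Qed.

Lemma near_and p (P Q : set S) : (\forall q \near p, P q) ->
  (\forall q \near p, Q q) -> \forall q \near p, P q /\ Q q.
Proof. by apply: near_sub2. Qed.

Lemma near_near p (P : set S) :
  (\forall q \near p, P q) -> \forall q \near p, \forall r \near q, P r.
Proof.
move=> /near_open[W [oW Wp sW]]; apply/near_open; exists W; split=> // q Wq.
by apply/near_open; exists W.
Qed.

Lemma reg_atW U f p : open U -> reg S U f -> U p -> reg_at p f.
Proof. by move=> oU rf Up; exists U. Qed.

Lemma reg_of_at U f : open U -> (forall p, U p -> reg_at p f) -> reg S U f.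
Proof.
move=> oU h; apply: reg_local => // p /h[W [oW Wp rf]].
by exists W, f.
Qed.

Lemma reg_at_near p f : reg_at p f -> \forall q \near p, reg_at q f.
Proof.
by case=> U [oU Up rf]; apply/near_open; exists U; split=> // q Uq; exists U.
Qed.

Lemma reg_at_eq p f g : (\forall q \near p, f q = g q) -> reg_at p f -> reg_at p g.
Proof.
move=> /near_open[W [oW Wp eW]] [U [oU Up rf]].
have oUW := openI oU oW; exists (U `&` W); split=> //.
apply: reg_local => // q [Uq Wq]; exists U, f; split=> // r _ [_ Wr].
by rewrite eW.
Qed.

Lemma reg_at_cst p c : reg_at p (fun=> c).
Proof. by exists setT; split; [exact: openT| |exact/reg_cst/openT]. Qed.

Lemma reg_at_add p f g : reg_at p f -> reg_at p g -> reg_at p (fun q => f q + g q).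
Proof.
move=> [U [oU Up rf]] [W [oW Wp rg]]; have oUW := openI oU oW.
exists (U `&` W); split=> //; apply: reg_add => //.
  by apply: (@reg_sub _ _ U) => // q [].
by apply: (@reg_sub _ _ W) => // q [].
Qed.

Lemma reg_at_mul p f g : reg_at p f -> reg_at p g -> reg_at p (fun q => f q * g q).
Proof.
move=> [U [oU Up rf]] [W [oW Wp rg]]; have oUW := openI oU oW.
exists (U `&` W); split=> //; apply: reg_mul => //.
  by apply: (@reg_sub _ _ U) => // q [].
by apply: (@reg_sub _ _ W) => // q [].
Qed.

Lemma reg_at_opp p f : reg_at p f -> reg_at p (fun q => - f q).
Proof.
move=> rf; apply: (@reg_at_eq _ (fun q => -1 * f q)).
  by apply: nearW => q; rewrite mulN1r.
by apply: reg_at_mul => //; exact: reg_at_cst.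
Qed.

Lemma reg_at_sub p f g : reg_at p f -> reg_at p g -> reg_at p (fun q => f q - g q).
Proof. by move=> rf rg; apply: reg_at_add => //; exact: reg_at_opp. Qed.

Lemma reg_at_inv p f : reg_at p f -> f p != 0 -> reg_at p (fun q => (f q)^-1).
Proof.
move=> [U [oU Up rf]] nf; have [oV rV] := reg_inv oU rf.
by exists (U `&` [set p | f p != 0]).
Qed.

Lemma reg_at_neq0 p f : reg_at p f -> f p != 0 -> \forall q \near p, f q != 0.
Proof.
move=> [U [oU Up rf]] nf; have [oV rV] := reg_inv oU rf.
by apply/near_open; exists (U `&` [set p | f p != 0]); split=> // q [].
Qed.

Lemma reg_at_sum p (I : Type) (r : seq I) (P : pred I) (F : I -> S -> k) :
  (forall i, P i -> reg_at p (F i)) -> reg_at p (fun q => \sum_(i <- r | P i) F i q).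
Proof.
move=> rF; elim: r => [|i r IH].
  apply: (@reg_at_eq _ (fun=> 0)); last exact: reg_at_cst.
  by apply: nearW => q; rewrite /= big_nil.
apply: (@reg_at_eq _ (fun q => (if P i then F i q else 0) +
                               \sum_(i <- r | P i) F i q)).
  by apply: nearW => q; rewrite /= [in RHS]big_cons; case: (P i); rewrite ?add0r.
apply: reg_at_add => //; case Pi: (P i); [exact: rF | exact: reg_at_cst].
Qed.

Lemma reg_at_prod p (I : Type) (r : seq I) (P : pred I) (F : I -> S -> k) :
  (forall i, P i -> reg_at p (F i)) -> reg_at p (fun q => \prod_(i <- r | P i) F i q).
Proof.
move=> rF; elim: r => [|i r IH].
  apply: (@reg_at_eq _ (fun=> 1)); last exact: reg_at_cst.
  by apply: nearW => q; rewrite /= big_nil.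
apply: (@reg_at_eq _ (fun q => (if P i then F i q else 1) *
                               \prod_(i <- r | P i) F i q)).
  by apply: nearW => q; rewrite /= [in RHS]big_cons; case: (P i); rewrite ?mul1r.
apply: reg_at_mul => //; case Pi: (P i); [exact: rF | exact: reg_at_cst].
Qed.

Lemma reg_at_exp p f m : reg_at p f -> reg_at p (fun q => f q ^+ m).
Proof.
move=> rf; elim: m => [|m IH]; first exact: reg_at_cst.
apply: (@reg_at_eq _ (fun q => f q * f q ^+ m)); last exact: reg_at_mul.
by apply: nearW => q; rewrite exprS.
Qed.

Lemma reg_at_det m p (A : S -> 'M[k]_m) :
  (forall i j, reg_at p (fun q => A q i j)) -> reg_at p (fun q => \det (A q)).
Proof.
move=> rA; apply: reg_at_sum => s _; apply: reg_at_mul; first exact: reg_at_cst.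
by apply: reg_at_prod.
Qed.

(** By Cramer's formula the entries are cofactors divided by the determinant, which stays nonzero
    near p. *)
Lemma reg_at_invmx m p (A : S -> 'M[k]_m) :
  (forall i j, reg_at p (fun q => A q i j)) -> \det (A p) != 0 ->
  forall i j, reg_at p (fun q => invmx (A q) i j).
Proof.
move=> rA nA i j; have rd := reg_at_det rA.
apply: (@reg_at_eq _ (fun q => (\det (A q))^-1 * cofactor (A q) j i)).
  have := reg_at_neq0 rd nA; apply: filterS => q nq.
  by rewrite /invmx unitmxE unitfE nq !mxE.
apply: reg_at_mul; first exact: reg_at_inv.
apply: reg_at_mul; first exact: reg_at_cst.
apply: reg_at_det => a b; apply: (@reg_at_eq _ (fun q => A q (lift j a) (lift i b))).
  by apply: nearW => q; rewrite !mxE.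
exact: rA.
Qed.

Lemma reg_at_mulmx m1 m2 m3 p (A : S -> 'M[k]_(m1, m2)) (B : S -> 'M[k]_(m2, m3)) :
  (forall i j, reg_at p (fun q => A q i j)) ->
  (forall i j, reg_at p (fun q => B q i j)) ->
  forall i j, reg_at p (fun q => (A q *m B q) i j).
Proof.
move=> rA rB i j.
apply: (@reg_at_eq _ (fun q => \sum_l A q i l * B q l j)).
  by apply: nearW => q; rewrite mxE.
by apply: reg_at_sum => l _; exact: reg_at_mul.
Qed.

Lemma reg_at_meval n p (F : mpoly.mpoly n k) (x : S -> 'I_n -> k) :
  (forall i, reg_at p (fun q => x q i)) -> reg_at p (fun q => mpoly.meval (x q) F).
Proof.
move=> rx; apply: (@reg_at_eq _ (fun q => \sum_(m <- mpoly.msupp F)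
   mpoly.mcoeff m F * \prod_i x q i ^+ m i)).
  by apply: nearW => q; rewrite mpoly.mevalE.
apply: reg_at_sum => m _; apply: reg_at_mul; first exact: reg_at_cst.
by apply: reg_at_prod => i _; exact: reg_at_exp.
Qed.

Lemma in_max_sqP p f :
  (exists m, exists g h : 'I_m -> S -> k,
    (forall i, [/\ reg_at p (g i), reg_at p (h i), g i p = 0 & h i p = 0]) /\
    \forall q \near p, f q = \sum_(i < m) g i q * h i q) -> in_max_sq p f.
Proof.
move=> [m [g [h [rgh /near_open[W0 [oW0 W0p eW0]]]]]].
have [U [oU Up rU]] : exists U, [/\ open U, U p &
    forall i, reg S U (g i) /\ reg S U (h i)].
  have : \forall q \near p, forall i, reg_at q (g i) /\ reg_at q (h i).
    apply: filter_forall => i; have [rg rh _ _] := rgh i.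
    by apply: filterI; exact: reg_at_near.
  move=> /near_open[W [oW Wp sW]]; exists W; split=> // i.
  by split; apply: reg_of_at => // q Wq; case: (sW q Wq i).
have oUW := openI oU oW0.
exists (U `&` W0), m, g, h; split=> // [i|q [_ /eW0]//].
have [rg rh g0 h0] := rgh i; have [rg' rh'] := rU i.
by split=> //; apply: (@reg_sub _ _ U) => // q [].
Qed.

Lemma in_max_sqE p f : in_max_sq p f -> exists m, exists g h : 'I_m -> S -> k,
    (forall i, [/\ reg_at p (g i), reg_at p (h i), g i p = 0 & h i p = 0]) /\
    \forall q \near p, f q = \sum_(i < m) g i q * h i q.
Proof.
move=> [U [m [g [h [oU Up rgh fE]]]]]; exists m, g, h; split.
  by move=> i; have [rg rh g0 h0] := rgh i; split=> //; exists U.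
by apply/near_open; exists U.
Qed.

Lemma in_max_sq_eq p f g : (\forall q \near p, f q = g q) ->
  in_max_sq p f -> in_max_sq p g.
Proof.
move=> fg /in_max_sqE[m [a [b [rab e]]]]; apply: in_max_sqP; exists m, a, b; split=> //.
by apply: filterS2 fg e => q <-.
Qed.

Lemma in_max_sq_reg p f : in_max_sq p f -> reg_at p f.
Proof.
move=> /in_max_sqE[m [a [b [rab e]]]].
apply: (@reg_at_eq _ (fun q => \sum_(i < m) a i q * b i q)).
  by apply: filterS e.
by apply: reg_at_sum => i _; have [] := rab i => *; exact: reg_at_mul.
Qed.

Lemma in_max_sq0 p : in_max_sq p (fun=> 0).
Proof.
apply: in_max_sqP; exists 0%N, (fun _ _ => 0), (fun _ _ => 0); split; first by case.
by apply: nearW => q; rewrite big_ord0.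
Qed.

Lemma in_max_sq_add p f g :
  in_max_sq p f -> in_max_sq p g -> in_max_sq p (fun q => f q + g q).
Proof.
move=> /in_max_sqE[m [a [b [rab e]]]] /in_max_sqE[m' [a' [b' [rab' e']]]].
apply: in_max_sqP; exists (m + m')%N,
  (fun i => match fintype.split i with inl j => a j | inr j => a' j end),
  (fun i => match fintype.split i with inl j => b j | inr j => b' j end); split.
  by move=> i; case: (fintype.split i) => j.
apply: filterS2 e e' => q -> ->; rewrite big_split_ord /=; congr (_ + _).
  by apply: eq_bigr => i _; case: splitP => j /= => [/val_inj <- //|ij];
    have := ltn_ord i; rewrite ij ltnNge leq_addr.
apply: eq_bigr => i _; case: splitP => j /= => [ij|/addnI/val_inj<-//].
by have := ltn_ord j; rewrite -ij ltnNge leq_addr.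
Qed.

Lemma in_max_sq_mul p f g :
  reg_at p f -> in_max_sq p g -> in_max_sq p (fun q => f q * g q).
Proof.
move=> rf /in_max_sqE[m [a [b [rab e]]]].
apply: in_max_sqP; exists m, (fun i q => f q * a i q), b; split.
  move=> i; have [ra rb a0 b0] := rab i; split=> //; last by rewrite a0 mulr0.
  exact: reg_at_mul.
by apply: filterS e => q ->; rewrite mulr_sumr; apply: eq_bigr => i _; rewrite mulrA.
Qed.

Lemma in_max_sqM p f g : reg_at p f -> reg_at p g -> f p = 0 -> g p = 0 ->
  in_max_sq p (fun q => f q * g q).
Proof.
move=> rf rg f0 g0; apply: in_max_sqP; exists 1%N, (fun=> f), (fun=> g); split=> //.
by apply: nearW => q; rewrite big_ord1.
Qed.

Lemma in_max_sq_scale p c g : in_max_sq p g -> in_max_sq p (fun q => c * g q).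
Proof. by apply: in_max_sq_mul; exact: reg_at_cst. Qed.

Lemma in_max_sq_sum p (I : Type) (r : seq I) (F : I -> S -> k) :
  (forall i, in_max_sq p (F i)) -> in_max_sq p (fun q => \sum_(i <- r) F i q).
Proof.
move=> mF; elim: r => [|i r IH].
  by apply: in_max_sq_eq (in_max_sq0 p); apply: nearW => q; rewrite /= big_nil.
have := in_max_sq_add (mF i) IH; apply: in_max_sq_eq.
by apply: nearW => q; rewrite /= big_cons.
Qed.

Section Diff.
Variables (d : nat) (x : 'I_d -> S -> k).

Lemma diff_expand_eq p f g v : (\forall q \near p, f q = g q) ->
  diff_expand p x f v -> diff_expand p x g v.
Proof.
move=> fg; have := nbhs_singleton fg => fgp.
by apply: in_max_sq_eq; apply: filterS fg => q ->; rewrite fgp.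
Qed.

Lemma diff_expand_cst p c : diff_expand p x (fun=> c) 0.
Proof.
apply: in_max_sq_eq (in_max_sq0 p); apply: nearW => q.
by rewrite subrr big1 ?subrr // => i _; rewrite mxE mul0r.
Qed.

Lemma diff_expand_add p f g v w : diff_expand p x f v -> diff_expand p x g w ->
  diff_expand p x (fun q => f q + g q) (v + w).
Proof.
move=> ev ew; have := in_max_sq_add ev ew; apply: in_max_sq_eq; apply: nearW => q.
rewrite [in RHS](eq_bigr (fun a => v 0 a * (x a q - x a p) + w 0 a * (x a q - x a p))).
  by rewrite big_split /=; set s := \sum_(_ < _) _; set t := \sum_(_ < _) _; ring.
by move=> a _; rewrite mxE mulrDl.
Qed.

Lemma diff_expand_scale p c f v : diff_expand p x f v ->
  diff_expand p x (fun q => c * f q) (c *: v).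
Proof.
move=> ev; have := in_max_sq_scale c ev; apply: in_max_sq_eq; apply: nearW => q.
rewrite !mulrBr mulr_sumr; congr (_ - _).
by apply: eq_bigr => a _; rewrite mxE mulrA.
Qed.

Lemma diff_expand_sub p f g v w : diff_expand p x f v -> diff_expand p x g w ->
  diff_expand p x (fun q => f q - g q) (v - w).
Proof.
move=> ev /(diff_expand_scale (-1)) ew; have := diff_expand_add ev ew.
rewrite scaleN1r; apply: diff_expand_eq; apply: nearW => q.
by rewrite mulN1r.
Qed.

Lemma diff_expand_sum p (I : Type) (r : seq I) (F : I -> S -> k) (v : I -> 'rV[k]_d) :
  (forall i, diff_expand p x (F i) (v i)) ->
  diff_expand p x (fun q => \sum_(i <- r) F i q) (\sum_(i <- r) v i).
Proof.
move=> eF; elim: r => [|i r IH].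
  rewrite /= big_nil; apply: diff_expand_eq (diff_expand_cst p 0).
  by apply: nearW => q; rewrite /= big_nil.
rewrite /= big_cons; have := diff_expand_add (eF i) IH; apply: diff_expand_eq.
by apply: nearW => q; rewrite /= big_cons.
Qed.

(** Leibniz rule: the error term (f - f(p)) (g - g(p)) is a product of two germs vanishing at p. *)
Lemma diff_expand_mul p f g v w : reg_at p f -> reg_at p g ->
  diff_expand p x f v -> diff_expand p x g w ->
  diff_expand p x (fun q => f q * g q) (f p *: w + g p *: v).
Proof.
move=> rf rg ev ew.
have := in_max_sq_add (in_max_sq_add (in_max_sq_scale (f p) ew)
  (in_max_sq_scale (g p) ev))
  (in_max_sqM (reg_at_sub rf (reg_at_cst p (f p)))
              (reg_at_sub rg (reg_at_cst p (g p))) (subrr _) (subrr _)).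
apply: in_max_sq_eq; apply: nearW => q.
rewrite [in RHS](eq_bigr (fun a => f p * (w 0 a * (x a q - x a p)) +
                           g p * (v 0 a * (x a q - x a p)))); last first.
  by move=> a _; rewrite !mxE mulrDl !mulrA.
rewrite big_split /= -!mulr_sumr.
set s := \sum_(_ < _) _; set t := \sum_(_ < _) _.
ring.
Qed.

(** With u = f - f(p), one has 1/f - 1/f(p) = - u / f(p)^2 + u^2 / (f f(p)^2), and the last term
    lies in the square of the maximal ideal. *)
Lemma diff_expand_inv p f v : reg_at p f -> f p != 0 -> diff_expand p x f v ->
  diff_expand p x (fun q => (f q)^-1) (- (f p) ^- 2 *: v).
Proof.
move=> rf nf ev; have rfp := reg_at_sub rf (reg_at_cst p (f p)).
have := in_max_sq_add (in_max_sq_scale (- (f p) ^- 2) ev)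
  (in_max_sq_mul (reg_at_mul (reg_at_inv rf nf) (reg_at_cst p ((f p) ^- 2)))
    (in_max_sqM rfp rfp (subrr _) (subrr _))).
apply: in_max_sq_eq; apply: filterS (reg_at_neq0 rf nf) => q nq.
rewrite [in RHS](eq_bigr (fun a => (- (f p) ^- 2) * (v 0 a * (x a q - x a p)))); last first.
  by move=> a _; rewrite !mxE mulrA.
rewrite -mulr_sumr; set s := \sum_(_ < _) _.
by field; rewrite nq nf.
Qed.

Lemma diff_expand_coord p a : diff_expand p x (x a) (delta_mx 0 a).
Proof.
apply: in_max_sq_eq (in_max_sq0 p); apply: nearW => q.
rewrite (bigD1 a) //= big1 ?addr0 => [|b ba].
  by rewrite !mxE !eqxx mul1r subrr.
by rewrite !mxE eqxx (negbTE ba) mul0r.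
Qed.

Lemma diff_expand_reg p f v : (forall a, reg_at p (x a)) ->
  diff_expand p x f v -> reg_at p f.
Proof.
move=> rx /in_max_sq_reg rf.
have rs : reg_at p (fun q => \sum_(a < d) v 0 a * (x a q - x a p)).
  apply: reg_at_sum => a _; apply: reg_at_mul; first exact: reg_at_cst.
  exact/reg_at_sub/reg_at_cst.
have := reg_at_add (reg_at_add rf rs) (reg_at_cst p (f p)).
by apply: reg_at_eq; apply: nearW => q; rewrite subrK subrK.
Qed.

Lemma diff_expand_uniq p f v w : local_coordinates p x ->
  diff_expand p x f v -> diff_expand p x f w -> v = w.
Proof.
move=> [rx ux] ev ew; have [u [_ uu]] := ux f (diff_expand_reg rx ev).
by rewrite -(uu v ev) -(uu w ew).
Qed.

End Diff.

(** Chain rule. Neither family has to be a coordinate system, so it also applies to the redundant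
    affine coordinates of an embedding. *)
Lemma diff_expand_change p d e (x : 'I_d -> S -> k) (y : 'I_e -> S -> k) f v
    (A : 'M[k]_(d, e)) :
  diff_expand p x f v -> (forall a, diff_expand p y (x a) (row a A)) ->
  diff_expand p y f (v *m A).
Proof.
move=> ev eA.
have := in_max_sq_add ev (in_max_sq_sum (index_enum 'I_d)
  (fun a => in_max_sq_scale (v 0 a) (eA a))).
apply: in_max_sq_eq; apply: nearW => q.
have -> : \sum_(i < e) (v *m A) 0 i * (y i q - y i p) =
    \sum_(a < d) v 0 a * (\sum_(i < e) (row a A) 0 i * (y i q - y i p)).
  under [RHS]eq_bigr do rewrite mulr_sumr.
  rewrite exchange_big /=; apply: eq_bigr => b _.
  by rewrite mxE mulr_suml; apply: eq_bigr => a _; rewrite !mxE mulrA.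
under [X in _ + X]eq_bigr do rewrite mulrBr.
by rewrite sumrB; set s := \sum_(_ < _) _; set t := \sum_(_ < _) _; ring.
Qed.

End Germs.

Section Pullback.
Variables (k : fieldType) (S T : kspace k) (F : morphism S T).

Lemma near_pull p (P : set T) :
  (\forall r \near F p, P r) -> \forall q \near p, P (F q).
Proof.
move=> /near_open[W [oW Wp sW]]; apply/near_open; exists (F @^-1` W).
by split=> // [|q /sW//]; exact: mor_open.
Qed.

Lemma reg_at_pull p h : reg_at (F p) h -> reg_at p (h \o F).
Proof.
move=> [U [oU Up rh]]; exists (F @^-1` U); split=> //; first exact: mor_open.
exact: mor_reg.
Qed.

Lemma in_max_sq_pull p h : in_max_sq (F p) h -> in_max_sq p (h \o F).
Proof.
move=> /in_max_sqE[m [a [b [rab e]]]]; apply: in_max_sqP.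
exists m, (fun i => a i \o F), (fun i => b i \o F); split.
  by move=> i; have [ra rb a0 b0] := rab i; split=> //; exact: reg_at_pull.
exact: near_pull e.
Qed.

Lemma diff_expand_pull p d (x : 'I_d -> T -> k) h v :
  diff_expand (F p) x h v -> diff_expand p (fun a => x a \o F) (h \o F) v.
Proof. exact: in_max_sq_pull. Qed.

End Pullback.

(** * Projective space *)

Section ProjectivePoints.
Variables (k : fieldType) (n : nat).
Local Notation P := (proj_pt k n).
Local Notation poly := (mpoly.mpoly n.+1 k).
Implicit Types (v w : 'rV[k]_n.+1) (l : P) (G H : poly).

Definition hvec l : 'rV[k]_n.+1 := \row_i hcoord l i.

Lemma hvecE l : hvec l = vpick (sval l).
Proof. by apply/rowP => i; rewrite mxE. Qed.

Lemma hvec_neq0 l : hvec l != 0.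
Proof.
rewrite hvecE vpick0; apply/eqP => l0; have := svalP l.
by rewrite l0 dimv0.
Qed.

Lemma hcoord_neq0 l : exists i, hcoord l i != 0.
Proof. by have /rV0Pn[i] := hvec_neq0 l; rewrite mxE; exists i. Qed.

Lemma dim_point0 : \dim (<[(delta_mx 0 0 : 'rV[k]_n.+1)%R]>)%VS == 1%N.
Proof.
rewrite dim_vline (_ : delta_mx 0 0 != 0) //.
by apply/rV0Pn; exists 0; rewrite mxE !eqxx oner_neq0.
Qed.

(* [pline 0] is a junk value. *)
Definition pline v : P :=
  insubd (exist (fun l : {vspace 'rV[k]_n.+1} => \dim l == 1%N) _ dim_point0 : P)
    (<[v]>)%VS.

Lemma val_pline v : v != 0 -> sval (pline v) = (<[v]>)%VS.
Proof. by move=> nv; rewrite /pline; apply: insubdK; rewrite unfold_in /= dim_vline nv. Qed.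

Lemma hvec_pline v : v != 0 -> exists2 c, c != 0 & hvec (pline v) = c *: v.
Proof.
move=> nv; have := memv_pick (sval (pline v)); rewrite -hvecE val_pline //.
move=> /vlineP[c e]; exists c => //; apply: contraTneq (hvec_neq0 (pline v)) => c0.
by rewrite e c0 scale0r eqxx.
Qed.

Lemma hvecK l : pline (hvec l) = l.
Proof.
apply: val_inj; rewrite /= val_pline ?hvec_neq0 //.
apply/eqP; rewrite eqEdim dim_vline hvec_neq0 (eqP (svalP l)) leqnn andbT.
by rewrite -memvE hvecE memv_pick.
Qed.

Lemma pline_scale c v : c != 0 -> pline (c *: v) = pline v.
Proof.
move=> nc; rewrite /pline; congr insubd; apply/eqP; rewrite eqEsubv -!memvE.
rewrite memvZ ?memv_line //=.
by rewrite -[X in X \in _](scalerK nc) memvZ ?memv_line.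
Qed.

Lemma pline_hvecZ c l v : hvec l = c *: v -> pline v = l.
Proof.
move=> e; have nc : c != 0.
  by apply: contraTneq (hvec_neq0 l) => c0; rewrite e c0 scale0r eqxx.
by rewrite -(pline_scale v nc) -e hvecK.
Qed.

Lemma meval_homog d G c (v : 'I_n.+1 -> k) : homog d G ->
  mpoly.meval (fun i => c * v i) G = c ^+ d * mpoly.meval v G.
Proof.
move=> hG; rewrite !mpoly.mevalE mulr_sumr big_seq [RHS]big_seq.
apply: eq_bigr => m mG.
have <- : mpoly.mdeg m = d by exact: (mpoly.dhomog_mf hG mG).
rewrite mulrCA; congr (_ * _); rewrite mpoly.mdegE -prodrXr -big_split /=.
by apply: eq_bigr => i _; rewrite exprMn.
Qed.

Lemma heval_pline d G v : homog d G -> v != 0 -> exists2 c, c != 0 &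
  heval G (pline v) = c * mpoly.meval (fun i => v 0 i) G.
Proof.
move=> hG nv; have [c nc e] := hvec_pline nv; exists (c ^+ d); first exact: expf_neq0.
rewrite /heval -(meval_homog _ _ hG); apply: mpoly.meval_eq => i.
by have := congr1 (fun u : 'rV__ => u 0 i) e; rewrite !mxE.
Qed.

Lemma heval_ratio d G H v : homog d G -> homog d H -> v != 0 ->
  heval G (pline v) / heval H (pline v) =
  mpoly.meval (fun i => v 0 i) G / mpoly.meval (fun i => v 0 i) H.
Proof.
move=> hG hH nv; have [c nc e] := hvec_pline nv.
have E F : homog d F ->
    heval F (pline v) = c ^+ d * mpoly.meval (fun i => v 0 i) F.
  move=> hF; rewrite /heval -(meval_homog _ _ hF); apply: mpoly.meval_eq => i.
  by have := congr1 (fun u : 'rV__ => u 0 i) e; rewrite !mxE.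
by rewrite !E // -mulf_div divff ?mul1r // expf_neq0.
Qed.

Lemma homogX (i : 'I_n.+1) : homog 1 (mpoly.mpolyX k (mpoly.mnm1 i)).
Proof. by rewrite /homog mpoly.dhomogX; apply/eqP; exact: mpoly.mdeg1. Qed.

Lemma reg_at_ratio d G H (l : projsp k n) : homog d G -> homog d H -> heval H l != 0 ->
  @reg_at _ (projsp k n) l (fun m => heval G m / heval H m).
Proof.
move=> hG hH nH; exists [set m | heval H m != 0].
have oH := proj_open_neq0 hH; split=> // m nm.
by exists [set m | heval H m != 0], d, G, H; split.
Qed.

Lemma reg_at_proj (l : projsp k n) h : @reg_at _ (projsp k n) l h -> exists d G H,
  [/\ homog d G, homog d H &
      \forall m \near (l : projsp k n), heval H m != 0 /\ h m = heval G m / heval H m].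
Proof.
move=> [U [oU Ul rh]]; have [W [d [G [H [oW Wl [hG hH] e]]]]] := rh l Ul.
exists d, G, H; split=> //.
apply/near_open; exists (U `&` W); split=> [|//|m [Um Wm]]; last exact: e.
exact: openI.
Qed.

(** Affine coordinates of the chart where the [i0]-th homogeneous coordinate is nonzero, and 0
    outside it. All n+1 of them are kept, the [i0]-th being 1 on the chart, so that forms are
    evaluated without dehomogenizing. *)
Definition affc (i0 : 'I_n.+1) l (i : 'I_n.+1) : k := hcoord l i / hcoord l i0.

Lemma reg_at_affc i0 (l : projsp k n) i : hcoord l i0 != 0 ->
  @reg_at _ (projsp k n) l (fun m => affc i0 m i).
Proof.
move=> n0; have := @reg_at_ratio 1 _ _ l (homogX i) (homogX i0).
rewrite /heval mpoly.mevalXU => /(_ n0); apply: reg_at_eq.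
by apply: near_all => m; rewrite !mpoly.mevalXU.
Qed.

Lemma near_hcoord i0 (l : projsp k n) : hcoord l i0 != 0 ->
  \forall m \near (l : projsp k n), hcoord m i0 != 0.
Proof.
move=> n0; have o0 := proj_open_neq0 (homogX i0).
apply/near_open; exists [set m | heval (mpoly.mpolyX k (mpoly.mnm1 i0)) m != 0].
by split=> // [|m]; rewrite /= /heval mpoly.mevalXU.
Qed.

Lemma affc_neq0 i0 l : hcoord l i0 != 0 -> \row_i affc i0 l i != 0.
Proof.
move=> n0; apply/rV0Pn; exists i0; rewrite mxE /affc divff //.
exact: oner_neq0.
Qed.

Lemma heval_affc d G i0 l : homog d G -> hcoord l i0 != 0 ->
  heval G l = hcoord l i0 ^+ d * mpoly.meval (affc i0 l) G.
Proof.
move=> hG n0; rewrite -(meval_homog _ _ hG); apply: mpoly.meval_eq => i.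
by rewrite mulrC divfK.
Qed.

End ProjectivePoints.

(** * Morphisms to projective space and charts of immersed spaces *)

Section IntoProjective.
Variables (k : fieldType) (n : nat) (Z : kspace k).
Local Notation P := (projsp k n).

Lemma near_line (z0 : Z) (phi : Z -> 'rV[k]_n.+1) (U : set P) :
  (forall i, reg_at z0 (fun z => phi z 0 i)) -> phi z0 != 0 -> open U ->
  U (pline (phi z0)) -> \forall z \near z0, U (pline (phi z)).
Proof.
move=> rphi nphi; rewrite proj_openE => -[I [hI ->]] [G IG nG].
have [d hG] := hI G IG; have [c nc e] := heval_pline hG nphi.
have nG' : mpoly.meval (fun i => phi z0 0 i) G != 0.
  by apply: contraNneq nG; rewrite e => ->; rewrite mulr0.
have [i ni] : exists i, phi z0 0 i != 0 by apply/rV0Pn.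
apply: filterS2 (reg_at_neq0 (reg_at_meval G rphi) nG') (reg_at_neq0 (rphi i) ni).
move=> z nz ni'; exists G => //.
have nphiz : phi z != 0 by apply/rV0Pn; exists i.
by have [c' nc' ->] := heval_pline hG nphiz; rewrite mulf_neq0.
Qed.

(** A local lift [phi] of F to nonzero vectors turns a ratio of forms of equal degree into the ratio
    of their values on [phi], which is regular. *)
Lemma into_proj (F : Z -> P) :
  (forall z0, exists phi : Z -> 'rV[k]_n.+1,
     [/\ forall i, reg_at z0 (fun z => phi z 0 i), phi z0 != 0 &
         \forall z \near z0, F z = pline (phi z)]) ->
  exists m : morphism Z P, forall z, m z = F z.
Proof.
move=> hF.
have oF (W : set P) : open W -> open (F @^-1` W).
  move=> oW; rewrite openE => z0 Wz0.
  have [phi [rphi nphi e]] := hF z0.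
  have e0 := nbhs_singleton e.
  have Wp : W (pline (phi z0)) by rewrite -e0.
  by apply: filterS2 e (near_line rphi nphi oW Wp) => z /= ->.
have rF (W : set P) (g : P -> k) : open W -> reg P W g -> reg Z (F @^-1` W) (g \o F).
  move=> oW rg; apply: reg_of_at; first exact: oF.
  move=> z0 Wz0; have [phi [rphi nphi e]] := hF z0.
  have e0 := nbhs_singleton e.
  have [d [G [H [hG hH eg]]]] := reg_at_proj (reg_atW oW rg Wz0).
  have [V [oV Vz0 sV]] := (near_open _ _).1 eg.
  have [i ni] : exists i, phi z0 0 i != 0 by apply/rV0Pn.
  have Vp : V (pline (phi z0)) by rewrite -e0.
  apply: (@reg_at_eq _ _ _ (fun z => mpoly.meval (fun i => phi z 0 i) G /
                                 mpoly.meval (fun i => phi z 0 i) H)).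
    apply: filterS3 e (near_line rphi nphi oV Vp) (reg_at_neq0 (rphi i) ni).
    move=> z ez Vz niz; rewrite /= ez; have [_ ->] := sV _ Vz.
    by rewrite (heval_ratio hG hH) //; apply/rV0Pn; exists i.
  apply: reg_at_mul; first exact: reg_at_meval.
  apply: reg_at_inv; first exact: reg_at_meval.
  have [nH _] := sV _ Vp; have [c _ eH] := heval_pline hH nphi.
  by apply: contraNneq nH; rewrite eH => ->; rewrite mulr0.
by exists (Morphism oF rF).
Qed.

End IntoProjective.

Lemma immersion_germ (k : fieldType) (S T : kspace k) (F : morphism S T) p h :
  immersion F -> reg_at p h ->
  exists g, reg_at (F p) g /\ \forall q \near p, h q = g (F q).
Proof.
move=> [_ _ gF] [U [oU Up rh]].
have [W [g [oW Wp rg e]]] := gF U h oU rh p Up.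
exists g; split; first by exists W.
apply: filterS2 (near_of_open oU Up) (near_pull (near_of_open oW Wp)) => q.
exact: e.
Qed.

Section MorphismChart.
Variables (k : fieldType) (n : nat) (Z : kspace k) (F : morphism Z (projsp k n)).

Lemma reg_at_chart i0 i z0 : hcoord (F z0) i0 != 0 ->
  reg_at z0 (fun z => affc i0 (F z) i).
Proof. by move=> n0; exact: (reg_at_pull (reg_at_affc i n0)). Qed.

Lemma near_chart i0 z0 : hcoord (F z0) i0 != 0 ->
  \forall z \near z0, hcoord (F z) i0 != 0.
Proof. by move=> n0; exact: (near_pull (near_hcoord n0)). Qed.

Lemma immersion_ratio z0 h : immersion F -> reg_at z0 h ->
  exists d G H, [/\ homog d G, homog d H &
    \forall z \near z0, heval H (F z) != 0 /\ h z = heval G (F z) / heval H (F z)].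
Proof.
move=> iF /(immersion_germ iF)[g [rg e]].
have [d [G [H [hG hH e']]]] := reg_at_proj rg.
exists d, G, H; split=> //; apply: filterS2 e (near_pull e') => z -> [nH ->].
by split.
Qed.

Lemma immersion_affine z0 h i0 : immersion F -> reg_at z0 h ->
  hcoord (F z0) i0 != 0 ->
  exists G H, \forall z \near z0, mpoly.meval (affc i0 (F z)) H != 0 /\
    h z = mpoly.meval (affc i0 (F z)) G / mpoly.meval (affc i0 (F z)) H.
Proof.
move=> iF rh n0; have [d [G [H [hG hH e]]]] := immersion_ratio iF rh.
exists G, H; apply: filterS2 e (near_chart n0) => z [nH ->] nz.
rewrite (heval_affc hH nz) in nH *; rewrite (heval_affc hG nz).
move: nH; rewrite mulf_eq0 negb_or => /andP[nc nH]; split=> //.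
by rewrite -mulf_div divff // mul1r.
Qed.

End MorphismChart.

(** * Derivations of the ground field acting on functions *)

Section Derivations.
Variable k : fieldType.

(** D is a derivation of the ring k, not linear over k. It acts on values of functions, and
    [D (h q)] is in general not regular in q. *)
Definition derivation (D : k -> k) : Prop :=
  (forall a b, D (a + b) = D a + D b) /\ (forall a b, D (a * b) = a * D b + b * D a).

Variables (D : k -> k) (derD : derivation D).

Lemma der0 : D 0 = 0.
Proof. by have := derD.1 0 0; rewrite addr0 => /eqP; rewrite -subr_eq subrr => /eqP. Qed.

Lemma der1 : D 1 = 0.
Proof.
have := derD.2 1 1; rewrite !mul1r => /eqP.
by rewrite -subr_eq subrr => /eqP.
Qed.

Lemma derN a : D (- a) = - D a.
Proof. by apply/eqP; rewrite -addr_eq0 -derD.1 addrC subrr der0. Qed.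

Lemma derB a b : D (a - b) = D a - D b.
Proof. by rewrite derD.1 derN. Qed.

Lemma der_sum (I : Type) (r : seq I) (P : pred I) (F : I -> k) :
  D (\sum_(i <- r | P i) F i) = \sum_(i <- r | P i) D (F i).
Proof.
elim: r => [|i r IH]; first by rewrite !big_nil der0.
by rewrite !big_cons; case: (P i); rewrite // derD.1 IH.
Qed.

Lemma derV a : a != 0 -> D (a^-1) = - a ^- 2 * D a.
Proof.
move=> na; have := derD.2 a a^-1; rewrite divff // der1 => e.
apply: (mulfI na); apply/eqP; rewrite -subr_eq0; apply/eqP.
have -> : a * D a^-1 = - (a^-1 * D a).
  by apply/eqP; rewrite -addr_eq0 -e.
by field.
Qed.

End Derivations.

Lemma derivation0 (k : fieldType) : derivation (fun=> 0 : k).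
Proof. by split=> *; rewrite ?mulr0 ?addr0. Qed.

(** * Effect of a derivation of k on the values of regular functions *)

Section Presentation.
Variables (k : fieldType) (S : kspace k) (D : k -> k) (derD : derivation D).

Section Family.
Variables (m : nat) (z : 'I_m -> S -> k) (p : S).

(* [c] holds the partial derivatives of [h] in the coordinates [z], and [h0]
   measures what [D] does to the coefficients of [h]. *)
Definition pres_with (h : S -> k) (c : S -> 'rV[k]_m) (h0 : S -> k) : Prop :=
  [/\ reg_at p h, forall i, reg_at p (fun q => c q 0 i), reg_at p h0 &
      \forall q \near p, diff_expand q z h (c q) /\
        D (h q) = h0 q + \sum_i c q 0 i * D (z i q)].

Definition pres (h : S -> k) : Prop := exists c h0, pres_with h c h0.

Lemma pres_with_eq h g c h0 : (\forall q \near p, h q = g q) ->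
  pres_with h c h0 -> pres_with g c h0.
Proof.
move=> hg [rh rc r0 e]; split=> //; first exact: reg_at_eq rh.
apply: near_sub2 (near_near hg) e => q hgq [eq1 eq2]; split.
  exact: diff_expand_eq eq1.
by rewrite -(nbhs_singleton hgq).
Qed.

Lemma pres_eq h g : (\forall q \near p, h q = g q) -> pres h -> pres g.
Proof. by move=> e [c [h0 w]]; exists c, h0; exact: pres_with_eq w. Qed.

Lemma pres_cst a : pres (fun=> a).
Proof.
exists (fun=> 0), (fun=> D a); split=> [|i||]; try exact: reg_at_cst.
apply: near_all => q; split; first exact: diff_expand_cst.
by rewrite big1 ?addr0 // => i _; rewrite mxE mul0r.
Qed.

Lemma pres_coord i : reg_at p (z i) -> pres (z i).
Proof.
move=> rz; exists (fun=> delta_mx 0 i), (fun=> 0); split=> // [j||].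
- exact: reg_at_cst.
- exact: reg_at_cst.
apply: near_all => q; split; first exact: diff_expand_coord.
rewrite add0r (bigD1 i) //= big1 ?addr0 => [|j ji]; rewrite !mxE eqxx.
  by rewrite eqxx mul1r.
by rewrite (negbTE ji) mul0r.
Qed.

Lemma pres_add f g : pres f -> pres g -> pres (fun q => f q + g q).
Proof.
move=> [c [f0 [rf rc r0 e]]] [c' [g0 [rg rc' r0' e']]].
exists (fun q => c q + c' q), (fun q => f0 q + g0 q); split=> [|i||].
- exact: reg_at_add.
- by apply: reg_at_eq (reg_at_add (rc i) (rc' i)); apply: near_all => q; rewrite mxE.
- exact: reg_at_add.
apply: near_sub2 e e' => q [e1 e2] [e1' e2']; split; first exact: diff_expand_add.
rewrite derD.1 e2 e2' addrACA -big_split /=; congr (_ + _); apply: eq_bigr => i _.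
by rewrite mxE mulrDl.
Qed.

Lemma pres_with_mul f g c f0 c' g0 : pres_with f c f0 -> pres_with g c' g0 ->
  pres_with (fun q => f q * g q) (fun q => f q *: c' q + g q *: c q)
            (fun q => f q * g0 q + g q * f0 q).
Proof.
move=> [rf rc r0 e] [rg rc' r0' e']; split=> [|i||].
- exact: reg_at_mul.
- apply: reg_at_eq (reg_at_add (reg_at_mul rf (rc' i)) (reg_at_mul rg (rc i))).
  by apply: near_all => q; rewrite !mxE.
- by apply: reg_at_add; exact: reg_at_mul.
have rfg : \forall q \near p, reg_at q f /\ reg_at q g.
  by apply: near_sub2 (reg_at_near rf) (reg_at_near rg) => q.
apply: near_sub2 rfg (near_and e e') => q [rfq rgq] [[e1 e2] [e1' e2']].
split; first exact: diff_expand_mul.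
rewrite derD.2 e2 e2' !mulrDr !mulr_sumr addrACA -big_split /=; congr (_ + _).
by apply: eq_bigr => i _; rewrite !mxE mulrDl !mulrA.
Qed.

Lemma pres_mul f g : pres f -> pres g -> pres (fun q => f q * g q).
Proof. by move=> [c [f0 w]] [c' [g0 w']]; do 2 eexists; exact: pres_with_mul w w'. Qed.

Lemma pres_inv f : pres f -> f p != 0 -> pres (fun q => (f q)^-1).
Proof.
move=> [c [f0 [rf rc r0 e]]] nf.
have ri := reg_at_inv rf nf.
have r2 : reg_at p (fun q => - f q ^- 2).
  apply: reg_at_eq (reg_at_opp (reg_at_mul ri ri)); apply: near_all => q.
  by rewrite -expr2 exprVn.
exists (fun q => - f q ^- 2 *: c q), (fun q => - f q ^- 2 * f0 q); split=> // [i||].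
- by apply: reg_at_eq (reg_at_mul r2 (rc i)); apply: near_all => q; rewrite mxE.
- exact: reg_at_mul.
apply: near_sub2 (near_and (reg_at_neq0 rf nf) (reg_at_near rf)) e.
move=> q [nq rq] [e1 e2]; split; first exact: diff_expand_inv.
rewrite (derV derD nq) e2 mulrDr mulr_sumr; congr (_ + _).
by apply: eq_bigr => i _; rewrite mxE mulrA.
Qed.

Lemma pres_with_sum (n : nat) (F : 'I_n -> S -> k) c F0 :
  (forall i, pres_with (F i) (c i) (F0 i)) ->
  pres_with (fun q => \sum_i F i q) (fun q => \sum_i c i q) (fun q => \sum_i F0 i q).
Proof.
move=> w; split=> [|i||].
- by apply: reg_at_sum => i _; case: (w i).
- apply: (@reg_at_eq _ _ _ (fun q => \sum_j c j q 0 i)).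
    by apply: near_all => q; rewrite summxE.
  by apply: reg_at_sum => j _; case: (w j).
- by apply: reg_at_sum => i _; case: (w i).
have : \forall q \near p, forall i, diff_expand q z (F i) (c i q) /\
        D (F i q) = F0 i q + \sum_j c i q 0 j * D (z j q).
  by apply: filter_forall => i; case: (w i).
apply: near_sub => q H; split; first by apply: diff_expand_sum => i; case: (H i).
rewrite der_sum // (eq_bigr _ (fun i _ => (H i).2)) big_split /=; congr (_ + _).
rewrite exchange_big; apply: eq_bigr => j _.
by rewrite summxE mulr_suml.
Qed.

Lemma pres_sum (I : Type) (r : seq I) (F : I -> S -> k) :
  (forall i, pres (F i)) -> pres (fun q => \sum_(i <- r) F i q).
Proof.
move=> rF; elim: r => [|i r IH].
  by apply: pres_eq (pres_cst 0); apply: near_all => q; rewrite big_nil.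
apply: pres_eq (pres_add (rF i) IH).
by apply: near_all => q; rewrite big_cons.
Qed.

Lemma pres_prod (I : Type) (r : seq I) (F : I -> S -> k) :
  (forall i, pres (F i)) -> pres (fun q => \prod_(i <- r) F i q).
Proof.
move=> rF; elim: r => [|i r IH].
  by apply: pres_eq (pres_cst 1); apply: near_all => q; rewrite big_nil.
apply: pres_eq (pres_mul (rF i) IH).
by apply: near_all => q; rewrite big_cons.
Qed.

Lemma pres_exp f n : pres f -> pres (fun q => f q ^+ n).
Proof.
move=> rf; elim: n => [|n IH]; first exact: pres_cst.
by apply: pres_eq (pres_mul rf IH); apply: near_all => q; rewrite exprS.
Qed.

Lemma pres_meval n (F : mpoly.mpoly n k) (x : S -> 'I_n -> k) :
  (forall i, pres (fun q => x q i)) -> pres (fun q => mpoly.meval (x q) F).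
Proof.
move=> rx; apply: (@pres_eq (fun q => \sum_(m <- mpoly.msupp F)
   mpoly.mcoeff m F * \prod_i x q i ^+ m i)).
  by apply: near_all => q; rewrite mpoly.mevalE.
apply: pres_sum => l; apply: pres_mul; first exact: pres_cst.
by apply: pres_prod => i; exact: pres_exp.
Qed.

(* The product rule makes the partial derivatives of g * h vanish at a common
   zero of g and h. *)
Lemma pres_max_sq h : (forall g, reg_at p g -> pres g) -> in_max_sq p h ->
  exists c h0, pres_with h c h0 /\ c p = 0.
Proof.
move=> allp /in_max_sqE[n [a [b [rab e]]]].
have ha i : {w : (S -> 'rV[k]_m) * (S -> k) | pres_with (a i) w.1 w.2}.
  by apply: cid; have [ra _ _ _] := rab i; have [c [h0 w]] := allp _ ra; exists (c, h0).
have hb i : {w : (S -> 'rV[k]_m) * (S -> k) | pres_with (b i) w.1 w.2}.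
  by apply: cid; have [_ rb _ _] := rab i; have [c [h0 w]] := allp _ rb; exists (c, h0).
have := pres_with_sum (fun i => pres_with_mul (svalP (ha i)) (svalP (hb i))).
move=> w; do 2 eexists; split; first by apply: pres_with_eq w; apply: near_sub e => q ->.
by rewrite /= big1 // => i _; have [_ _ -> ->] := rab i; rewrite !scale0r addr0.
Qed.

End Family.

(** Chain rule: the partial derivatives multiply as matrices, and the new regular remainder collects
    those of the z_i weighted by the partial derivatives of h. *)
Lemma pres_trans m n (z : 'I_m -> S -> k) (y : 'I_n -> S -> k) p h :
  pres z p h -> (forall i, pres y p (z i)) -> pres y p h.
Proof.
move=> [c [h0 [rh rc r0 e]]] pz.
have hz i : {w : (S -> 'rV[k]_n) * (S -> k) | pres_with y p (z i) w.1 w.2}.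
  by apply: cid; have [a [b w]] := pz i; exists (a, b).
pose A q : 'M[k]_(m, n) := \matrix_i (sval (hz i)).1 q.
have rA i j : reg_at p (fun q => A q i j).
  have [_ ra _ _] := svalP (hz i); apply: reg_at_eq (ra j).
  by apply: near_all => q; rewrite mxE.
exists (fun q => c q *m A q), (fun q => h0 q + \sum_i c q 0 i * (sval (hz i)).2 q).
split=> // [j||].
- by apply: reg_at_mulmx => // i l; rewrite (ord1 i).
- apply: reg_at_add => //; apply: reg_at_sum => i _; apply: reg_at_mul => //.
  by case: (svalP (hz i)).
have : \forall q \near p, forall i, diff_expand q y (z i) ((sval (hz i)).1 q) /\
        D (z i q) = (sval (hz i)).2 q + \sum_j (sval (hz i)).1 q 0 j * D (y j q).
  by apply: filter_forall => i; case: (svalP (hz i)).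
apply: near_sub2 e => q [e1 e2] H; split.
  by apply: diff_expand_change e1 _ => i; rewrite rowK; case: (H i).
rewrite e2 -addrA; congr (_ + _).
rewrite (eq_bigr (fun i => c q 0 i * (sval (hz i)).2 q +
   \sum_j c q 0 i * (A q i j * D (y j q)))); last first.
  by move=> i _; rewrite (H i).2 mulrDr mulr_sumr; congr (_ + _);
    apply: eq_bigr => j _; rewrite mxE.
rewrite big_split /=; congr (_ + _); rewrite exchange_big; apply: eq_bigr => j _.
by rewrite mxE mulr_suml; apply: eq_bigr => i _; rewrite mulrA.
Qed.

Section Affine.
Variables (n : nat) (e : morphism S (projsp k n)) (ie : immersion e).
Variables (p : S) (i0 : 'I_n.+1) (n0 : hcoord (e p) i0 != 0).
Let z (i : 'I_n.+1) : S -> k := fun q => affc i0 (e q) i.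

(** Through an immersion a germ is a ratio of polynomials in the affine coordinates, and [pres]
    contains constants and coordinates and is stable under the ring operations and inversion. *)
Lemma pres_affine h : reg_at p h -> pres z p h.
Proof.
move=> rh; have [G [H E]] := immersion_affine ie rh n0.
have pz i : pres z p (z i) by apply: pres_coord; exact: reg_at_chart.
apply: (@pres_eq _ _ _ (fun q => mpoly.meval (affc i0 (e q)) G *
   (mpoly.meval (affc i0 (e q)) H)^-1)).
  by apply: near_sub E => q [_ ->].
have [nH _] := nbhs_singleton E.
by apply: pres_mul; [|apply: pres_inv => //]; exact: pres_meval.
Qed.

(** A Nakayama argument. The error of the expansion of z_j in y at p lies in the square of the
    maximal ideal, so its partial derivatives in z form a matrix c vanishing at p. Hence (1 - c) dz
    = v dy at all points near p, with 1 - c invertible there, and the values of D on z and y satisfy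
    the same linear system up to a regular term. *)
Lemma pres_affine_local d (y : 'I_d -> S -> k) i :
  local_coordinates p y -> pres y p (z i).
Proof.
move=> [ry uy].
have rz j : reg_at p (z j) by exact: reg_at_chart.
have hv j : {v | diff_expand p y (z j) v}.
  by apply: cid; have [v [ev _]] := uy _ (rz j); exists v.
have hphi j : {w : (S -> 'rV[k]_n.+1) * (S -> k) |
    pres_with z p (fun q => z j q - z j p -
      \sum_(a < d) sval (hv j) 0 a * (y a q - y a p)) w.1 w.2 /\ w.1 p = 0}.
  apply: cid; have [c [h0 w]] := pres_max_sq pres_affine (svalP (hv j)).
  by exists (c, h0).
pose v : 'M[k]_(n.+1, d) := \matrix_j sval (hv j).
pose c q : 'M[k]_n.+1 := \matrix_j (sval (hphi j)).1 q.
pose f0 q : 'M[k]_(n.+1, 1) := \col_j (sval (hphi j)).2 q.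
(* [y0] gathers the regular part of D(z_j(q)): once D is applied to z_j = z_j(p) + sum of v_ja (y_a
   - y_a(p)) + error, only the terms in D(y_a(q)) and D(z_l(q)) remain outside it. *)
pose y0 q : 'M[k]_(n.+1, 1) := \col_j (f0 q j 0 + D (z j p) +
  \sum_a (y a q * D (v j a) - D (v j a * y a p))).
pose M q := 1%:M - c q.
have rc a b : reg_at p (fun q => c q a b).
  have [[_ r _ _] _] := svalP (hphi a); apply: reg_at_eq (r b).
  by apply: near_all => q; rewrite mxE.
have rM a b : reg_at p (fun q => M q a b).
  apply: reg_at_eq (reg_at_sub (reg_at_cst p ((1%:M : 'M[k]_n.+1) a b)) (rc a b)).
  by apply: near_all => q; rewrite !mxE.
have Mp : M p = 1%:M.
  apply/matrixP => a b; rewrite !mxE; have [_ ->] := svalP (hphi a).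
  by rewrite mxE subr0.
have dM : \det (M p) != 0 by rewrite Mp det1 oner_neq0.
have rI := reg_at_invmx rM dM.
have ry0 a b : reg_at p (fun q => y0 q a b).
  rewrite (ord1 b); have [[_ _ r _] _] := svalP (hphi a).
  apply: (@reg_at_eq _ _ _ (fun q => (sval (hphi a)).2 q + D (z a p) +
     \sum_l (y l q * D (v a l) - D (v a l * y l p)))).
    by apply: near_all => q; rewrite !mxE.
  apply: reg_at_add; first by apply: reg_at_add => //; exact: reg_at_cst.
  apply: reg_at_sum => l _; apply: reg_at_sub; last exact: reg_at_cst.
  by apply: reg_at_mul => //; exact: reg_at_cst.
exists (fun q => row i (invmx (M q) *m v)), (fun q => (invmx (M q) *m y0 q) i 0).
split=> // [j||].
- apply: (@reg_at_eq _ _ _ (fun q => (invmx (M q) *m v) i j)).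
    by apply: near_all => q; rewrite !mxE.
  by apply: reg_at_mulmx => // a b; exact: reg_at_cst.
- exact: reg_at_mulmx.
have E : \forall q \near p, forall j,
    diff_expand q z (fun q => z j q - z j p -
      \sum_(a < d) sval (hv j) 0 a * (y a q - y a p)) ((sval (hphi j)).1 q) /\
    D (z j q - z j p - \sum_(a < d) sval (hv j) 0 a * (y a q - y a p)) =
    (sval (hphi j)).2 q + \sum_l (sval (hphi j)).1 q 0 l * D (z l q).
  by apply: filter_forall => j; case: (svalP (hphi j)) => -[].
apply: near_sub2 E (reg_at_neq0 (reg_at_det rM) dM) => q E nM.
have uM : M q \in unitmx by rewrite unitmxE unitfE.
split.
  (* M dz = v dy modulo the square of the maximal ideal of q *)
  have E' j : in_max_sq q (fun r => \sum_l M q j l * (z l r - z l q) -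
      \sum_a v j a * (y a r - y a q)).
    have [E1 _] := E j; apply: in_max_sq_eq E1; apply: near_all => r.
    have -> : \sum_l M q j l * (z l r - z l q) =
       (z j r - z j q) - \sum_l (sval (hphi j)).1 q 0 l * (z l r - z l q).
      rewrite (eq_bigr (fun l => (j == l)%:R * (z l r - z l q) -
        (sval (hphi j)).1 q 0 l * (z l r - z l q))); last first.
        by move=> l _; rewrite !mxE mulrBl.
      rewrite sumrB; congr (_ - _); rewrite (bigD1 j) //= eqxx mul1r big1 ?addr0 //.
      by move=> l lj; rewrite eq_sym (negbTE lj) mul0r.
    have -> : \sum_a v j a * (y a r - y a q) =
        \sum_(a < d) sval (hv j) 0 a * (y a r - y a p) -
        \sum_(a < d) sval (hv j) 0 a * (y a q - y a p).
      by rewrite -sumrB; apply: eq_bigr => a _; rewrite mxE; ring.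
    set s := \sum_(_ < d) _; set t := \sum_(_ < d) _; set u := \sum_(_ < n.+1) _.
    by ring.
  have := in_max_sq_sum (index_enum 'I_n.+1)
    (fun j => in_max_sq_scale (invmx (M q) i j) (E' j)).
  apply: in_max_sq_eq; apply: near_all => r.
  pose zr := \col_l (z l r - z l q); pose yr := \col_a (y a r - y a q).
  transitivity ((invmx (M q) *m (M q *m zr - v *m yr)) i 0).
    rewrite [RHS]mxE; apply: eq_bigr => j _; congr (_ * _).
    by rewrite !mxE; congr (_ - _); apply: eq_bigr => l _; rewrite !mxE.
  rewrite mulmxBr !mulmxA mulVmx // mul1mx !mxE; congr (_ - _).
  by apply: eq_bigr => a _; rewrite !mxE.
(* The same system as for differentials, now for the values of D and with the inhomogeneous term
   [y0]. *)
pose dz : 'cV[k]_n.+1 := \col_l D (z l q); pose dy := \col_a D (y a q).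
suff e1 : M q *m dz = y0 q + v *m dy.
  have := congr1 (fun B => (invmx (M q) *m B) i 0) e1.
  rewrite mulmxA mulVmx // mul1mx mulmxDr mulmxA [LHS]mxE => ->.
  by rewrite [LHS]mxE; congr (_ + _); rewrite [LHS]mxE; apply: eq_bigr => a _; rewrite !mxE.
apply/matrixP => j b; rewrite (ord1 b).
have [_] := E j; rewrite !derB // der_sum // => E2.
rewrite mulmxBl mul1mx.
have -> : (dz - c q *m dz) j 0 = D (z j q) - \sum_l (sval (hphi j)).1 q 0 l * D (z l q).
  by rewrite !mxE; congr (_ - _); apply: eq_bigr => l _; rewrite !mxE.
have -> : D (z j q) = (sval (hphi j)).2 q +
    \sum_l (sval (hphi j)).1 q 0 l * D (z l q) + D (z j p) +
    \sum_(a < d) D (sval (hv j) 0 a * (y a q - y a p)).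
  by rewrite -E2; set s := \sum_(_ < d) _; ring.
rewrite !mxE; set s := \sum_(_ < n.+1) _.
rewrite (_ : \sum_(a < d) D _ = \sum_a (y a q * D (v j a) - D (v j a * y a p)) +
   \sum_a v j a * dy a 0); first by set t := \sum_(_ < d) _; set u := \sum_(_ < d) _; ring.
rewrite -big_split /=; apply: eq_bigr => a _.
rewrite !mxE mulrBr derB // (derD.2 (sval (hv j) 0 a) (y a q)); ring.
Qed.

End Affine.

(* Subtracting the terms in D(y_b) from D(h) leaves a regular function: this is
   the lift of D to the structure sheaf that kills the coordinates y_b. *)
Lemma pres_local n (e : morphism S (projsp k n)) d (y : 'I_d -> S -> k) p h :
  immersion e -> local_coordinates p y -> reg_at p h -> pres y p h.
Proof.
move=> ie ly rh; have [i0 n0] := hcoord_neq0 (e p).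
by apply: pres_trans (pres_affine ie n0 rh) _ => i; exact: pres_affine_local.
Qed.

End Presentation.

(** * Extension of derivations *)

(** [Zorn_bigcup] also tests the empty chain, whose union is empty; [Q] therefore admits the empty
    set beside the sets above [A0]. *)
Lemma Zorn_above (T : Type) (P : set (set T)) (A0 : set T) : P A0 ->
  (forall F : set (set T), F !=set0 -> (forall X, F X -> P X /\ A0 `<=` X) ->
     total_on F subset -> P (\bigcup_(X in F) X)) ->
  exists A, [/\ P A, A0 `<=` A & forall B, A `<=` B -> P B -> B `<=` A].
Proof.
move=> P0 Pch; pose Q (A : set T) := A = set0 \/ (P A /\ A0 `<=` A).
have [F FQ totF|A [QA maxA]] := @Zorn_bigcup T Q.
  pose F' := [set X | F X /\ (P X /\ A0 `<=` X)].
  have [/set0P[X0 F'X0]|F'0] := boolP (F' != set0); last first.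
    left; apply/seteqP; split=> // x [X FX Xx].
    case: (FQ X FX) => [X0|PX]; first by rewrite X0 in Xx.
    by move: F'0 => /negP; case; apply/set0P; exists X.
  have e : \bigcup_(X in F) X = \bigcup_(X in F') X.
    apply/seteqP; split=> x [X FX Xx]; last by exists X => //; case: FX.
    exists X => //; split=> //; case: (FQ X FX) => [X0'|//].
    by rewrite X0' in Xx.
  right; rewrite e; split.
    apply: Pch; [by exists X0 | by move=> X [] | ].
    by move=> X Y [FX _] [FY _]; exact: totF.
  by move=> x A0x; exists X0 => //; case: F'X0 => _ [_]; exact.
have {QA} [PA sA] : P A /\ A0 `<=` A.
  case: QA => // A_0; rewrite A_0.
  have A00 : A0 = set0.
    apply: contrapT => nA0; apply: (maxA A0); last by right; split.
    by rewrite A_0 properEneq; split=> //; apply/eqP => /esym.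
  by rewrite -A00; split=> // x.
exists A; split=> // B AB PB; apply: contrapT => nBA; apply: (maxA B).
  by split; [exact: AB | exact: nBA].
by right; split=> //; exact: subset_trans AB.
Qed.

Section DerivationExtension.
Variable k : fieldType.

(* The pair (a, a') stands for the dual number a + a' eps. The graph of a
   derivation of a subring is a subring of the dual numbers meeting the line
   through eps in 0. *)
Definition dmul (A : pzRingType) (a b : A * A) : A * A :=
  (a.1 * b.1, a.1 * b.2 + a.2 * b.1).

Definition dual_subring (G : set (k * k)) : Prop :=
  [/\ G (1, 0), forall a b, G a -> G b -> G (a.1 - b.1, a.2 - b.2) &
      forall a b, G a -> G b -> G (dmul a b)].

Definition vertical (G : set (k * k)) : Prop := forall b, G (0, b) -> b = 0.

Section Adjoin.
Variables (G : set (k * k)) (rG : dual_subring G).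

Let G0 : G (0, 0).
Proof. by case: rG => G1 GB _; have := GB _ _ G1 G1; rewrite /= !subrr. Qed.

Let GN a : G a -> G (- a.1, - a.2).
Proof. by case: rG => _ GB _ Ga; have := GB _ _ G0 Ga; rewrite /= !sub0r. Qed.

Let GD a b : G a -> G b -> G (a.1 + b.1, a.2 + b.2).
Proof.
case: rG => _ GB _ Ga /GN Gb; have := GB _ _ Ga Gb.
by rewrite /= !opprK.
Qed.

Let Gsum (I : Type) (r : seq I) (F : I -> k * k) : (forall i, G (F i)) ->
  G (\sum_(i <- r) (F i).1, \sum_(i <- r) (F i).2).
Proof.
move=> GF; elim: r => [|i r IH]; first by rewrite !big_nil.
by rewrite !big_cons; exact: (GD (GF i) IH).
Qed.

Let Gmuln a b n : G (a, b) -> G (a *+ n, b *+ n).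
Proof.
move=> Gab; elim: n => [|n IH]; first by rewrite !mulr0n.
by rewrite !mulrS; exact: GD Gab IH.
Qed.

(** The pair stands for the polynomial P.1 + P.2 eps over the dual numbers, with coefficients in
    G. *)
Definition dual_poly (P : {poly k} * {poly k}) : Prop :=
  forall i, G (P.1`_i, P.2`_i).

Let dpB P Q : dual_poly P -> dual_poly Q -> dual_poly (P.1 - Q.1, P.2 - Q.2).
Proof.
by move=> GP GQ i; rewrite /= !coefB; case: rG => _ GB _; exact: GB (GP i) (GQ i).
Qed.

Let dpM P Q : dual_poly P -> dual_poly Q -> dual_poly (dmul P Q).
Proof.
move=> GP GQ i; rewrite /= coefD !coefM -big_split /=.
apply: (@Gsum _ (index_enum _)
  (fun j : 'I_i.+1 => dmul (P.1`_j, P.2`_j) (Q.1`_(i - j), Q.2`_(i - j)))) => j.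
by case: rG => _ _ GM; exact: GM.
Qed.

Let dpC a : G a -> dual_poly (a.1%:P, a.2%:P).
Proof. by move=> Ga i; rewrite /= !coefC; case: (i == 0)%N => //; case: a Ga. Qed.

Let dpX j : dual_poly ('X^j, 0).
Proof. by move=> i; rewrite /= coef0 coefXn; case: eqP => // _; case: rG. Qed.

Let dpderiv P : dual_poly P -> dual_poly (P.1^`(), P.2^`()).
Proof.
move=> GP i; rewrite /= !coef_deriv.
exact: Gmuln (GP i.+1).
Qed.

(** The value of P.1 + P.2 eps at the dual number t + s eps, by Taylor expansion. *)
Definition dual_horner (t s : k) (P : {poly k} * {poly k}) : k * k :=
  (P.1.[t], P.2.[t] + P.1^`().[t] * s).

Lemma dual_hornerB t s P Q : dual_horner t s (P.1 - Q.1, P.2 - Q.2) =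
  ((dual_horner t s P).1 - (dual_horner t s Q).1,
   (dual_horner t s P).2 - (dual_horner t s Q).2).
Proof. by rewrite /dual_horner /= derivB !hornerE; congr pair; ring. Qed.

Lemma dual_hornerM t s P Q :
  dual_horner t s (dmul P Q) = dmul (dual_horner t s P) (dual_horner t s Q).
Proof. by rewrite /dual_horner /dmul /= derivM !hornerE; congr pair; ring. Qed.

Definition adjoin (t s : k) : set (k * k) :=
  [set a | exists2 P, dual_poly P & a = dual_horner t s P].

Lemma adjoin_subring t s : dual_subring (adjoin t s).
Proof.
split.
- exists (1%:P, 0%:P); first by apply: dpC (1, 0) _; case: rG.
  by rewrite /dual_horner /= derivC !hornerE ?mul0r ?addr0.
- move=> _ _ [P GP ->] [Q GQ ->]; rewrite -dual_hornerB.
  by eexists; first exact: dpB GP GQ.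
- move=> _ _ [P GP ->] [Q GQ ->]; rewrite -dual_hornerM.
  by eexists; first exact: dpM GP GQ.
Qed.

Lemma sub_adjoin t s : G `<=` adjoin t s.
Proof.
move=> a Ga; exists (a.1%:P, a.2%:P); first exact: dpC.
by rewrite /dual_horner /= derivC !hornerE ?mul0r ?addr0; case: a Ga.
Qed.

Lemma adjoin_gen t s : adjoin t s (t, s).
Proof.
exists ('X^1, 0); first exact: dpX.
by rewrite /dual_horner /= expr1 derivX !hornerE ?mul1r ?add0r.
Qed.

Hypothesis char0 : [pchar k] =i pred0.

(** If t is transcendental over the first components of G, the value s is free and 0 is taken. If t
    is algebraic, s is forced by a dual polynomial P of minimal degree with P.1(t) = 0, and
    pseudo-division by P shows that every other relation respects this choice. *)
Lemma exists_adjoin t : vertical G -> exists s, vertical (adjoin t s).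
Proof.
move=> vG.
have [[P0 [GP0 nP0 rP0]]|nP] := pselect (exists P : {poly k} * {poly k},
    [/\ dual_poly P, P.1 != 0 & P.1.[t] = 0]); last first.
  exists 0 => b [Q GQ [e ->]]; have Q0 : Q.1 = 0.
    by apply: contrapT => nQ; apply: nP; exists Q; split=> //; apply/eqP.
  have -> : Q.2 = 0.
    by apply/polyP => i; rewrite coef0; apply: vG; have := GQ i; rewrite Q0 coef0.
  by rewrite hornerE ?mulr0 ?addr0.
pose B n := `[< exists P : {poly k} * {poly k},
    [/\ dual_poly P, P.1 != 0, P.1.[t] = 0 & size P.1 = n] >].
have exB : exists n, B n by exists (size P0.1); apply/asboolP; exists P0.
case: (ex_minnP exB) => n /asboolP[P [GP nP rP sP]] minP.
have sP1 : (1 < size P.1)%N.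
  rewrite ltnNge; apply/negP => /size1_polyC e.
  by move: rP nP; rewrite e hornerC => ->; rewrite eqxx.
(* Otherwise the derivative of P, nonzero in characteristic zero, would contradict minimality. *)
have nd : P.1^`().[t] != 0.
  apply/eqP => rd.
  have nd : P.1^`() != 0.
    apply/eqP => /(congr1 (fun p : {poly k} => p`_(size P.1).-2)).
    rewrite coef_deriv coef0 prednK; last by move: sP1; case: (size P.1) => [|[]].
    rewrite -mulr_natr => /eqP; rewrite mulf_eq0 => /orP[].
      have := nP; rewrite -lead_coef_eq0 lead_coefE => /negbTE.
      by case: (size P.1) sP1 => [|[|m]] //= _ ->.
    have /pcharf0P -> := char0.
    by case: (size P.1) sP1 => [|[|m]].
  have /minP : B (size P.1^`()).
    by apply/asboolP; exists (P.1^`(), P.2^`()); split=> //; exact: dpderiv.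
  by rewrite leqNgt -sP lt_size_deriv.
(* The only s for which P vanishes at t + s eps. *)
pose s := - P.2.[t] / P.1^`().[t]; exists s.
have vP : (dual_horner t s P).2 = 0 by rewrite /= mulrC divfK // subrr.
suff H m (Q : {poly k} * {poly k}) : (size Q.1 <= m)%N -> dual_poly Q -> Q.1.[t] = 0 ->
    (dual_horner t s Q).2 = 0.
  by move=> b [Q GQ [e ->]]; exact: (H (size Q.1)).
elim: m Q => [|m IH] Q sQ GQ rQ; have [Q0|nQ] := eqVneq Q.1 0.
- have Q2 : Q.2 = 0.
    by apply/polyP => i; rewrite coef0; apply: vG; have := GQ i; rewrite Q0 coef0.
  by rewrite /= Q0 Q2 derivC !hornerE ?mul0r ?addr0.
- by move: sQ; rewrite leqn0 size_poly_eq0 (negbTE nQ).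
- have Q2 : Q.2 = 0.
    by apply/polyP => i; rewrite coef0; apply: vG; have := GQ i; rewrite Q0 coef0.
  by rewrite /= Q0 Q2 derivC !hornerE ?mul0r ?addr0.
(* A pseudo-division step cancels the leading term of Q, P being a dual
   polynomial of minimal degree among those vanishing at t + s eps. *)
have leP : (size P.1 <= size Q.1)%N.
  by rewrite sP; apply: minP; apply/asboolP; exists Q.
pose c := (P.1`_(size P.1).-1, P.2`_(size P.1).-1).
pose l := (Q.1`_(size Q.1).-1, Q.2`_(size Q.1).-1).
pose Q' := dmul (c.1%:P, c.2%:P) Q.
pose P' := dmul (l.1%:P, l.2%:P) (dmul ('X^(size Q.1 - size P.1), 0) P).
have GQ' : dual_poly Q' by apply: dpM => //; apply: dpC; exact: GP.
have GP' : dual_poly P'.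
  by apply: dpM; [apply: dpC; exact: GQ | apply: dpM => //; exact: dpX].
have nc : c.1 != 0 by rewrite /= -lead_coefE lead_coef_eq0.
have hC a : dual_horner t s (a.1%:P, a.2%:P) = a.
  by rewrite /dual_horner /= derivC !hornerC mul0r addr0; case: a.
have hP : dual_horner t s P = (0, 0) by rewrite [LHS]surjective_pairing vP /= rP.
have hQ : (dual_horner t s Q).1 = 0 by [].
have E : (dual_horner t s (Q'.1 - P'.1, Q'.2 - P'.2)).2 =
    c.1 * (dual_horner t s Q).2.
  rewrite dual_hornerB !dual_hornerM !hC hP /dmul hQ.
  by rewrite [LHS]/= !mulr0 !addr0 ?mulr0 ?subr0.
apply: (mulfI nc); rewrite mulr0 -E; apply: IH; last 2 first.
- exact: dpB.
- by rewrite [LHS]/= hornerD hornerN !hornerM rP rQ !mulr0 subrr.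
rewrite -ltnS; apply: leq_trans sQ.
rewrite -[X in (_ < X)%N]prednK ?size_poly_gt0 // ltnS.
apply/leq_sizeP => j; rewrite coefB !coefCM coefXnM.
have sQE : (size Q.1).-1.+1 = size Q.1 by rewrite prednK // size_poly_gt0.
have sPE : (size P.1).-1.+1 = size P.1 by rewrite prednK // size_poly_gt0.
rewrite leq_eqVlt => /orP[/eqP <-|lj].
  rewrite ifF; last by apply/negbTE; rewrite -leqNgt; lia.
  rewrite (_ : ((size Q.1).-1 - (size Q.1 - size P.1))%N = (size P.1).-1); last by lia.
  by rewrite /= mulrC subrr.
rewrite [Q.1`_j]nth_default; last by rewrite -sQE.
rewrite ifF; last by apply/negbTE; lia.
rewrite [P.1`_(j - _)]nth_default ?mulr0 ?subrr //.
move: leP; rewrite -sQE; clear -lj; move: (size Q.1).-1 (size P.1) lj => a b; lia.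
Qed.

End Adjoin.

(** A maximal vertical subring above [G0] has a pair over every t, since t can be adjoined; it is
    then the graph of a function on k, and the subring axioms make that function a derivation. *)
Lemma extend_derivation (char0 : [pchar k] =i pred0) (G0 : set (k * k)) :
  dual_subring G0 -> vertical G0 ->
  exists D : k -> k, derivation D /\ forall a b, G0 (a, b) -> D a = b.
Proof.
move=> rG0 vG0.
have [|F [X0 FX0] FP totF|G [[rG vG] sG maxG]] :=
    @Zorn_above _ (fun G => dual_subring G /\ vertical G) G0; first by [].
  have ub X Y a b : F X -> F Y -> X a -> Y b -> exists Z, [/\ F Z, Z a & Z b].
    move=> FX FY Xa Yb; have [XY|YX] := totF X Y FX FY.
      by exists Y; split=> //; exact: XY.
    by exists X; split=> //; exact: YX.
  split; first split.
  - by exists X0 => //; case: (FP X0 FX0) => -[[]].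
  - move=> a b [X FX Xa] [Y FY Yb]; have [Z [FZ Za Zb]] := ub _ _ _ _ FX FY Xa Yb.
    by exists Z => //; case: (FP Z FZ) => -[[_ ZB _] _] _; exact: ZB.
  - move=> a b [X FX Xa] [Y FY Yb]; have [Z [FZ Za Zb]] := ub _ _ _ _ FX FY Xa Yb.
    by exists Z => //; case: (FP Z FZ) => -[[_ _ ZM] _] _; exact: ZM.
  - by move=> b [X FX Xb]; case: (FP X FX) => -[_ vX] _; exact: vX.
have ex t : exists s, G (t, s).
  have [s vs] := exists_adjoin rG char0 t vG; exists s.
  apply: (maxG _ (@sub_adjoin _ rG t s)); last exact: adjoin_gen.
  by split=> //; exact: adjoin_subring.
have [D GD] := choice ex.
have uG a b : G (a, b) -> D a = b.
  case: rG => _ GB _ Gb; apply/eqP; rewrite -subr_eq0; apply/eqP; apply: vG.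
  by have := GB _ _ (GD a) Gb; rewrite /= subrr.
exists D; split; last by move=> a b /sG/uG.
case: rG => G1 GB GM.
have GN a : G (- a, - D a).
  have := GB _ _ (GB _ _ G1 G1) (GD a); by rewrite /= !subrr !sub0r.
split=> a b; apply: uG.
  by have := GB _ _ (GD a) (GN b); rewrite /= !opprK.
by have := GM _ _ (GD a) (GD b); rewrite /dmul /= [D a * b]mulrC.
Qed.

End DerivationExtension.

(** * Very general points over an uncountable field *)

Section Baire.
Variables (k : closedFieldType).

Lemma irreducible_meet (T : topologicalType) (Z A B : set T) : irreducible_set Z ->
  open A -> open B -> Z `&` A !=set0 -> Z `&` B !=set0 -> Z `&` (A `&` B) !=set0.
Proof.
move=> [_ iZ] oA oB [a [Za Aa]] [b [Zb Bb]]; apply: contrapT => nAB.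
have cov : Z `<=` ~` A `|` ~` B.
  move=> z Zz; apply: contrapT => h; apply: nAB; exists z; split=> //.
  by split; apply: contrapT => h'; apply: h; [left|right].
have [/(_ a Za)|/(_ b Zb)] := iZ _ _ (open_closedC oA) (open_closedC oB) cov;
  exact.
Qed.

Lemma uncountable_fiber (T : Type) (C : countType) (f : T -> C) :
  ~ countable [set: T] -> exists v, infinite_set (f @^-1` [set v]).
Proof.
move=> unc; apply: contrapT => nf; apply: unc.
have -> : [set: T] = \bigcup_(v in [set: C]) (f @^-1` [set v]).
  by apply/seteqP; split=> // t _; exists (f t).
apply: bigcup_countable; first exact: countableP.
by move=> v _; apply/finite_set_countable; apply: contrapT => h; apply: nf; exists v.
Qed.

Variables (n : nat) (i0 : 'I_n.+1).
Local Notation P := (projsp k n).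
Local Notation poly := (mpoly.mpoly n.+1 k).
Local Notation varX i := (mpoly.mpolyX k (mpoly.mnm1 i) : poly).

Definition mideal (J : set poly) : Prop :=
  (forall F G, J F -> J G -> J (F + G)) /\ (forall F G, J G -> J (F * G)).

Definition mprime (J : set poly) : Prop :=
  mideal J /\ (forall F G, J (F * G) -> J F \/ J G).

(** [msize] at most d means degree below d; one polynomial more than the number r of monomials of
    degree below d forces a linear relation. *)
Lemma mpoly_dependent d : exists N, forall A : 'I_N -> poly,
  (forall j, (mpoly.msize (A j) <= d)%N) ->
  exists a : 'I_N -> k, (exists j, a j != 0) /\ \sum_j a j *: A j = 0.
Proof.
pose B := mpoly.bmultinom n.+1 d.
pose r := #|{: B}|; exists r.+1 => A sA.
pose M : 'M[k]_(r.+1, r) := \matrix_(j, b) mpoly.mcoeff (mpoly.bmnm (enum_val b)) (A j).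
have nM : kermx M != 0.
  by rewrite -mxrank_eq0 mxrank_ker subn_eq0 -ltnNge ltnS rank_leq_col.
have [j nj] : exists j, row j (kermx M) != 0.
  apply: contrapT => h; case/eqP: nM; apply/row_matrixP => j; rewrite row0.
  by apply: contrapT => /eqP nj; apply: h; exists j.
exists (fun l => row j (kermx M) 0 l); split; first by apply/rV0Pn.
apply/mpoly.mpolyP => m; rewrite linear_sum /= mpoly.mcoeff0.
have [sm|sm] := ltnP (mpoly.mdeg m) d; last first.
  apply: big1 => l _; rewrite mpoly.mcoeffZ mpoly.memN_msupp_eq0 ?mulr0 //.
  by apply: mpoly.msize_mdeg_ge; exact: leq_trans (sA l) sm.
have := congr1 (fun N => row j N 0 (enum_rank (mpoly.BMultinom sm : B))) (mulmx_ker M).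
rewrite row_mul row0 !mxE => E; rewrite -[RHS]E; apply: eq_bigr => l _.
by rewrite mpoly.mcoeffZ !mxE enum_rankK.
Qed.

Section MaximalIdeal.
Variables (J : set poly) (pJ : mprime J) (G : nat -> poly).
Let M (s : seq nat) := \prod_(j <- s) G j.
Hypothesis JM : forall s, ~ J (M s).
Hypothesis maxJ : forall F, ~ J F -> exists s A, J (M s - A * F).
Hypothesis unc : ~ countable [set: k].

Let J0 : J !=set0 -> J 0.
Proof. by case=> F /(pJ.1.2 0); rewrite mul0r. Qed.

Let JN F : J F -> J (- F).
Proof. by move=> /(pJ.1.2 (-1)); rewrite mulN1r. Qed.

Let J1 : ~ J 1.
Proof. by have := @JM [::]; rewrite /M big_nil. Qed.

Let JC c : c != 0 -> ~ J c%:A.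
Proof.
move=> nc /(pJ.1.2 (c^-1)%:A); rewrite -scalerAl mul1r scalerA mulVf //.
by rewrite scale1r.
Qed.

Let JprodP (r : seq poly) : J (\prod_(F <- r) F) -> exists2 F, F \in r & J F.
Proof.
elim: r => [|F r IH]; first by rewrite big_nil => /J1.
rewrite big_cons => /pJ.2[JF|/IH[H Hr JH]].
  by exists F => //; rewrite mem_head.
by exists H => //; rewrite inE Hr orbT.
Qed.

(* Over an uncountable field the residue field of J, being of countable
   dimension over k, is k itself. *)
Lemma ideal_coordinate i : exists c, J (varX i - c%:A).
Proof.
apply: contrapT => nc.
have hc c : exists w : seq nat * poly, J (M w.1 - w.2 * (varX i - c%:A)).
  have [|s [A JA]] := @maxJ (varX i - c%:A); first by move=> h; apply: nc; exists c.
  by exists (s, A).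
have [w hw] := choice hc.
(* Uncountably many c share countably many pairs (product of the G_j, size of the cofactor), so
   infinitely many c have the same pair. *)
have [[s d] inf] := uncountable_fiber
  (fun c => ((w c).1, mpoly.msize (w c).2)) unc.
have [N dep] := mpoly_dependent d.
have [e [ie he]] : exists e : 'I_N -> k, injective e /\
    forall j, (w (e j)).1 = s /\ mpoly.msize (w (e j)).2 = d.
  have [B sB cB] := infinite_set_fset N inf.
  have lB (j : 'I_N) : (j < size (finmap.enum_fset B))%N by exact: leq_trans cB.
  exists (fun j : 'I_N => nth 0 (finmap.enum_fset B) j); split.
    move=> i1 i2 /eqP; rewrite nth_uniq ?finmap.fset_uniq // => /eqP.
    exact: val_inj.
  by move=> j; have /= [] := sB _ (mem_nth 0 (lB j)).
have [a [[j0 nj0] sum0]] := dep (fun j => (w (e j)).2) (fun j => eq_leq (he j).2).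
(* The numerator of the sum of a_j / (X - e_j). It is nonzero at e_j0, and its value at x_i times M
   s lies in J because the cofactors A_j, which behave as M s / (x_i - e_j) modulo J, satisfy the
   relation with coefficients a_j. *)
pose g : {poly k} := \sum_(j < N) a j *: \prod_(l < N | l != j) ('X - (e l)%:P).
have ng : g != 0.
  apply/eqP => /(congr1 (horner^~ (e j0))); rewrite /g horner_sum horner0.
  rewrite (bigD1 j0 isT) /= [X in _ + X]big1 ?addr0 => [|j jj0].
    rewrite hornerZ horner_prod => /eqP; rewrite mulf_eq0 (negbTE nj0) /=.
    apply/negP/prodf_neq0 => l lj0; rewrite hornerXsubC subr_eq0.
    by apply: contra lj0 => /eqP/ie ->.
  rewrite hornerZ horner_prod (bigD1 j0) /=; last by rewrite eq_sym.
  by rewrite hornerXsubC subrr mul0r mulr0.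
pose ev : {rmorphism {poly k} -> poly} := horner_alg (varX i).
have evX c : ev ('X - c%:P) = varX i - c%:A by rewrite /ev rmorphB /= horner_algX horner_algC.
have evZ c p : ev (c *: p) = c *: ev p by rewrite -mul_polyC rmorphM /= horner_algC mulr_algl.
have Jg : J (M s * ev g).
  have -> : M s * ev g = \sum_(j < N) a j *: ((M s - (w (e j)).2 * (varX i - (e j)%:A)) *
      ev (\prod_(l < N | l != j) ('X - (e l)%:P))) +
      (\sum_(j < N) a j *: (w (e j)).2) * ev (\prod_(l < N) ('X - (e l)%:P)).
    rewrite /g rmorph_sum /= mulr_sumr mulr_suml -big_split /=; apply: eq_bigr => j _.
    rewrite evZ -scalerAr -scalerAl -scalerDr; congr (_ *: _).
    have -> : ev (\prod_(l < N) ('X - (e l)%:P)) =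
        (varX i - (e j)%:A) * ev (\prod_(l < N | l != j) ('X - (e l)%:P)).
      by rewrite (bigD1 j) // rmorphM evX.
    by rewrite mulrBl mulrA subrK.
  rewrite sum0 mul0r addr0.
  have JZ j : J (a j *: ((M s - (w (e j)).2 * (varX i - (e j)%:A)) *
      ev (\prod_(l < N | l != j) ('X - (e l)%:P)))).
    rewrite -mpoly.mul_mpolyC mulrA [_ * ev _]mulrC mulrA; apply: pJ.1.2.
    by rewrite -{1}(he j).1; exact: hw.
  elim/big_ind: _ => //; first by apply: J0; eexists; exact: (hw 0).
  exact: pJ.1.1.
case/pJ.2: Jg => [/JM//|].
(* As k is algebraically closed, g splits, and primality puts one linear factor x_i - c in J. *)
have [rs Eg] := closed_field_poly_normal g.
rewrite Eg evZ -mpoly.mul_mpolyC => /pJ.2[].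
  by rewrite -mpoly.alg_mpolyC; apply: JC; rewrite lead_coef_eq0.
rewrite rmorph_prod /= -(big_map (fun z => ev ('X - z%:P)) xpredT id).
move=> /JprodP[F /mapP[c _ ->]]; rewrite evX => Jc; apply: nc.
by exists c.
Qed.

(** Each variable is congruent to a constant x_i modulo J, so every F is congruent to F(x). A
    nonzero constant is not in J, hence J vanishes at x; and G_j(x) = 0 would put G_j in J. *)
Lemma ideal_point : exists x : 'I_n.+1 -> k,
  (forall F, J F -> mpoly.meval x F = 0) /\ forall j, mpoly.meval x (G j) != 0.
Proof.
have [x hx] := choice ideal_coordinate.
have J_0 : J 0 by apply: J0; eexists; exact: (hx i0).
have JB A B : J A -> J B -> J (A - B) by move=> JA /JN; exact: pJ.1.1.
have hF F : J (F - (mpoly.meval x F)%:A).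
  elim/mpoly.mpolyind: F => [|c m F _ _ IH].
    by rewrite mpoly.meval0 scale0r subr0.
  rewrite mpoly.mevalD mpoly.mevalZ scalerDl opprD addrACA; apply: pJ.1.1 => //.
  rewrite -scalerA -scalerBr -mpoly.mul_mpolyC; apply: pJ.1.2.
  pose K (H : poly) := J (H - (mpoly.meval x H)%:A).
  have KM A B : K A -> K B -> K (A * B).
    move=> KA KB; rewrite /K mpoly.mevalM.
    have -> : A * B - (mpoly.meval x A * mpoly.meval x B)%:A =
        A * (B - (mpoly.meval x B)%:A) +
        (mpoly.meval x B)%:A * (A - (mpoly.meval x A)%:A).
      have -> : (mpoly.meval x A * mpoly.meval x B)%:A =
          (mpoly.meval x A)%:A * (mpoly.meval x B)%:A :> poly.
        by rewrite -scalerAl mul1r scalerA.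
      by set u := _%:A; set v := _%:A; ring.
    by apply: pJ.1.1; apply: pJ.1.2.
  have K1 : K 1 by rewrite /K mpoly.meval1 scale1r subrr.
  rewrite mpoly.mpolyXE_id -/(K _); apply: big_ind => // i _.
  elim: (m i) => [|l IHl]; first by rewrite expr0.
  by rewrite exprS; apply: KM => //; rewrite /K mpoly.mevalXU; exact: hx.
have evJ F : J F -> mpoly.meval x F = 0.
  move=> JF; apply: contrapT => /eqP nF; apply: (JC nF).
  by have := JB _ _ JF (hF F); rewrite opprB addrC subrK.
exists x; split=> // j; apply/eqP => e; apply: (@JM [:: j]).
by have := hF (G j); rewrite e scale0r subr0 /M big_seq1.
Qed.

End MaximalIdeal.
End Baire.

Lemma open_affine (k : fieldType) n (i0 : 'I_n.+1) (F : mpoly.mpoly n.+1 k) :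
  open [set l : projsp k n | hcoord l i0 != 0 /\ mpoly.meval (affc i0 l) F != 0].
Proof.
rewrite openE => l [n0 nF].
apply: near_sub2 (near_hcoord n0) (reg_at_neq0 (reg_at_meval F _) nF).
  by move=> m h1 h2; split.
by move=> i; exact: reg_at_affc.
Qed.

(** Each O_j contains the locus G_j != 0 of a form not vanishing identically on Z. The ideal I of an
    affine chart of Z is enlarged to an ideal J maximal among those containing no product of the
    G_j. Such a J is prime, and its zero is the required point. *)
Lemma projective_baire (k : closedFieldType) n (Z : set (projsp k n))
    (O : nat -> set (projsp k n)) :
  ~ countable [set: k] -> closed Z -> irreducible_set Z ->
  (forall j, open (O j) /\ Z `&` O j !=set0) ->
  exists l, Z l /\ forall j, O j l.
Proof.
move=> unc cZ iZ hO.
have hG j : {G : mpoly.mpoly n.+1 k | [/\ exists d, homog d G,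
    [set l | heval G l != 0] `<=` O j & exists2 l, Z l & heval G l != 0]}.
  apply: cid; have [] := hO j; rewrite proj_openE => -[I [hI OE]] [l [Zl]].
  rewrite OE => -[G IG nG]; exists G; split; [exact: hI| |by exists l].
  by move=> m nm; exists G.
pose G j := sval (hG j).
have [[l0 Zl0] _] := iZ; have [i0 ni0] := hcoord_neq0 l0.
pose I : set (mpoly.mpoly n.+1 k) := [set F | forall l, Z l -> hcoord l i0 != 0 ->
  mpoly.meval (affc i0 l) F = 0].
have IF F : ~ I F -> Z `&` [set l : projsp k n | hcoord l i0 != 0 /\
    mpoly.meval (affc i0 l) F != 0] !=set0.
  move=> nI; apply: contrapT => h; apply: nI => l Zl nl; apply/eqP.
  by apply/negPn/negP => nF; apply: h; exists l; split.
have idI : mideal I.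
  split=> [A B IA IB l Zl nl|A B IB l Zl nl].
    by rewrite mpoly.mevalD IA // IB // addr0.
  by rewrite mpoly.mevalM IB // mulr0.
have prI : mprime I.
  split=> // A B IAB; apply: contrapT => h.
  have [nA nB] : ~ I A /\ ~ I B by split=> h'; apply: h; [left|right].
  have [l [Zl [[nl nA'] [_ nB']]]] := irreducible_meet iZ (open_affine i0 A)
    (open_affine i0 B) (IF _ nA) (IF _ nB).
  by have /eqP := IAB l Zl nl; rewrite mpoly.mevalM mulf_eq0 (negbTE nA') (negbTE nB').
have nIG j : ~ I (G j).
  have [[d hGj] _ [l Zl nl]] := svalP (hG j) => IG.
  have o1 := proj_open_neq0 hGj; have o2 := proj_open_neq0 (homogX k i0).
  have m1 : Z `&` [set l : projsp k n | heval (G j) l != 0] !=set0 by exists l.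
  have m2 : Z `&` [set l : projsp k n |
      heval (mpoly.mpolyX k (mpoly.mnm1 i0)) l != 0] !=set0.
    by exists l0; split=> //=; rewrite /heval mpoly.mevalXU.
  have [m [Zm [nm1 /= nm2]]] := irreducible_meet iZ o1 o2 m1 m2.
  rewrite /heval mpoly.mevalXU in nm2; move: nm1 => /=.
  by rewrite (heval_affc hGj nm2) IG // mulr0 eqxx.
pose M (s : seq nat) := \prod_(j <- s) G j.
have nIM s : ~ I (M s).
  elim: s => [|j s IH]; rewrite /M ?big_nil ?big_cons.
    by move=> /(_ l0 Zl0 ni0)/eqP; rewrite mpoly.meval1 oner_eq0.
  by move=> /prI.2[/nIG|/IH].
have MD s t : M (s ++ t) = M s * M t by rewrite /M big_cat.
have [|F [X0 FX0] FP totF|J [[idJ JM] IJ maxJ]] :=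
  @Zorn_above _ (fun J => mideal J /\ forall s, ~ J (M s)) I; first by [].
  have ub X Y a b : F X -> F Y -> X a -> Y b -> exists W, [/\ F W, W a & W b].
    move=> FX FY Xa Yb; have [XY|YX] := totF X Y FX FY.
      by exists Y; split=> //; exact: XY.
    by exists X; split=> //; exact: YX.
  split; first split.
  - move=> A B [X FX XA] [Y FY YB]; have [W [FW WA WB]] := ub _ _ _ _ FX FY XA YB.
    by exists W => //; case: (FP W FW) => -[[WD _] _] _; exact: WD.
  - by move=> A B [X FX XB]; exists X => //; case: (FP X FX) => -[[_ XM] _] _; exact: XM.
  - by move=> s [X FX XM]; case: (FP X FX) => -[_ /(_ s)].
have J0 : J 0 by apply: IJ => l _ _; rewrite mpoly.meval0.
have mx A : ~ J A -> exists s B, J (M s - B * A).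
  move=> nA; apply: contrapT => h; apply: nA.
  apply: (maxJ [set H | exists B C, J B /\ H = B + C * A]); last first.
  - by exists 0, 1; rewrite mul1r add0r.
  - split=> [|s [B [C [JB e]]]]; last first.
      by apply: h; exists s, C; rewrite e addrK.
    split=> [_ _ [B [C [JB ->]]] [B' [C' [JB' ->]]]|H _ [B [C [JB ->]]]].
      exists (B + B'), (C + C'); split; first exact: idJ.1.
      by rewrite mulrDl addrACA.
    exists (H * B), (H * C); split; first exact: idJ.2.
    by rewrite mulrDr mulrA.
  - by move=> B JB; exists B, 0; rewrite mul0r addr0.
(* The usual argument that an ideal maximal among those avoiding a multiplicative set is prime. *)
have prJ : mprime J.
  split=> // A B JAB; apply: contrapT => h.
  have [nA nB] : ~ J A /\ ~ J B by split=> h'; apply: h; [left|right].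
  have [s [C JC]] := mx _ nA; have [t [D JD]] := mx _ nB.
  apply: (JM (s ++ t)); rewrite MD.
  have -> : M s * M t = M t * (M s - C * A) + C * A * (M t - D * B) + C * D * (A * B).
    by set a := M s; set b := M t; ring.
  by apply: idJ.1; [apply: idJ.1|]; apply: idJ.2.
have [x [xJ xG]] := ideal_point i0 prJ JM mx unc.
(* The ideal of the chart contains x_i0 - 1, so the zero x is a nonzero vector and defines a
   point. *)
have xi0 : x i0 = 1.
  apply/eqP; rewrite -subr_eq0; apply/eqP.
  have : I (mpoly.mpolyX k (mpoly.mnm1 i0) - 1).
    by move=> l _ nl; rewrite mpoly.mevalB mpoly.mevalXU mpoly.meval1 /affc divff // subrr.
  by move=> /IJ/xJ; rewrite mpoly.mevalB mpoly.mevalXU mpoly.meval1.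
pose v : 'rV[k]_n.+1 := \row_i x i.
have nv : v != 0 by apply/rV0Pn; exists i0; rewrite mxE xi0 oner_neq0.
have vx H : mpoly.meval (fun i => v 0 i) H = mpoly.meval x H.
  by apply: mpoly.meval_eq => i; rewrite mxE.
exists (pline v : projsp k n); split=> [|j]; last first.
  have [[d hGj] sG _] := svalP (hG j); apply: sG => /=.
  by have [c nc ->] := heval_pline hGj nv; rewrite vx mulf_neq0 //; exact: xG.
apply: contrapT => nZ; have oZ : open (~` Z) by rewrite openC.
move: (oZ); rewrite proj_openE => -[Q [hQ ZE]].
have : (~` Z) (pline v) by [].
rewrite ZE => -[H QH nH]; have [d hH] := hQ H QH.
case/negP: nH; have [c _ ->] := heval_pline hH nv.
rewrite vx xJ ?mulr0 //; apply: IJ => l Zl nl; apply/eqP/negPn/negP => nHl.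
suff : (~` Z) l by [].
rewrite ZE; exists H => //; rewrite (heval_affc hH nl) mulf_neq0 // expf_neq0 //.
Qed.

(** * Products of quasi-projective spaces *)

Section InducedSpace.
Variables (k : fieldType) (A : choiceType) (T : kspace k) (s : A -> T).
Local Notation A' := (initial_topology s).

(** Used with s the Segre map, to put on a set of pairs the structure of its image in projective
    space. *)
Definition ind_reg (U : set A') (h : A' -> k) : Prop :=
  forall p, U p -> exists W g, [/\ open W, W (s p), reg T W g &
    forall q, U q -> W (s q) -> h q = g (s q)].

Lemma ind_reg_local (U : set A') (f : A' -> k) : open U ->
  (forall p, U p -> exists W : set A', exists g : A' -> k,
      [/\ open W, W p, ind_reg W g & forall q, W q -> U q -> f q = g q]) ->
  ind_reg U f.
Proof.
move=> oU h p Up; have [_ [g [[V oV <-] Vp rg e]]] := h p Up.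
have [W [g' [oW Wp rg' e']]] := rg p Vp; have oWV := openI oW oV.
exists (W `&` V), g'; split=> //.
  by apply: (@reg_sub _ _ W) => // q [].
by move=> q Uq [Wq Vq]; rewrite e // e'.
Qed.

Lemma ind_reg_cst (U : set A') c : open U -> ind_reg U (fun=> c).
Proof.
move=> oU p Up; exists setT, (fun=> c); split=> //; first exact: openT.
exact/reg_cst/openT.
Qed.

Lemma ind_reg_op (op : k -> k -> k) (U : set A') f g :
  (forall (W : set T) (f g : T -> k), open W -> reg T W f -> reg T W g ->
     reg T W (fun p => op (f p) (g p))) ->
  ind_reg U f -> ind_reg U g -> ind_reg U (fun p => op (f p) (g p)).
Proof.
move=> rop rf rg p Up; have [W [f' [oW Wp rf' ef]]] := rf p Up.
have [V [g' [oV Vp rg' eg]]] := rg p Up; have oWV := openI oW oV.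
exists (W `&` V), (fun q => op (f' q) (g' q)); split=> //.
  apply: rop => //.
    by apply: (@reg_sub _ _ W) => // q [].
  by apply: (@reg_sub _ _ V) => // q [].
by move=> q Uq [Wq Vq]; rewrite ef // eg.
Qed.

Lemma ind_reg_inv (U : set A') (f : A' -> k) : open U -> ind_reg U f ->
  open (U `&` [set p | f p != 0]) /\
  ind_reg (U `&` [set p | f p != 0]) (fun p => (f p)^-1).
Proof.
move=> oU rf; split.
  rewrite openE => p [Up nf]; have [W [g [oW Wp rg e]]] := rf p Up.
  have [oV _] := reg_inv oW rg.
  rewrite /interior nbhsE; exists (U `&` s @^-1` (W `&` [set p | g p != 0])).
    split; last by split=> //; split=> //=; rewrite -e.
    by apply: openI => //; eexists; first exact: oV.
  by move=> q [Uq [Wq nq]]; split=> //=; rewrite e.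
move=> p [Up nf]; have [W [g [oW Wp rg e]]] := rf p Up.
have [oV rV] := reg_inv oW rg.
exists (W `&` [set p | g p != 0]), (fun p => (g p)^-1); split=> //.
  by split=> //=; rewrite -e.
by move=> q [Uq _] [Wq _]; rewrite e.
Qed.

Definition indsp : kspace k := @KSpace k A' ind_reg ind_reg_local ind_reg_cst
  (fun U f g _ => @ind_reg_op +%R U f g (@reg_add _ T))
  (fun U f g _ => @ind_reg_op *%R U f g (@reg_mul _ T)) ind_reg_inv.

Lemma ind_mor_open (W : set T) : open W -> open ((s : indsp -> T) @^-1` W).
Proof. by move=> oW; exists W. Qed.

Lemma ind_mor_reg (W : set T) (g : T -> k) : open W -> reg T W g ->
  reg indsp ((s : indsp -> T) @^-1` W) (g \o s).
Proof. by move=> oW rg p Wp; exists W, g; split. Qed.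

Definition ind_mor : morphism indsp T := Morphism ind_mor_open ind_mor_reg.

Lemma ind_immersion : injective s -> immersion ind_mor.
Proof. by move=> injs; split=> // U [W oW <-]; exists W. Qed.

End InducedSpace.

Section Morphisms.
Variables (k : fieldType).
Implicit Types S T Z : kspace k.

Lemma id_mor_open S (W : set S) : open W -> open ((id : S -> S) @^-1` W).
Proof. by []. Qed.

Definition id_mor S : morphism S S :=
  Morphism (@id_mor_open S) (fun W g _ (rg : reg S W g) => rg).

Lemma comp_mor_open S T Z (F : morphism S T) (G : morphism T Z) (W : set Z) :
  open W -> open ((G \o F) @^-1` W).
Proof. by move=> /(mor_open G)/(mor_open F). Qed.

Lemma comp_mor_reg S T Z (F : morphism S T) (G : morphism T Z) (W : set Z) g :
  open W -> reg Z W g -> reg S ((G \o F) @^-1` W) (g \o (G \o F)).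
Proof. by move=> oW /(mor_reg G oW)/(mor_reg F (mor_open G oW)). Qed.

Definition comp_mor S T Z (F : morphism S T) (G : morphism T Z) : morphism S Z :=
  Morphism (@comp_mor_open S T Z F G) (@comp_mor_reg S T Z F G).

Lemma const_mor_open S T (t : T) (W : set T) :
  open W -> open ((fun _ : S => t) @^-1` W).
Proof.
move=> _; have [Wt|nWt] := pselect (W t).
  have -> : (fun _ : S => t) @^-1` W = setT by apply/seteqP; split.
  exact: openT.
have -> : (fun _ : S => t) @^-1` W = set0 by apply/seteqP; split.
exact: open0.
Qed.

Lemma const_mor_reg S T (t : T) (W : set T) (g : T -> k) :
  open W -> reg T W g -> reg S ((fun _ : S => t) @^-1` W) (g \o (fun=> t)).
Proof. by move=> oW _; apply: reg_cst; exact: const_mor_open. Qed.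

Definition const_mor S T (t : T) : morphism S T :=
  Morphism (@const_mor_open S T t) (@const_mor_reg S T t).

(** Open sets and regular functions of S come locally from T, so a set-theoretic factorization of a
    morphism through an immersion is a morphism. *)
Lemma into_immersed S T Z (e : morphism S T) (m : morphism Z T) (F : Z -> S) :
  immersion e -> (forall z, m z = e (F z)) -> exists m' : morphism Z S, forall z, m' z = F z.
Proof.
move=> ie mE; have [_ eo er] := ie.
have pre (W : set T) : F @^-1` (e @^-1` W) = m @^-1` W.
  by apply/seteqP; split=> z /=; rewrite mE.
have oF (U : set S) : open U -> open (F @^-1` U).
  by move=> /eo[W oW ->]; rewrite pre; exact: mor_open.
have rF (U : set S) (h : S -> k) : open U -> reg S U h -> reg Z (F @^-1` U) (h \o F).
  move=> oU rh; apply: reg_local; first exact: oF.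
  move=> z Uz; have [W [g [oW Wz rg E]]] := er U h oU rh (F z) Uz.
  exists (m @^-1` W), (g \o m); split=> //; first exact: mor_open.
  - by rewrite /= mE.
  - exact: mor_reg.
  by move=> y Wy Uy; rewrite /= mE E //; move: Wy; rewrite /= mE.
by exists (Morphism oF rF).
Qed.

End Morphisms.

(** * The Segre embedding and its image *)

Section Segre.
Variables (k : fieldType) (n m : nat).
(* The index [N] is chosen so that [N.+1] is convertible to [n.+1 * m.+1]. *)
Local Notation N := (m + n * m.+1)%N.

Definition segre_idx (i : 'I_n.+1) (j : 'I_m.+1) : 'I_N.+1 := mxvec_index i j.

Definition segre_vec (v : 'rV[k]_n.+1) (w : 'rV[k]_m.+1) : 'rV[k]_N.+1 :=
  mxvec (v^T *m w).

Lemma segre_vecE v w i j : segre_vec v w 0 (segre_idx i j) = v 0 i * w 0 j.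
Proof. by rewrite [LHS]mxvecE mxE big_ord1 mxE. Qed.

Lemma segre_idxP x : exists i j, x = segre_idx i j.
Proof. by case: (mxvec_indexP (x : 'I_(n.+1 * m.+1))) => i j; exists i, j. Qed.

Definition segre (a : proj_pt k n) (b : proj_pt k m) : proj_pt k N :=
  pline (segre_vec (hvec a) (hvec b)).

Lemma segre_vec_neq0 v w : v != 0 -> w != 0 -> segre_vec v w != 0.
Proof.
move=> /rV0Pn[i vi] /rV0Pn[j wj]; apply/rV0Pn; exists (segre_idx i j).
by rewrite segre_vecE mulf_neq0.
Qed.

Lemma hcoord_segre a b : exists2 c, c != 0 &
  forall i j, hcoord (segre a b) (segre_idx i j) = c * (hcoord a i * hcoord b j).
Proof.
have [c nc e] := hvec_pline (segre_vec_neq0 (hvec_neq0 a) (hvec_neq0 b)).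
exists c => // i j.
have := congr1 (fun u : 'rV__ => u 0 (segre_idx i j)) e.
by rewrite mxE => ->; rewrite mxE segre_vecE !mxE.
Qed.

Lemma hcoord_segre_neq0 a b i j :
  (hcoord (segre a b) (segre_idx i j) != 0) = (hcoord a i != 0) && (hcoord b j != 0).
Proof.
by have [c nc ->] := hcoord_segre a b; rewrite !mulf_eq0 !negb_or nc.
Qed.

End Segre.

Section Selection.
Variables (k : fieldType) (n N : nat) (f : 'I_n.+1 -> 'I_N.+1).

(** The linear projection to the coordinates selected by f, with a junk value where they all vanish.
    On a nonzero row or column of the Segre matrix it recovers a factor. *)
Definition psel (l : proj_pt k N) : proj_pt k n := pline (\row_i hcoord l (f i)).

Lemma psel_affc i0 (l : proj_pt k N) : hcoord l (f i0) != 0 ->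
  psel l = pline (\row_i affc (f i0) l (f i)).
Proof.
move=> n0; rewrite /psel -[RHS](pline_scale _ n0); congr pline.
by apply/rowP => i; rewrite !mxE mulrC divfK.
Qed.

Lemma psel_row_neq0 i0 (l : proj_pt k N) : hcoord l (f i0) != 0 ->
  \row_i affc (f i0) l (f i) != 0.
Proof.
by move=> n0; apply/rV0Pn; exists i0; rewrite mxE /affc divff ?oner_neq0.
Qed.

Lemma near_psel i0 (l0 : projsp k N) (U : set (projsp k n)) :
  hcoord l0 (f i0) != 0 -> open U -> U (psel l0) ->
  \forall l \near l0, hcoord l (f i0) != 0 /\ U (psel l).
Proof.
move=> n0 oU Ul0.
have H : \forall l \near l0, U (pline (\row_i affc (f i0) l (f i))).
  apply: near_line => //; last 2 first.
  - exact: psel_row_neq0.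
  - by rewrite -(psel_affc n0).
  move=> i; apply: reg_at_eq (reg_at_affc (f i) n0).
  by apply: near_all => l; rewrite mxE.
apply: near_sub2 (near_hcoord n0) H => l nl Ul.
by split=> //; rewrite (psel_affc nl).
Qed.

Lemma psel_mor (Z : kspace k) (M : morphism Z (projsp k N)) (z0 : Z) i0 :
  hcoord (M z0) (f i0) != 0 -> exists phi : Z -> 'rV[k]_n.+1,
    [/\ forall i, reg_at z0 (fun z => phi z 0 i), phi z0 != 0 &
        \forall z \near z0, psel (M z) = pline (phi z)].
Proof.
move=> n0; exists (fun z => \row_i affc (f i0) (M z) (f i)); split.
- move=> i; apply: reg_at_eq (reg_at_chart (f i) n0).
  by apply: near_all => l; rewrite mxE.
- exact: psel_row_neq0.
- by apply: near_sub (near_chart n0) => z; exact: psel_affc.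
Qed.

Lemma open_psel (U : set (projsp k n)) : open U ->
  open [set l : projsp k N | (exists i, hcoord l (f i) != 0) /\ U (psel l)].
Proof.
move=> oU; rewrite openE => l [[i ni] Ul].
by apply: near_sub (near_psel ni oU Ul) => l' [ni' Ul']; split=> //; exists i.
Qed.

End Selection.

Section SegreRange.
Variables (k : fieldType) (n m : nat).
Local Notation N := (m + n * m.+1)%N.

Implicit Types (a : proj_pt k n) (b : proj_pt k m).

Lemma psel_segre_l a b j : hcoord b j != 0 ->
  psel (fun i => segre_idx i j) (segre a b) = a.
Proof.
move=> nb; have [c nc e] := @hcoord_segre k n m a b.
apply: (@pline_hvecZ _ _ (c * hcoord b j)^-1); apply/rowP => i.
by rewrite !mxE e; field; rewrite nc nb.
Qed.

Lemma psel_segre_r a b i : hcoord a i != 0 ->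
  psel (segre_idx i) (segre a b) = b.
Proof.
move=> na; have [c nc e] := @hcoord_segre k n m a b.
apply: (@pline_hvecZ _ _ (c * hcoord a i)^-1); apply/rowP => j.
by rewrite !mxE e; field; rewrite nc na.
Qed.

Lemma segre_inj a b a' b' : segre a b = segre a' b' ->
  a = a' /\ b = b'.
Proof.
move=> e; have [i ni] := hcoord_neq0 a; have [j nj] := hcoord_neq0 b.
have := hcoord_segre_neq0 a b i j; rewrite ni nj /= e hcoord_segre_neq0.
move=> /andP[ni' nj']; split.
  by rewrite -(psel_segre_l a nj) e psel_segre_l.
by rewrite -(psel_segre_r b ni) e psel_segre_r.
Qed.

Definition segre_minors : set (projsp k N) := [set l | forall i j i' j',
  hcoord l (segre_idx i j) * hcoord l (segre_idx i' j') =
  hcoord l (segre_idx i j') * hcoord l (segre_idx i' j)].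

Lemma closed_segre_minors : closed segre_minors.
Proof.
rewrite -openC openE => l /existsNP[i /existsNP[j /existsNP[i' /existsNP[j' /eqP nl]]]].
have [x nx] := hcoord_neq0 l.
pose g (l : projsp k N) := affc x l (segre_idx i j) * affc x l (segre_idx i' j') -
   affc x l (segre_idx i j') * affc x l (segre_idx i' j).
have gE l' : hcoord l' x != 0 -> g l' * hcoord l' x ^+ 2 =
    hcoord l' (segre_idx i j) * hcoord l' (segre_idx i' j') -
    hcoord l' (segre_idx i j') * hcoord l' (segre_idx i' j).
  by move=> nx'; rewrite /g /affc; field.
have rg : reg_at l g.
  by apply: reg_at_sub; apply: reg_at_mul; exact: reg_at_affc.
have ng : g l != 0.
  move: nl; rewrite -subr_eq0 -gE //; apply: contraNneq => ->.
  by rewrite mul0r.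
apply: near_sub2 (near_hcoord nx) (reg_at_neq0 rg ng) => l' nx' ng' H.
have := gE _ nx'; rewrite H subrr => /eqP; rewrite mulf_eq0 (negbTE ng') /=.
by rewrite expf_eq0 (negbTE nx').
Qed.

(** A matrix with vanishing 2 x 2 minors is, up to a scalar, the product of any column and any row
    that meet in a nonzero entry. *)
Lemma segre_minorsP (l : projsp k N) : segre_minors l -> forall i j,
  hcoord l (segre_idx i j) != 0 ->
  l = segre (psel (fun i => segre_idx i j) l) (psel (segre_idx i) l).
Proof.
move=> Ml i j nl; set a := psel _ l; set b := psel _ l.
have na : \row_i hcoord l (segre_idx i j) != 0 :> 'rV[k]_n.+1.
  by apply/rV0Pn; exists i; rewrite mxE.
have nb : \row_j hcoord l (segre_idx i j) != 0 :> 'rV[k]_m.+1.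
  by apply/rV0Pn; exists j; rewrite mxE.
have [c nc ea] := hvec_pline na; have [d nd eb] := hvec_pline nb.
rewrite -[LHS]hvecK /segre; set v := segre_vec (hvec a) (hvec b).
have -> : v = (c * d * hcoord l (segre_idx i j)) *: hvec l.
  apply/rowP => x; have [i' [j' ->]] := segre_idxP x.
  rewrite segre_vecE [hvec a]ea [hvec b]eb !mxE -!mulrA; congr (_ * _).
  by rewrite mulrCA; congr (_ * _); rewrite Ml mulrC.
by rewrite pline_scale // !mulf_neq0.
Qed.

Lemma segre_minors_segre a b : segre_minors (segre a b).
Proof.
by move=> i j i' j'; have [c _ e] := hcoord_segre a b; rewrite !e; ring.
Qed.

(* Whether a point with vanishing minors comes from U1 x U2 can be read off
   any nonzero row and column. *)
Lemma segre_locally_closed (U1 Z1 : set (projsp k n)) (U2 Z2 : set (projsp k m)) :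
  open U1 -> closed Z1 -> open U2 -> closed Z2 ->
  exists U Z : set (projsp k N), [/\ open U, closed Z &
    [set l | exists a b, [/\ (U1 `&` Z1) a, (U2 `&` Z2) b & l = segre a b]] = U `&` Z].
Proof.
move=> oU1 cZ1 oU2 cZ2.
pose A j (V : set (projsp k n)) : set (projsp k N) :=
  [set l | (exists i, hcoord l (segre_idx i j) != 0) /\
           V (psel (fun i => segre_idx i j) l)].
pose B i (V : set (projsp k m)) : set (projsp k N) :=
  [set l | (exists j, hcoord l (segre_idx i j) != 0) /\ V (psel (segre_idx i) l)].
have oA j V : open V -> open (A j V) by exact: open_psel.
have oB i V : open V -> open (B i V) by exact: open_psel.
exists ((\bigcup_j A j U1) `&` (\bigcup_i B i U2)).
exists (segre_minors `&` ~` ((\bigcup_j A j (~` Z1)) `|` (\bigcup_i B i (~` Z2)))).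
split.
- by apply: openI; apply: bigcup_open => i _; [exact: oA|exact: oB].
- apply: closedI; first exact: closed_segre_minors.
  by apply: open_closedC; apply: openU; apply: bigcup_open => i _;
    [apply: oA|apply: oB]; rewrite openC.
apply/seteqP; split=> l.
  move=> [a [b [[Ua Za] [Ub Zb] ->]]].
  have [i ni] := hcoord_neq0 a; have [j nj] := hcoord_neq0 b.
  have nij : hcoord (segre a b) (segre_idx i j) != 0 by rewrite hcoord_segre_neq0 ni.
  split; first split.
  - by exists j => //; split; [exists i|rewrite psel_segre_l].
  - by exists i => //; split; [exists j|rewrite psel_segre_r].
  split; first exact: segre_minors_segre.
  case=> [[j' _ [[i' ]]]|[i' _ [[j']]]]; rewrite hcoord_segre_neq0 => /andP[ni' nj'].
    by rewrite psel_segre_l.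
  by rewrite psel_segre_r.
move=> [[[j _ [[i nij] U1l]] [i' _ [[j' nij'] U2l]]] [Ml nZ]].
have lE := segre_minorsP Ml nij; set a := psel _ l in lE; set b := psel _ l in lE.
have [ni nj] : hcoord a i != 0 /\ hcoord b j != 0.
  by apply/andP; rewrite -hcoord_segre_neq0 -lE.
have [ni' nj'] : hcoord a i' != 0 /\ hcoord b j' != 0.
  by apply/andP; rewrite -hcoord_segre_neq0 -lE.
exists a, b; split=> //; split=> //.
- by apply: contrapT => nZa; apply: nZ; left; exists j => //; split=> //; exists i.
- by move: U2l; rewrite lE psel_segre_r.
- apply: contrapT => nZb; apply: nZ; right; exists i => //; split; first by exists j.
  by rewrite lE psel_segre_r.
Qed.

End SegreRange.

(** The set of pairs carries the structure induced by the Segre map. Its projections are read off a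
    column or a row of the Segre matrix, and a pair of morphisms is lifted locally by the products
    of their affine coordinates. *)
Theorem product_exists (k : fieldType) (S T : kspace k) :
  quasi_projective S -> quasi_projective T ->
  exists (Q : kspace k) (qS : morphism Q S) (qT : morphism Q T), is_product qS qT.
Proof.
move=> [n [eS [iS [U1 [Z1 [oU1 cZ1 rS]]]]]] [m [eT [iT [U2 [Z2 [oU2 cZ2 rT]]]]]].
pose s (p : S * T) : projsp k (m + n * m.+1) := segre (eS p.1) (eT p.2).
have injs : injective s.
  move=> [a b] [a' b'] /segre_inj /= [ea eb].
  by have [jS _ _] := iS; have [jT _ _] := iT; rewrite (jS _ _ ea) (jT _ _ eb).
pose Q := indsp s; pose e : morphism Q _ := ind_mor s.
have ie : immersion e := ind_immersion injs.
have [mS mSE] : exists mS : morphism Q (projsp k n), forall q, mS q = eS q.1.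
  apply: into_proj => q0; have [j nj] := hcoord_neq0 (eT q0.2).
  have [i ni] := hcoord_neq0 (eS q0.1).
  have nij : hcoord (e q0) (segre_idx i j) != 0 by rewrite hcoord_segre_neq0 ni.
  have [phi [rphi nphi E]] := psel_mor (f := fun a => segre_idx a j) nij.
  exists phi; split=> //; apply: near_sub2 (near_chart nij) E => q.
  rewrite hcoord_segre_neq0 => /andP[_ njq] <-.
  by rewrite [e q]/(segre _ _) psel_segre_l.
have [mT mTE] : exists mT : morphism Q (projsp k m), forall q, mT q = eT q.2.
  apply: into_proj => q0; have [j nj] := hcoord_neq0 (eT q0.2).
  have [i ni] := hcoord_neq0 (eS q0.1).
  have nij : hcoord (e q0) (segre_idx i j) != 0 by rewrite hcoord_segre_neq0 ni.
  have [phi [rphi nphi E]] := psel_mor (f := segre_idx i) nij.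
  exists phi; split=> //; apply: near_sub2 (near_chart nij) E => q.
  rewrite hcoord_segre_neq0 => /andP[niq _] <-.
  by rewrite [e q]/(segre _ _) psel_segre_r.
have [qS qSE] := into_immersed iS mSE; have [qT qTE] := into_immersed iT mTE.
exists Q, qS, qT; split.
  exists _, e; split=> //.
  have [U [Z [oU cZ E]]] := segre_locally_closed oU1 cZ1 oU2 cZ2.
  exists U, Z; split=> //; rewrite -E -rS -rT; apply/seteqP; split=> l.
    by move=> [[a b] _ <-]; exists (eS a), (eT b).
  by move=> [_ [_ [[a _ <-] [b _ <-] ->]]]; exists (a, b).
move=> Z _ f g; split; last first.
  move=> h h' hE z; have [] := hE z; rewrite !qSE !qTE.
  by case: (h z) (h' z) => [a b] [a' b'] /= -> ->.
have [M ME] : exists M : morphism Z (projsp k (m + n * m.+1)),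
    forall z, M z = s (f z, g z).
  apply: into_proj => z0.
  have [i ni] := hcoord_neq0 (comp_mor f eS z0).
  have [j nj] := hcoord_neq0 (comp_mor g eT z0).
  exists (fun z => segre_vec (\row_a affc i (eS (f z)) a) (\row_b affc j (eT (g z)) b)).
  split.
  - move=> x; have [a [b ->]] := segre_idxP x.
    apply: reg_at_eq (reg_at_mul (reg_at_chart a ni) (reg_at_chart b nj)).
    by apply: near_all => z; rewrite segre_vecE !mxE.
  - by apply: segre_vec_neq0; exact: affc_neq0.
  apply: near_sub2 (near_chart ni) (near_chart nj) => z niz njz.
  rewrite /s /segre -[RHS](pline_scale _ (mulf_neq0 niz njz)); congr pline.
  apply/rowP => x; have [a [b ->]] := segre_idxP x.
  by rewrite mxE !segre_vecE !mxE /affc /=; field; rewrite niz njz.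
have [h hE] := into_immersed ie ME.
by exists h => z; rewrite qSE qTE hE.
Qed.

(** * Functoriality of the Neron-Severi space *)

Section LineBundles.
Variables (k : fieldType).
Implicit Types S T : kspace k.

Lemma lb_iso_same S (L M : line_bundle S) (u : lb_idx L -> lb_idx M)
    (v : lb_idx M -> lb_idx L) :
  (forall a, u (v a) = a) -> (forall i, lb_cov i = lb_cov (u i)) ->
  (forall i j, lb_trans i j = lb_trans (u i) (u j)) -> lb_iso L M.
Proof.
move=> uv cE tE; exists (fun i a => lb_trans (u i) a); split.
- by move=> i a; rewrite cE; exact: lb_reg.
- by move=> i a p; rewrite cE; exact: lb_neq0.
- by move=> i j a b p; rewrite !cE tE => ip jp ap bp; rewrite !lb_cocycle.
Qed.

Lemma quasi_projective_of_variety S : projective_variety S -> quasi_projective S.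
Proof.
move=> [_ [n [f [imf clf]]]]; exists n, f; split=> //.
by exists setT, (range f); split; [exact: openT| |rewrite setTI].
Qed.

Definition P0_point : projsp k 0 := pline (const_mx 1).

Lemma P0_unique (a b : projsp k 0) : a = b.
Proof.
have na i : hcoord a i != 0.
  by have [j] := hcoord_neq0 a; rewrite (ord1 j) (ord1 i).
have nb i : hcoord b i != 0.
  by have [j] := hcoord_neq0 b; rewrite (ord1 j) (ord1 i).
rewrite -(hvecK a); apply: (@pline_hvecZ _ _ (hcoord b 0 / hcoord a 0)).
by apply/rowP => i; rewrite !mxE (ord1 i) divfK.
Qed.

Lemma id_immersion S : immersion (id_mor S).
Proof.
split=> [//|U oU|U h oU rh p Up]; first by exists U.
by exists U, h; split.
Qed.

(** Both bundles are fibres of the constant family L over the one-point space P^0, since S itself is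
    a product of S with P^0. *)
Lemma alg_equiv_of_iso S (L M : line_bundle S) :
  quasi_projective S -> lb_iso L M -> alg_equiv L M.
Proof.
move=> qS LM.
exists (projsp k 0), S, (id_mor S), (const_mor S P0_point), L, P0_point, P0_point,
  (id_mor S), (id_mor S); split.
- split.
    exists 0%N, (id_mor _); split; first exact: id_immersion.
    exists setT, setT; split; [exact: openT|exact: closedT|].
    by rewrite setTI; apply/seteqP; split=> // l _; exists l.
  split; first by exists P0_point.
  move=> B C _ _ sBC; have [BP|CP] := sBC P0_point I; [left|right] => l _;
    by rewrite (P0_unique l P0_point).
- split=> // Z _ f g; split.
    by exists f => z; split=> //; exact: P0_unique.
  by move=> h h' hE z; have [] := hE z.
- by move=> q; split=> //; exact: P0_unique.
- by move=> q; split=> //; exact: P0_unique.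
split; first exact: (@lb_iso_same _ _ L id id).
have [h [rh nh ch]] := LM.
by exists h; split.
Qed.

(** The family E on T x B is pulled back along g = f x id from a product Q of S and B. *)
Lemma alg_equiv_pull S T (f : morphism S T) (L M : line_bundle T) :
  quasi_projective S -> alg_equiv L M -> alg_equiv (lb_pullback f L) (lb_pullback f M).
Proof.
move=> qS [B [P [pT [pB [E [t1 [t2 [f1 [f2 [[qB iB] prP f1E f2E [is1 is2]]]]]]]]]]].
have [Q [qS' [qB' prQ]]] := product_exists qS qB.
have [g gE] : exists g : morphism Q P, forall z, pT (g z) = f (qS' z) /\ pB (g z) = qB' z.
  by have [[g gE] _] := prP.2 Q prQ.1 (comp_mor qS' f) qB'; exists g.
(* The inclusion s of S x {t} in Q; g composed with s agrees with [fi] composed with f by uniqueness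
   in the universal property of T x B. *)
have sec t (fi : morphism T P) : (forall q, pT (fi q) = q /\ pB (fi q) = t) ->
    exists2 s : morphism S Q, (forall q, qS' (s q) = q /\ qB' (s q) = t) &
      forall q, g (s q) = fi (f q).
  move=> fiE; have [[s sE] _] := prQ.2 S qS (id_mor S) (const_mor S t).
  exists s => // q.
  have [_ uq] := prP.2 S qS f (const_mor S t).
  apply: (uq (comp_mor s g) (comp_mor f fi)) => z /=.
  by have [-> ->] := gE (s z); have [-> ->] := fiE (f z); have [-> ->] := sE z.
have pull (fi : morphism T P) (s : morphism S Q) (N : line_bundle T) :
    (forall q, g (s q) = fi (f q)) -> lb_iso (lb_pullback fi E) N ->
    lb_iso (lb_pullback s (lb_pullback g E)) (lb_pullback f N).
  move=> sE [h [rh nh ch]]; exists (fun i a => h i a \o f).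
  have cE i q : @lb_cov _ _ (lb_pullback s (lb_pullback g E)) i q =
      @lb_cov _ _ (lb_pullback fi E) i (f q) by rewrite /= /preimage /= sE.
  split.
  - move=> i a.
    have -> : @lb_cov _ _ (lb_pullback s (lb_pullback g E)) i `&`
        @lb_cov _ _ (lb_pullback f N) a =
        f @^-1` (@lb_cov _ _ (lb_pullback fi E) i `&` @lb_cov _ _ N a).
      by apply/seteqP; split=> q [iq aq]; split; rewrite // cE in iq *.
    by apply: mor_reg; [apply: openI; exact: lb_open | exact: rh].
  - by move=> i a p; rewrite cE => ip ap; exact: nh.
  - move=> i j a b p; rewrite !cE => ip jp ap bp.
    by have := ch i j a b (f p) ip jp ap bp; rewrite /= /comp sE.
have [s1 s1E gs1] := sec t1 f1 f1E; have [s2 s2E gs2] := sec t2 f2 f2E.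
exists B, Q, qS', qB', (lb_pullback g E), t1, t2, s1, s2; split=> //.
by split; [exact: pull gs1 is1|exact: pull gs2 is2].
Qed.

Lemma NS_hom_iso S (W : zmodType) (c : line_bundle S -> W) L M :
  quasi_projective S -> NS_hom c -> lb_iso L M -> c L = c M.
Proof. by move=> qS [_ h] LM; apply: h; exact: alg_equiv_of_iso. Qed.

(** Fed to the universal property in [NS_space], this yields the linear map f^* between Neron-Severi
    spaces. *)
Lemma NS_hom_pull S T (f : morphism S T) (W : zmodType) (c : line_bundle S -> W) :
  quasi_projective S -> NS_hom c -> NS_hom (fun L => c (lb_pullback f L)).
Proof.
move=> qS nc; split=> [L M|L M LM].
  rewrite -nc.1; apply: NS_hom_iso => //.
  exact: (@lb_iso_same _ _ (lb_tensor (lb_pullback f L) (lb_pullback f M)) id id).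
by apply: nc.2; exact: alg_equiv_pull.
Qed.

End LineBundles.

(** * The tangent vector D(p) *)

Section CoefficientDerivation.
Variables (k : fieldType) (n : nat) (D : k -> k) (derD : derivation D).
Local Notation poly := (mpoly.mpoly n k).
Implicit Types F G : poly.

Definition coefD F : poly :=
  \sum_(m <- mpoly.msupp F) D (mpoly.mcoeff m F) *: mpoly.mpolyX k m.

Lemma mcoeff_coefD F m : mpoly.mcoeff m (coefD F) = D (mpoly.mcoeff m F).
Proof.
rewrite /coefD raddf_sum /=.
under eq_bigr do rewrite mpoly.mcoeffZ mpoly.mcoeffX.
have [mF|mF] := boolP (m \in mpoly.msupp F).
  rewrite (bigD1_seq m) ?mpoly.msupp_uniq //= eqxx mulr1 big1 ?addr0 //.
  by move=> i /negbTE ->; rewrite mulr0.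
rewrite (mpoly.memN_msupp_eq0 mF) (der0 derD) big_seq big1 // => i iF.
by case: eqP => [im|_]; rewrite ?mulr0 //; rewrite -im iF in mF.
Qed.

Lemma coefD_add F G : coefD (F + G) = coefD F + coefD G.
Proof.
by apply/mpoly.mpolyP => m; rewrite mpoly.mcoeffD !mcoeff_coefD mpoly.mcoeffD derD.1.
Qed.

Lemma coefD_sum (I : Type) (r : seq I) (A : I -> poly) :
  coefD (\sum_(i <- r) A i) = \sum_(i <- r) coefD (A i).
Proof.
apply/mpoly.mpolyP => m; rewrite mcoeff_coefD !raddf_sum (der_sum derD) /=.
by apply: eq_bigr => i _; rewrite mcoeff_coefD.
Qed.

Lemma coefDZ c F : coefD (c *: F) = c *: coefD F + D c *: F.
Proof.
apply/mpoly.mpolyP => m.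
rewrite mpoly.mcoeffD !mpoly.mcoeffZ !mcoeff_coefD mpoly.mcoeffZ derD.2.
by rewrite [D c * _]mulrC.
Qed.

Lemma coefD_sub F G : coefD (F - G) = coefD F - coefD G.
Proof.
by apply/mpoly.mpolyP => m; rewrite mpoly.mcoeffB !mcoeff_coefD mpoly.mcoeffB (derB derD).
Qed.

Lemma coefD_mul F G : coefD (F * G) = F * coefD G + G * coefD F.
Proof.
apply/mpoly.mpolyP => m.
rewrite mpoly.mcoeffD !mcoeff_coefD mpoly.mcoeffM (mpoly.mcoeffM F) mpoly.mcoeffMr.
rewrite (der_sum derD) -big_split /=; apply: eq_bigr => i _.
by rewrite derD.2 !mcoeff_coefD.
Qed.

Lemma coefD_killed F : (forall m, D (mpoly.mcoeff m F) = 0) -> coefD F = 0.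
Proof. by move=> h; apply/mpoly.mpolyP => m; rewrite mcoeff_coefD h mpoly.mcoeff0. Qed.

Lemma coefDX m : coefD (mpoly.mpolyX k m) = 0.
Proof.
apply: coefD_killed => l; rewrite mpoly.mcoeffX.
by case: (_ == _); rewrite ?(der1 derD) ?(der0 derD).
Qed.

Lemma coefD_cst c : coefD (mpoly.mpolyC n c) = mpoly.mpolyC n (D c).
Proof.
apply/mpoly.mpolyP => l; rewrite mcoeff_coefD !mpoly.mcoeffC.
by case: (_ == _); rewrite ?mulr1 ?mulr0 ?(der0 derD).
Qed.

End CoefficientDerivation.

Lemma coefD_homog (k : fieldType) n (D : k -> k) (derD : derivation D) d
    (F : mpoly.mpoly n.+1 k) : homog d F -> homog d (coefD D F).
Proof.
move=> hF; apply/mpoly.dhomogP => m; rewrite mpoly.mcoeff_msupp mcoeff_coefD // => nm.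
apply: (mpoly.dhomog_mf hF); rewrite mpoly.mcoeff_msupp.
by apply: contraNneq nm => ->; rewrite (der0 derD).
Qed.

Section VerticalPart.
Variables (k : fieldType) (X : kspace k) (n : nat) (e : morphism X (projsp k n)).
Hypotheses (ie : immersion e) (iX : irreducible_set [set: X]).
Variables (D : k -> k) (derD : derivation D).

(* X is defined over the constants of D *)
Definition D_stable : Prop := forall F : mpoly.mpoly n.+1 k,
  (forall p, heval F (e p) = 0) -> forall p, heval (coefD D F) (e p) = 0.
Hypothesis stD : D_stable.

Definition is_Dgerm (p : X) (h : X -> k) (s : k) : Prop := exists d G H,
  [/\ homog d G, homog d H,
      \forall q \near p, heval H (e q) != 0 /\ h q = heval G (e q) / heval H (e q) &
      s = (heval (coefD D G) (e p) * heval H (e p) -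
           heval G (e p) * heval (coefD D H) (e p)) / heval H (e p) ^+ 2].

Lemma form_vanish d (F : mpoly.mpoly n.+1 k) (p : X) : homog d F ->
  (\forall q \near p, heval F (e q) = 0) -> forall q, heval F (e q) = 0.
Proof.
move=> hF /near_open[W [oW Wp sW]] q; apply/eqP/negPn/negP => nq.
have oF := mor_open e (proj_open_neq0 hF).
have m1 : [set: X] `&` W !=set0 by exists p.
have m2 : [set: X] `&` (e @^-1` [set l | heval F l != 0]) !=set0 by exists q.
have [r [_ [Wr /=]]] := irreducible_meet iX oW oF m1 m2.
by rewrite sW ?eqxx.
Qed.

(** If G/H = G'/H' near p, then G H' - G' H vanishes near p, hence on all of X by irreducibility.
    Stability under D makes its coefficient derivative vanish too, which is the equality of the two
    quotient rules. *)
Lemma is_Dgerm_uniq p h s s' : is_Dgerm p h s -> is_Dgerm p h s' -> s = s'.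
Proof.
move=> [d [G [H [hG hH E ->]]]] [d' [G' [H' [hG' hH' E' ->]]]].
have hF : homog (d + d') (G * H' - G' * H).
  apply: rpredB; first exact: mpoly.dhomogM.
  by rewrite addnC; exact: mpoly.dhomogM.
have F0 : \forall q \near p, heval (G * H' - G' * H) (e q) = 0.
  apply: near_sub2 E E' => q [nH e1] [nH' e2].
  rewrite /heval mpoly.mevalB !mpoly.mevalM -/(heval _ _) -/(heval _ _).
  rewrite -/(heval G' _) -/(heval H _).
  have := e1; rewrite e2 => /eqP; rewrite eqr_div // => /eqP ->.
  by rewrite mulrC subrr.
have := stD (form_vanish hF F0) p.
rewrite coefD_sub // !coefD_mul // /heval !(mpoly.mevalB, mpoly.mevalD, mpoly.mevalM).
rewrite -?/(heval _ (e p)).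
have [nH eh] := nbhs_singleton E; have [nH' eh'] := nbhs_singleton E'.
move=> E0; apply/eqP; rewrite -subr_eq0; apply/eqP.
have <- : 0 / (heval H (e p) * heval H' (e p)) = 0 by rewrite mul0r.
rewrite -[in RHS]E0.
have -> : heval G (e p) = h p * heval H (e p) by rewrite eh divfK.
have -> : heval G' (e p) = h p * heval H' (e p) by rewrite eh' divfK.
by field; rewrite nH nH'.
Qed.

Definition Dgerm (p : X) (h : X -> k) : k := xget 0 [set s | is_Dgerm p h s].

Lemma DgermE p h s : is_Dgerm p h s -> Dgerm p h = s.
Proof.
move=> hs; rewrite /Dgerm; case: xgetP => [t _ ht|/(_ s)//].
exact: is_Dgerm_uniq ht hs.
Qed.

Lemma is_DgermP p h : reg_at p h -> is_Dgerm p h (Dgerm p h).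
Proof.
move=> rh; have [d [G [H [hG hH E]]]] := immersion_ratio ie rh.
have hs : is_Dgerm p h ((heval (coefD D G) (e p) * heval H (e p) -
   heval G (e p) * heval (coefD D H) (e p)) / heval H (e p) ^+ 2) by exists d, G, H.
by rewrite (DgermE hs).
Qed.

(** One presentation G/H serves at all points near p, so the quotient rule is a regular function of
    the point. *)
Lemma Dgerm_reg p h : reg_at p h -> reg_at p (fun q => Dgerm q h).
Proof.
move=> rh; have [d [G [H [hG hH E]]]] := immersion_ratio ie rh.
have [i0 n0] := hcoord_neq0 (e p).
pose ev F q := mpoly.meval (affc i0 (e q)) F.
have rev F : reg_at p (ev F) by apply: reg_at_meval => i; exact: reg_at_chart.
have [nHp _] := nbhs_singleton E.
have nev : ev H p != 0.
  by apply: contraNneq nHp; rewrite (heval_affc hH n0) -/(ev H p) => ->; rewrite mulr0.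
apply: (@reg_at_eq _ _ _ (fun q => (ev (coefD D G) q * ev H q -
   ev G q * ev (coefD D H) q) * (ev H q)^-1 ^+ 2)); last first.
  apply: reg_at_mul; last exact/reg_at_exp/reg_at_inv.
  by apply: reg_at_sub; exact: reg_at_mul.
apply: near_sub2 (near_near E) (near_chart n0) => q Eq nq.
apply/esym/DgermE.
have [nHq _] := nbhs_singleton Eq.
exists d, G, H; split=> //.
have nevq : ev H q != 0.
  by apply: contraNneq nHq; rewrite (heval_affc hH nq) -/(ev H q) => ->; rewrite mulr0.
rewrite (heval_affc (coefD_homog derD hG) nq) (heval_affc (coefD_homog derD hH) nq).
rewrite (heval_affc hG nq) (heval_affc hH nq) -?/(ev _ q).
have nd : hcoord (e q) i0 ^+ d != 0 by exact: expf_neq0.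
by field; rewrite nd nevq.
Qed.

(* [tau p] is the tangent vector at p with coordinates D(p_i). *)
Definition tau (p : X) (h : X -> k) : k := D (h p) - Dgerm p h.

Lemma tau_eq p f g : reg_at p f -> (\forall q \near p, f q = g q) -> tau p f = tau p g.
Proof.
move=> rf fg; rewrite /tau (nbhs_singleton fg); congr (_ - _); apply/esym/DgermE.
have [d [G [H [hG hH E sE]]]] := is_DgermP rf.
by exists d, G, H; split=> //; apply: near_sub2 fg E => q <-.
Qed.

(** On a constant the two terms of [tau] cancel. With the Leibniz rule this makes [tau] linear over
    k, a tangent vector at p, although D is not linear. *)
Lemma tau_cst p c : tau p (fun=> c) = 0.
Proof.
rewrite /tau (@DgermE _ _ (D c)) ?subrr //.
exists 0%N, (mpoly.mpolyC _ c), 1; split.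
- by rewrite -mpoly.alg_mpolyC; apply: mpoly.dhomogZ; exact: mpoly.dhomog1.
- exact: mpoly.dhomog1.
- by apply: near_all => q; rewrite /heval mpoly.meval1 mpoly.mevalC divr1 oner_neq0.
rewrite coefD_cst // -[1]/(mpoly.mpolyC _ 1) coefD_cst // (der1 derD).
by rewrite /heval !mpoly.mevalC mulr0 subr0 mulr1 expr1n divr1.
Qed.

Lemma tau_add p f g : reg_at p f -> reg_at p g ->
  tau p (fun q => f q + g q) = tau p f + tau p g.
Proof.
move=> /is_DgermP[d [G [H [hG hH E1 e1]]]] /is_DgermP[d' [G' [H' [hG' hH' E2 e2]]]].
rewrite /tau derD.1 addrACA -opprD; congr (_ - _); apply: DgermE.
exists (d + d')%N, (G * H' + G' * H), (H * H'); split.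
- by apply: rpredD; [|rewrite addnC]; exact: mpoly.dhomogM.
- exact: mpoly.dhomogM.
- apply: near_sub2 E1 E2 => q [nH ->] [nH' ->].
  rewrite /heval !(mpoly.mevalD, mpoly.mevalM) -?/(heval _ _) addf_div //.
  by rewrite mulf_neq0.
have [nH eh] := nbhs_singleton E1; have [nH' eh'] := nbhs_singleton E2.
rewrite e1 e2 coefD_add // !coefD_mul // /heval !(mpoly.mevalD, mpoly.mevalM).
rewrite -?/(heval _ (e p)).
by field; rewrite nH nH'.
Qed.

Lemma tau_mul p f g : reg_at p f -> reg_at p g ->
  tau p (fun q => f q * g q) = f p * tau p g + g p * tau p f.
Proof.
move=> /is_DgermP[d [G [H [hG hH E1 e1]]]] /is_DgermP[d' [G' [H' [hG' hH' E2 e2]]]].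
have -> : f p * tau p g + g p * tau p f =
    D (f p * g p) - (f p * Dgerm p g + g p * Dgerm p f).
  by rewrite /tau derD.2; ring.
congr (_ - _); apply: DgermE.
exists (d + d')%N, (G * G'), (H * H'); split; try exact: mpoly.dhomogM.
- apply: near_sub2 E1 E2 => q [nH ->] [nH' ->].
  by rewrite /heval !mpoly.mevalM -?/(heval _ _) mulf_div mulf_neq0.
have [nH eh] := nbhs_singleton E1; have [nH' eh'] := nbhs_singleton E2.
rewrite e1 e2 eh eh' !coefD_mul // /heval !(mpoly.mevalD, mpoly.mevalM).
rewrite -?/(heval _ (e p)).
by field; rewrite nH nH'.
Qed.

Lemma tau_scale p c f : reg_at p f -> tau p (fun q => c * f q) = c * tau p f.
Proof. by move=> rf; rewrite tau_mul //= ?tau_cst ?mulr0 ?addr0 //; exact: reg_at_cst. Qed.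

Lemma tau_sum p (I : Type) (r : seq I) (F : I -> X -> k) :
  (forall i, reg_at p (F i)) ->
  tau p (fun q => \sum_(i <- r) F i q) = \sum_(i <- r) tau p (F i).
Proof.
move=> rF; elim: r => [|i r IH].
  rewrite big_nil -[RHS](tau_cst p 0); apply: tau_eq.
    by apply: reg_at_sum.
  by apply: near_all => q; rewrite big_nil.
rewrite big_cons -IH -tau_add //; last exact: reg_at_sum.
apply: tau_eq; first exact: reg_at_sum.
by apply: near_all => q; rewrite big_cons.
Qed.

Lemma tau_max_sq p f : in_max_sq p f -> tau p f = 0.
Proof.
move=> mf; have [m [a [b [rab E]]]] := in_max_sqE mf.
rewrite (tau_eq (in_max_sq_reg mf) E) tau_sum => [|i]; last first.
  by have [ra rb _ _] := rab i; exact: reg_at_mul.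
apply: big1 => i _; have [ra rb a0 b0] := rab i.
by rewrite tau_mul // a0 b0 !mul0r addr0.
Qed.

Lemma tau_expand p d (x : 'I_d -> X -> k) h v : (forall a, reg_at p (x a)) ->
  diff_expand p x h v -> tau p h = \sum_a v 0 a * tau p (x a).
Proof.
move=> rx ev; have rh := diff_expand_reg rx ev.
have rs : reg_at p (fun q => \sum_(a < d) v 0 a * x a q).
  by apply: reg_at_sum => a _; apply: reg_at_mul => //; exact: reg_at_cst.
pose c := - h p + \sum_(a < d) v 0 a * x a p.
have := tau_max_sq ev.
rewrite (@tau_eq _ _ (fun q => h q + ((-1) * (\sum_(a < d) v 0 a * x a q) + c))); last 2 first.
- exact: in_max_sq_reg ev.
- apply: near_all => q; rewrite /c.
  under eq_bigr do rewrite mulrBr.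
  by rewrite sumrB; set s := \sum_(_ < d) _; set t := \sum_(_ < d) _; ring.
have rc := reg_at_cst p c.
have rms : reg_at p (fun q => -1 * \sum_(a < d) v 0 a * x a q).
  exact: reg_at_mul (reg_at_cst p (-1)) rs.
rewrite (tau_add rh (reg_at_add rms rc)) (tau_add rms rc) tau_cst addr0.
rewrite (tau_scale _ rs) mulN1r => /eqP; rewrite subr_eq0 => /eqP ->.
rewrite tau_sum => [|a]; last by apply: reg_at_mul => //; exact: reg_at_cst.
by apply: eq_bigr => a _; rewrite tau_scale.
Qed.

(** A coordinate is a ratio of monomials, whose coefficients 0 and 1 are killed by D. *)
Lemma tau_affc p i0 i : hcoord (e p) i0 != 0 ->
  tau p (fun q => affc i0 (e q) i) = D (affc i0 (e p) i).
Proof.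
move=> n0; rewrite /tau (@DgermE _ _ 0) ?subr0 //.
exists 1%N, (mpoly.mpolyX k (mpoly.mnm1 i)), (mpoly.mpolyX k (mpoly.mnm1 i0)).
split; try exact: homogX.
  by apply: near_sub (near_chart n0) => q nq; rewrite /heval !mpoly.mevalXU.
by rewrite !coefDX // /heval !mpoly.meval0 mulr0 mul0r subrr mul0r.
Qed.

End VerticalPart.

(** * Countable fields of definition and generic points *)

Definition is_subring (k : fieldType) (k0 : set k) : Prop :=
  [/\ k0 1, forall a b, k0 a -> k0 b -> k0 (a - b) &
      forall a b, k0 a -> k0 b -> k0 (a * b)].

Definition poly_over (k : fieldType) n (k0 : set k) : set (mpoly.mpoly n k) :=
  [set F | forall m, k0 (mpoly.mcoeff m F)].

Section Subrings.
Variables (k : fieldType) (k0 : set k) (rk0 : is_subring k0).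

Lemma subring0 : k0 0.
Proof. by case: rk0 => k1 kB _; rewrite -(subrr 1); exact: kB. Qed.

Lemma subringD a b : k0 a -> k0 b -> k0 (a + b).
Proof.
case: rk0 => _ kB _ ka kb; rewrite -[b]opprK -[- b]sub0r; apply: (kB) => //.
by apply: (kB) => //; exact: subring0.
Qed.

Lemma subring_sum (I : Type) (r : seq I) (P : pred I) (F : I -> k) :
  (forall i, k0 (F i)) -> k0 (\sum_(i <- r | P i) F i).
Proof.
by move=> kF; apply: big_ind => //; [exact: subring0 | exact: subringD].
Qed.

Lemma poly_overB n (F G : mpoly.mpoly n k) :
  poly_over k0 F -> poly_over k0 G -> poly_over k0 (F - G).
Proof. by move=> kF kG m; rewrite mpoly.mcoeffB; case: rk0 => _ kB _; exact: kB. Qed.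

Lemma poly_overM n (F G : mpoly.mpoly n k) :
  poly_over k0 F -> poly_over k0 G -> poly_over k0 (F * G).
Proof.
move=> kF kG m; rewrite mpoly.mcoeffM; apply: subring_sum => i.
by case: rk0 => _ _ kM; exact: kM.
Qed.

Lemma poly_overC n c : k0 c -> poly_over k0 (mpoly.mpolyC n c).
Proof.
move=> kc m; rewrite mpoly.mcoeffC; case: (_ == _); rewrite ?mulr1 // mulr0.
exact: subring0.
Qed.

Lemma poly_overX n m : poly_over k0 (mpoly.mpolyX k m : mpoly.mpoly n k).
Proof.
by move=> l; rewrite mpoly.mcoeffX; case: (_ == _); [case: rk0|exact: subring0].
Qed.

End Subrings.

Lemma countable_subring (k : fieldType) (C : set k) : countable C ->
  exists k0, [/\ countable k0, C `<=` k0 & is_subring k0].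
Proof.
move=> cC; pose step (A : set k) := A `|` [set a.1 - a.2 | a in A `*` A] `|`
  [set a.1 * a.2 | a in A `*` A].
pose gen n := iter n step (C `|` [set 1]).
have cU (A B : set k) : countable A -> countable B -> countable (A `|` B).
  move=> cA cB; rewrite -bigcup2E; apply: bigcup_countable; first exact: countableP.
  by move=> [|[|i]] _ //=; exact: countable0.
have cI (A : set k) (f : k * k -> k) : countable A -> countable [set f a | a in A `*` A].
  by move=> cA; apply: sub_countable (card_image_le f _) _; exact: countableX.
have cg n : countable (gen n).
  elim: n => [|n IH]; first by apply: (cU) => //; exact: countable1.
  by apply: (cU); [apply: (cU) => //|]; exact: (cI (gen n)).
have mono n m : (n <= m)%N -> gen n `<=` gen m.
  move=> /subnK <-; elim: (m - n)%N => [|j IH] // a /IH ga.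
  by rewrite addSn; left; left.
have ub a b n m : gen n a -> gen m b -> gen (maxn n m) a /\ gen (maxn n m) b.
  by move=> ga gb; split; [exact: (mono n _ (leq_maxl _ _))|exact: (mono m _ (leq_maxr _ _))].
exists (\bigcup_n gen n); split.
- by apply: bigcup_countable => // ; exact: countableP.
- by move=> a Ca; exists 0%N => //; left.
split; first by exists 0%N => //; right.
- move=> a b [n _ ga] [m _ gb]; have [ga' gb'] := ub _ _ _ _ ga gb.
  by exists (maxn n m).+1 => //; left; right; exists (a, b).
- move=> a b [n _ ga] [m _ gb]; have [ga' gb'] := ub _ _ _ _ ga gb.
  by exists (maxn n m).+1 => //; right; exists (a, b).
Qed.

Lemma countable_enum (T : choiceType) (A : set T) (a0 : T) : countable A ->
  exists g : nat -> T, forall a, A a -> exists j, g j = a.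
Proof.
move=> /countable_injP[f fi]; exists (fun j => xget a0 [set a | A a /\ f a = j]).
move=> a Aa; exists (f a); case: xgetP => [b _ [Ab fb]|/(_ a)[]//].
by apply: fi fb; rewrite inE.
Qed.

(** Codes form a countable type, so the polynomials over a countable ring enumerated by g can be
    indexed by natural numbers. *)
Definition poly_of_code (k : fieldType) n (g : nat -> k)
    (s : seq (nat * mpoly.multinom n)) : mpoly.mpoly n k :=
  \sum_(c <- s) g c.1 *: mpoly.mpolyX k c.2.

Lemma poly_of_codeP (k : fieldType) n (k0 : set k) (g : nat -> k)
    (F : mpoly.mpoly n k) : (forall a, k0 a -> exists j, g j = a) ->
  poly_over k0 F -> exists s, F = poly_of_code g s.
Proof.
move=> gk kF; have [j jE] := choice (fun m => gk _ (kF m)).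
exists [seq (j m, m) | m <- mpoly.msupp F].
rewrite /poly_of_code big_map [LHS]mpoly.mpolyE.
by apply: eq_bigr => m _; rewrite /= jE.
Qed.

(** A linearly independent family of maximal length among the members of W of bounded size; its
    length is at most the number of monomials. *)
Lemma finite_span (k : fieldType) n d (W : set (mpoly.mpoly n k)) :
  exists s : seq (mpoly.mpoly n k), (forall F, F \in s -> W F) /\
    forall F, W F -> (mpoly.msize F <= d)%N ->
      exists a : 'I_(size s) -> k, F = \sum_j a j *: nth 0 s j.
Proof.
pose B := mpoly.bmultinom n d; pose r := #|{: B}|.
pose phi (F : mpoly.mpoly n k) : 'rV[k]_r :=
  \row_b mpoly.mcoeff (mpoly.bmnm (enum_val b)) F.
pose A (s : seq (mpoly.mpoly n k)) : 'M[k]_(size s, r) := \matrix_j phi (nth 0 s j).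
pose Q N := `[< exists s, [/\ forall F, F \in s -> W F /\ (mpoly.msize F <= d)%N,
   row_free (A s) & size s = N] >].
have exQ : exists N, Q N.
  exists 0%N; apply/asboolP; exists [::]; split=> //.
  by rewrite /row_free -leqn0; exact: rank_leq_row.
have ubQ N : Q N -> (N <= r)%N.
  by move=> /asboolP[s [_ /eqP <- <-]]; exact: rank_leq_col.
case: (ex_maxnP exQ ubQ) => N /asboolP[s [Ws fs sN]] maxN.
exists s; split=> [F /Ws[]//|F WF sF].
have sub : (phi F <= A s)%MS.
  apply: contrapT => nsub.
  have : Q N.+1.
    apply/asboolP; exists (F :: s); split=> //=; last by rewrite sN.
      by move=> G; rewrite inE => /orP[/eqP ->|/Ws].
    have fr : row_free (col_mx (phi F) (A s)).
      apply: inj_row_free => w; rewrite -[w]hsubmxK mul_row_col.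
      set a := lsubmx w; set b := rsubmx w => E.
      have a0 : a = 0.
        apply/eqP/negPn/negP => na; apply: nsub; apply/submxP.
        have n00 : a 0 0 != 0.
          by apply: contra na => /eqP a00; apply/eqP/rowP => i; rewrite (ord1 i) a00 mxE.
        exists (- (a 0 0)^-1 *: b); rewrite -scalemxAl scaleNr -scalerN.
        have -> : - (b *m A s) = a *m phi F by apply/eqP; rewrite eq_sym -addr_eq0 E.
        rewrite [a]mx11_scalar mul_scalar_mx scalerA.
        by rewrite [(_%:M) 0 0]mxE /= mulr1n mulVf // scale1r.
      move: E; rewrite a0 mul0mx add0r => bA.
      by rewrite (row_free_inj fs (etrans bA (esym (mul0mx _ _)))) row_mx0.
    have -> : A (F :: s) = col_mx (phi F) (A s) :> 'M[k]_(1 + size s, r).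
      apply/row_matrixP => j; rewrite rowK; case: (split_ordP j) => i ->.
        by rewrite rowKu /= (ord1 i) /= row_id.
      by rewrite rowKd rowK.
    exact: fr.
  by move=> /maxN; rewrite ltnn.
have [a ea] := submxP sub.
exists (fun j => a 0 j); apply/mpoly.mpolyP => m; rewrite linear_sum /=.
have [sm|sm] := ltnP (mpoly.mdeg m) d; last first.
  rewrite mpoly.memN_msupp_eq0 ?big1 // => [j _|]; last first.
    by apply: mpoly.msize_mdeg_ge; exact: leq_trans sm.
  rewrite mpoly.mcoeffZ mpoly.memN_msupp_eq0 ?mulr0 //.
  apply: mpoly.msize_mdeg_ge; apply: leq_trans sm.
  by have [] := Ws _ (mem_nth 0 (ltn_ord j)).
have := congr1 (fun v : 'rV__ => v 0 (enum_rank (mpoly.BMultinom sm : B))) ea.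
rewrite /phi !mxE enum_rankK /= => ->; apply: eq_bigr => j _.
by rewrite mpoly.mcoeffZ !mxE enum_rankK.
Qed.

(** C consists of the coefficients of finite spanning families, one for each degree bound, of the
    polynomials vanishing on X. If D kills C, applying D to the coefficients of a combination of a_j
    B_j gives the combination of D(a_j) B_j, which still vanishes on X. *)
Lemma D_stable_countable (k : fieldType) (X : kspace k) n (e : morphism X (projsp k n)) :
  exists C : set k, countable C /\
    forall D, derivation D -> (forall c, C c -> D c = 0) -> D_stable e D.
Proof.
pose W : set (mpoly.mpoly n.+1 k) := [set F | forall p, heval F (e p) = 0].
have [s sP] := choice (fun d => finite_span d W).
pose c (w : nat * nat * mpoly.multinom n.+1) := mpoly.mcoeff w.2 (nth 0 (s w.1.1) w.1.2).
exists (range c); split.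
  by apply: sub_countable (card_image_le c _) _; exact: countableP.
move=> D derD Dc F WF p; have [a ->] := (sP (mpoly.msize F)).2 F WF (leqnn _).
rewrite coefD_sum // /heval raddf_sum /= big1 // => j _.
rewrite coefDZ // coefD_killed //; last first.
  by move=> m; apply: Dc; exists (mpoly.msize F, nat_of_ord j, m).
rewrite scaler0 add0r mpoly.mevalZ.
by have := (sP (mpoly.msize F)).1 _ (mem_nth 0 (ltn_ord j)); move=> /(_ p);
  rewrite /heval => ->; rewrite mulr0.
Qed.

(* D is prescribed on k0[u], u the affine coordinates of p, as differentiation in
   the direction xi: genericity of p makes this well defined. *)
Lemma exists_tau (k : fieldType) (char0 : [pchar k] =i pred0) (X : kspace k) n
    (e : morphism X (projsp k n)) (k0 : set k) (p : X) d (x : 'I_d -> X -> k)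
    (xi : 'I_d -> k) :
  immersion e -> irreducible_set [set: X] -> is_subring k0 ->
  (forall D, derivation D -> (forall c, k0 c -> D c = 0) -> D_stable e D) ->
  (forall F i0, poly_over k0 F -> hcoord (e p) i0 != 0 ->
     mpoly.meval (affc i0 (e p)) F = 0 ->
     \forall q \near p, mpoly.meval (affc i0 (e q)) F = 0) ->
  local_coordinates p x ->
  exists D, [/\ derivation D, D_stable e D & forall a, tau e D p (x a) = xi a].
Proof.
move=> ie iX rk0 st gen lx; have [i0 n0] := hcoord_neq0 (e p).
pose z (i : 'I_n.+1) : X -> k := fun q => affc i0 (e q) i.
have rz i : reg_at p (z i) by exact: reg_at_chart.
pose ev F q := mpoly.meval (affc i0 (e q)) F.
have rev F : reg_at p (ev F) by exact: reg_at_meval.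
pose pair (v : 'rV[k]_d) : k := \sum_a v 0 a * xi a.
pose G0 : set (k * k) := [set w | exists F v,
  [/\ poly_over k0 F, diff_expand p x (ev F) v & w = (ev F p, pair v)]].
have rG0 : dual_subring G0.
  split.
  - exists 1, 0; split.
    + by rewrite -[1]/(mpoly.mpolyC _ 1); apply: poly_overC => //; case: rk0.
    + apply: diff_expand_eq (diff_expand_cst x p 1); apply: near_all => q.
      by rewrite /ev mpoly.meval1.
    + by rewrite /ev mpoly.meval1 /pair big1 // => a _; rewrite mxE mul0r.
  - move=> _ _ [F [v [kF eF ->]]] [G [w [kG eG ->]]].
    exists (F - G), (v - w); split; first exact: poly_overB.
      apply: diff_expand_eq (diff_expand_sub eF eG); apply: near_all => q.
      by rewrite /ev mpoly.mevalB.
    rewrite /ev mpoly.mevalB /pair -sumrB /=; congr (_, _).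
    by apply: eq_bigr => a _; rewrite !mxE mulrBl.
  - move=> _ _ [F [v [kF eF ->]]] [G [w [kG eG ->]]].
    exists (F * G), (ev F p *: w + ev G p *: v); split; first exact: poly_overM.
      apply: diff_expand_eq (diff_expand_mul (rev F) (rev G) eF eG).
      by apply: near_all => q; rewrite /ev mpoly.mevalM.
    congr (_, _); first by rewrite /ev mpoly.mevalM.
    rewrite /pair [LHS]/=; set A := ev F p; set C := ev G p.
    rewrite mulr_sumr mulr_suml -big_split /=.
    by apply: eq_bigr => a _; rewrite !mxE; ring.
(* By genericity a polynomial over k0 vanishing at p vanishes near p, so its differential at p is
   zero. *)
have vG0 : vertical G0.
  move=> b [F [v [kF eF [eF0 ->]]]].
  have near0 := gen F i0 kF n0 (esym eF0).
  have v0 : v = 0.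
    apply: (diff_expand_uniq lx eF); apply: diff_expand_eq (diff_expand_cst x p 0).
    by apply: near_sub near0 => q; rewrite /ev => ->.
  by rewrite v0 /pair big1 // => a _; rewrite mxE mul0r.
have [D [derD DG]] := extend_derivation char0 rG0 vG0.
have Dk0 c : k0 c -> D c = 0.
  move=> kc; apply: DG; exists (mpoly.mpolyC _ c), 0; split.
  - exact: poly_overC.
  - apply: diff_expand_eq (diff_expand_cst x p c); apply: near_all => q.
    by rewrite /ev mpoly.mevalC.
  - by rewrite /ev mpoly.mevalC /pair big1 // => a _; rewrite mxE mul0r.
have stD := st D derD Dk0.
exists D; split=> // a.
have hZ i : {v | diff_expand p x (z i) v}.
  by apply: cid; case: lx => _ ux; have [v [ev' _]] := ux _ (rz i); exists v.
have tz i : tau e D p (z i) = pair (sval (hZ i)).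
  rewrite tau_affc //; apply: DG; exists (mpoly.mpolyX k (mpoly.mnm1 i)), (sval (hZ i)).
  split; first exact: poly_overX.
    apply: diff_expand_eq (svalP (hZ i)); apply: near_all => q.
    by rewrite /ev mpoly.mevalXU.
  by rewrite /ev mpoly.mevalXU.
(* With the zero derivation only the expansion of dx_a in the dz_i is extracted. Since tau(z_i) is
   the pairing of dz_i with xi, tau(x_a) is that of dx_a with xi. *)
have [c [_ [_ _ _ /nbhs_singleton[ec _]]]] :=
  pres_affine (derivation0 k) ie n0 (lx.1 a).
rewrite (tau_expand ie iX derD stD rz ec) (eq_bigr _ (fun i _ => congr1 _ (tz i))).
pose Z : 'M[k]_(n.+1, d) := \matrix_i sval (hZ i).
have eZ := diff_expand_change ec (A := Z) (fun i => _).
have {eZ} /(diff_expand_uniq lx) /(_ (diff_expand_coord x p a)) cZ :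
    diff_expand p x (x a) (c p *m Z).
  by apply: eZ => i; rewrite rowK; exact: svalP.
transitivity (\sum_b (c p *m Z) 0 b * xi b).
  under eq_bigr do rewrite /pair mulr_sumr.
  rewrite exchange_big; apply: eq_bigr => b _; rewrite mxE mulr_suml.
  by apply: eq_bigr => i _; rewrite mxE mulrA.
rewrite cZ (bigD1 a) //= big1 ?addr0 => [|b ba]; rewrite mxE eqxx ?eqxx ?mul1r //.
by rewrite (negbTE ba) mul0r.
Qed.

(** * The section of K_S - f^*K_X *)

Section DualBundle.
Variables (k : fieldType) (S : kspace k) (L : line_bundle S).

Lemma lb_dual_reg (i j : lb_idx L) : reg S (lb_cov i `&` lb_cov j) (lb_trans j i).
Proof. by rewrite setIC; exact: lb_reg. Qed.

Lemma lb_dual_neq0 (i j : lb_idx L) p : lb_cov i p -> lb_cov j p -> lb_trans j i p != 0.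
Proof. by move=> ip jp; exact: lb_neq0. Qed.

Lemma lb_dual_cocycle (i j l : lb_idx L) p : lb_cov i p -> lb_cov j p -> lb_cov l p ->
  lb_trans j i p * lb_trans l j p = lb_trans l i p.
Proof. by move=> ip jp lp; rewrite mulrC lb_cocycle. Qed.

Definition lb_dual : line_bundle S :=
  LineBundle (@lb_open _ _ L) (@lb_cover _ _ L) lb_dual_reg lb_dual_neq0 lb_dual_cocycle.

Lemma lb_tensor_dual (M : line_bundle S) :
  lb_iso (lb_tensor L (lb_tensor lb_dual M)) M.
Proof.
exists (fun i a => fun p => lb_trans i.1 i.2.1 p * lb_trans i.2.2 a p); split.
- move=> [i [i' j]] a /=; apply: reg_mul.
  + by apply: openI; [apply: openI; [|apply: openI]|]; exact: lb_open.
  + apply: reg_sub (lb_reg i i').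
    * by apply: openI; exact: lb_open.
    * by apply: openI; [apply: openI; [|apply: openI]|]; exact: lb_open.
    * by move=> p [[? [? ?]] ?].
  + apply: reg_sub (lb_reg j a).
    * by apply: openI; exact: lb_open.
    * by apply: openI; [apply: openI; [|apply: openI]|]; exact: lb_open.
    * by move=> p [[? [? ?]] ?].
- by move=> [i [i' j]] a p [/= ip [i'p jp]] ap; rewrite mulf_neq0 // lb_neq0.
- move=> [i1 [i1' j1]] [i2 [i2' j2]] a b p /= [i1p [i1'p j1p]] [i2p [i2'p j2p]] ap bp.
  rewrite -mulrA lb_cocycle //.
  rewrite -(lb_cocycle i1p i2p i1'p) -(lb_cocycle i2p i2'p i1'p).
  by rewrite -(lb_cocycle j1p j2p bp); ring.
Qed.

End DualBundle.

(** On an irreducible space a section nonzero at one point is nonzero on a dense open set. *)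
Lemma section_effective (k : fieldType) (S : kspace k) (M : line_bundle S)
    (s : lb_idx M -> S -> k) : irreducible_set [set: S] ->
  (forall i, reg S (lb_cov i) (s i)) ->
  (forall i j p, lb_cov i p -> lb_cov j p -> s i p = lb_trans i j p * s j p) ->
  (exists i p, lb_cov i p /\ s i p != 0) -> effective_divisor_bundle M.
Proof.
move=> iS rs cs [j [p [jp np]]]; exists s; split=> // i W oW [w Ww] sW.
have [oV _] := reg_inv (@lb_open _ _ M j) (rs j).
have m1 : [set: S] `&` W !=set0 by exists w.
have m2 : [set: S] `&` (lb_cov j `&` [set p | s j p != 0]) !=set0 by exists p.
have [q [_ [Wq [jq nq]]]] := irreducible_meet iS oW oV m1 m2.
exists q => //; rewrite (cs i j q (sW _ Wq) jq) mulf_neq0 //.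
by apply: lb_neq0 => //; exact: sW.
Qed.

Section Jacobian.
Variables (k : fieldType) (X S : kspace k) (f : morphism S X).
Variables (n m : nat) (eX : morphism X (projsp k n)) (eS : morphism S (projsp k m)).
Hypotheses (iX : immersion eX) (irX : irreducible_set [set: X]) (iS : immersion eS).
Variables (d e : nat) (D : 'I_e -> k -> k).
Hypotheses (derD : forall c, derivation (D c)) (stD : forall c, D_stable eX (D c)).
Implicit Types (y : 'I_d -> S -> k) (x : 'I_(d + e) -> X -> k).

Definition dcoef y (q : S) (h : S -> k) : 'rV[k]_d :=
  xget 0 [set v | diff_expand q y h v].

Lemma dcoefE y q h v : local_coordinates q y -> diff_expand q y h v -> dcoef y q h = v.
Proof.
move=> ly ev; rewrite /dcoef; case: xgetP => [w _ ew|/(_ v)//].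
exact: diff_expand_uniq ly ew ev.
Qed.

Lemma dcoefP y q h : local_coordinates q y -> reg_at q h ->
  diff_expand q y h (dcoef y q h).
Proof.
move=> ly rh; have [_ uy] := ly; have [v [ev _]] := uy h rh.
by rewrite (dcoefE ly ev).
Qed.

Definition jac_diff x y q : 'M[k]_(d + e, d) := \matrix_a dcoef y q (x a \o f).
Definition jac_tau x q : 'M[k]_(d + e, e) := \matrix_(a, c) tau eX (D c) (f q) (x a).

(* The tangent space of S together with the vectors D_c(f(q)), measured in the
   coordinates x of X. *)
Definition jac x y q : k := \det (row_mx (jac_diff x y q) (jac_tau x q)).

(** Both blocks are multiplied by A on the left: the first by the chain rule, the second because
    each tau is a tangent vector at f(q). *)
Lemma jac_change_x x x' y q (A : 'M[k]_(d + e)) :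
  local_coordinates q y -> (forall a, reg_at (f q) (x a)) ->
  (forall b, diff_expand (f q) x (x' b) (row b A)) ->
  jac x' y q = \det A * jac x y q.
Proof.
move=> ly rx eA; rewrite /jac -det_mulmx mul_mx_row; congr (\det (row_mx _ _)).
  apply/row_matrixP => b; rewrite rowK row_mul; apply: dcoefE => //.
  apply: diff_expand_change (diff_expand_pull (eA b)) _ => a.
  by rewrite rowK; apply: dcoefP => //; exact: reg_at_pull.
apply/matrixP => b c; rewrite !mxE.
rewrite (tau_expand iX irX (derD c) (stD c) rx (eA b)).
by apply: eq_bigr => a _; rewrite !mxE.
Qed.

Lemma jac_change_y x y y' q (B : 'M[k]_d) :
  local_coordinates q y -> local_coordinates q y' ->
  (forall a, reg_at (f q) (x a)) ->
  (forall b, diff_expand q y (y' b) (row b B)) ->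
  jac x y q = \det B * jac x y' q.
Proof.
move=> ly ly' rx eB.
rewrite mulrC -[\det B]mulr1 -(det1 k e) -(det_ublock B 0) -det_mulmx.
rewrite mul_row_block !mulmx0 mulmx1 add0r addr0; congr (\det (row_mx _ _)).
apply/row_matrixP => a; rewrite rowK row_mul rowK; apply: dcoefE => //.
apply: diff_expand_change _ eB; apply: dcoefP => //; exact: reg_at_pull.
Qed.

(** The partial derivatives in y are regular, but the entries of [jac_tau] contain D(x_a(f(q))). By
    [pres_local] this is a regular function plus the partial derivatives of x_a composed with f,
    weighted by D(y_b(q)); column operations with these weights remove the irregular part. *)
Lemma jac_reg x y q0 : (\forall q \near q0, local_coordinates q y) ->
  (forall a, reg_at (f q0) (x a)) -> reg_at q0 (jac x y).
Proof.
move=> nly rx; have ly := nbhs_singleton nly.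
have rxf a : reg_at q0 (x a \o f) by exact: reg_at_pull.
have hV a : {w : (S -> 'rV[k]_d) * (S -> k) |
    pres_with (fun=> 0) y q0 (x a \o f) w.1 w.2}.
  by apply: cid; have [c [h0 w]] := pres_local (derivation0 k) iS ly (rxf a); exists (c, h0).
have hD c a : {w : (S -> 'rV[k]_d) * (S -> k) | pres_with (D c) y q0 (x a \o f) w.1 w.2}.
  by apply: cid; have [v [h0 w]] := pres_local (derD c) iS ly (rxf a); exists (v, h0).
pose V q : 'M[k]_(d + e, d) := \matrix_a (sval (hV a)).1 q.
pose R q : 'M[k]_(d + e, e) :=
  \matrix_(a, c) ((sval (hD c a)).2 q - Dgerm eX (D c) (f q) (x a)).
have rV a b : reg_at q0 (fun q => V q a b).
  have [_ r _ _] := svalP (hV a); apply: reg_at_eq (r b).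
  by apply: near_all => q; rewrite !mxE.
have rR a c : reg_at q0 (fun q => R q a c).
  have [_ _ r _] := svalP (hD c a).
  have rg := reg_at_pull (Dgerm_reg iX irX (derD c) (stD c) (rx a)).
  apply: reg_at_eq (reg_at_sub r rg).
  by apply: near_all => q; rewrite !mxE.
apply: (@reg_at_eq _ _ _ (fun q => \det (row_mx (V q) (R q)))); last first.
  apply: reg_at_det => a b; case: (split_ordP b) => b' ->.
    by apply: reg_at_eq (rV a b'); apply: near_all => q; rewrite row_mxEl.
  by apply: reg_at_eq (rR a b'); apply: near_all => q; rewrite row_mxEr.
have EV : \forall q \near q0, forall a,
    diff_expand q y (x a \o f) ((sval (hV a)).1 q).
  by apply: filter_forall => a; have [_ _ _] := svalP (hV a); apply: near_sub => q [].
have ED : \forall q \near q0, forall a c,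
    diff_expand q y (x a \o f) ((sval (hD c a)).1 q) /\
    D c ((x a \o f) q) = (sval (hD c a)).2 q +
      \sum_b (sval (hD c a)).1 q 0 b * D c (y b q).
  by apply: filter_forall => a; apply: filter_forall => c; case: (svalP (hD c a)).
apply: near_sub2 nly (near_and EV ED) => q lyq [EVq EDq].
(* The weights of the column operation, which is a unipotent block matrix and preserves the
   determinant. *)
pose B : 'M[k]_(d, e) := \matrix_(b, c) D c (y b q).
have -> : row_mx (V q) (R q) = row_mx (jac_diff x y q) (jac_tau x q - jac_diff x y q *m B).
  have VE : V q = jac_diff x y q.
    by apply/row_matrixP => a; rewrite !rowK (dcoefE lyq (EVq a)).
  congr (row_mx _ _) => //; apply/matrixP => a c; rewrite !mxE /tau.
  have [e1 e2] := EDq a c; rewrite -[D c (x a (f q))]/(D c ((x a \o f) q)) e2.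
  have -> : \sum_j jac_diff x y q a j * B j c =
      \sum_b (sval (hD c a)).1 q 0 b * D c (y b q).
    by apply: eq_bigr => b _; rewrite !mxE (dcoefE lyq e1).
  by set s := \sum_(_ < d) _; ring.
have -> : row_mx (jac_diff x y q) (jac_tau x q - jac_diff x y q *m B) =
    row_mx (jac_diff x y q) (jac_tau x q) *m block_mx 1%:M (- B) 0 1%:M.
  by rewrite mul_row_block !mulmx0 !mulmx1 addr0 mulmxN addrC.
by rewrite det_mulmx det_ublock !det1 !mulr1.
Qed.

End Jacobian.

Section CanonicalDifference.
Variables (k : fieldType) (X S : kspace k) (f : morphism S X).
Variables (n m : nat) (eX : morphism X (projsp k n)) (eS : morphism S (projsp k m)).
Hypotheses (iX : immersion eX) (irX : irreducible_set [set: X]).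
Hypotheses (iS : immersion eS) (irS : irreducible_set [set: S]).
Variables (d e : nat) (D : 'I_e -> k -> k).
Hypotheses (derD : forall c, derivation (D c)) (stD : forall c, D_stable eX (D c)).
Variables (K : line_bundle X) (K' : line_bundle S).
Variables (x : lb_idx K -> 'I_(d + e) -> X -> k) (y : lb_idx K' -> 'I_d -> S -> k).
Hypotheses (lx : forall i p, lb_cov i p -> local_coordinates p (x i))
  (tx : forall i j p (A : 'M[k]_(d + e)), lb_cov i p -> lb_cov j p ->
          (forall b, diff_expand p (x i) (x j b) (row b A)) -> lb_trans i j p = \det A).
Hypotheses (ly : forall i p, lb_cov i p -> local_coordinates p (y i))
  (ty : forall i j p (A : 'M[k]_d), lb_cov i p -> lb_cov j p ->
          (forall b, diff_expand p (y i) (y j b) (row b A)) -> lb_trans i j p = \det A).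

Lemma canonical_difference_effective i0 j0 q0 :
  lb_cov (i0 : lb_idx K) (f q0) -> lb_cov (j0 : lb_idx K') q0 ->
  jac f eX D (x i0) (y j0) q0 != 0 ->
  effective_divisor_bundle (lb_tensor (lb_dual (lb_pullback f K)) K').
Proof.
move=> i0q j0q nq.
pose N := lb_tensor (lb_dual (lb_pullback f K)) K'.
pose s (a : lb_idx N) : S -> k := jac f eX D (x a.1) (y a.2).
apply: (@section_effective _ _ N s) => //; last by exists (i0, j0), q0.
  move=> [i j]; apply: reg_of_at; first exact: lb_open.
  move=> q [/= iq jq]; apply: (jac_reg iX irX iS) => //.
    by apply: near_sub (near_of_open (lb_open j) jq) => r; exact: ly.
  by move=> a; case: (lx iq).
move=> [i j] [i' j'] q /= [/= iq jq] [/= i'q j'q]; rewrite /s /=.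
have [rxi ux] := lx iq; have [ryj uy] := ly jq.
have lxi' := lx i'q; have lyj' := ly j'q.
have [B eB] : exists B : 'M[k]_d, forall b, diff_expand q (y j) (y j' b) (row b B).
  exists (\matrix_b dcoef (y j) q (y j' b)) => b; rewrite rowK.
  by apply: dcoefP; [exact: ly|case: lyj'].
(* Here x_i is expanded in x_i', opposite to the treatment of y, because the dual bundle exchanges
   the two indices of a transition function. *)
have [A eA] : exists A : 'M[k]_(d + e),
    forall b, diff_expand (f q) (x i') (x i b) (row b A).
  exists (\matrix_b dcoef (x i') (f q) (x i b)) => b; rewrite rowK.
  by apply: dcoefP => //; exact: rxi.
rewrite (ty jq j'q eB) /= (tx i'q iq eA).
rewrite (jac_change_y eX D (ly jq) lyj' rxi eB).
rewrite (jac_change_x iX irX derD stD lyj' lxi'.1 eA); ring.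
Qed.

End CanonicalDifference.

(** * Nonvanishing of the section *)

(** V has rank d, so it spans the same columns as the first d columns of the invertible
    [col_ebase V]; the other e columns complete it. *)
Lemma complete_columns (k : fieldType) d e (V : 'M[k]_(d + e, d)) (C : 'M[k]_(d, d + e)) :
  C *m V = 1%:M -> exists W : 'M[k]_(d + e, e), \det (row_mx V W) != 0.
Proof.
move=> CV; have rV : \rank V = d.
  apply/eqP; rewrite eqn_leq rank_leq_col /=.
  by apply: (@mulmx1_min_rank _ d _ _ V C 1%:M); rewrite mulmx1.
pose L := col_ebase V; exists (rsubmx L).
have VE : V = lsubmx L *m row_ebase V.
  rewrite -[LHS]mulmx_ebase rV pid_mx_col -/L -[L in LHS]hsubmxK.
  by rewrite mul_row_col mulmx1 mulmx0 addr0.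
have -> : row_mx V (rsubmx L) = L *m block_mx (row_ebase V) 0 0 1%:M.
  by rewrite -[L in RHS]hsubmxK mul_row_block !mulmx0 mulmx1 addr0 add0r -VE.
rewrite det_mulmx det_ublock det1 mulr1 mulf_neq0 //.
  by have := col_ebase_unit V; rewrite unitmxE unitfE.
by have := row_ebase_unit V; rewrite unitmxE unitfE.
Qed.

Section Lifting.
Variables (k : fieldType) (X S : kspace k) (f : morphism S X) (q : S).

(** f is an immersion at q: pullback from X to S is surjective on germs. *)
Definition germs_lift : Prop := forall h, reg_at q h ->
  exists g, reg_at (f q) g /\ \forall q' \near q, h q' = g (f q').

Hypothesis lift : germs_lift.
Variables (N d : nat) (x : 'I_N -> X -> k) (y : 'I_d -> S -> k).
Hypotheses (lx : local_coordinates (f q) x) (ly : local_coordinates q y).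

Let V : 'M[k]_(N, d) := \matrix_a dcoef y q (x a \o f).

Let eV a : diff_expand q y (x a \o f) (row a V).
Proof. by rewrite rowK; apply: dcoefP => //; apply: reg_at_pull; case: lx. Qed.

(** If y_b lifts to a germ g_b on X, the coefficients of dg_b in the dx_a express dy_b through the
    rows of V. *)
Lemma differential_left_inverse : exists C : 'M[k]_(d, N), C *m V = 1%:M.
Proof.
have hg b : {w : (X -> k) * 'rV[k]_N |
    diff_expand (f q) x w.1 w.2 /\ \forall q' \near q, y b q' = w.1 (f q')}.
  apply: cid; have [g [rg E]] := lift (ly.1 b).
  by have [v [ev _]] := lx.2 g rg; exists (g, v).
exists (\matrix_b (sval (hg b)).2); apply/row_matrixP => b.
rewrite row_mul rowK row1; have [ev E] := svalP (hg b).
apply: (@diff_expand_uniq _ _ _ y q (y b)) => //; last exact: diff_expand_coord.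
apply: diff_expand_change (fun a => _ ) => //; last exact: eV.
apply: diff_expand_eq (diff_expand_pull ev).
by apply: near_sub E => q' ->.
Qed.

(** If a combination of the dx_a pulls back to zero, it is on S a sum of products of germs vanishing
    at q. These lift to X, and the identity holds on the image of a neighbourhood of q, which is
    open in X; hence the combination is trivial. *)
Lemma differential_right_injective : (exists U : set S, [/\ open U, U q &
    forall W : set S, open W -> W `<=` U -> open (f @` W)]) -> (N <= d)%N.
Proof.
move=> [U [oU Uq opU]].
suff /eqP <- : row_free V by exact: rank_leq_col.
apply: inj_row_free => c cV.
pose h (p : X) := \sum_a c 0 a * x a p.
have eh : diff_expand q y (h \o f) 0.
  have := diff_expand_sum (index_enum 'I_N) (fun a => diff_expand_scale (c 0 a) (eV a)).
  rewrite (_ : \sum_(i <- _) _ = 0) // -[RHS]cV; apply/rowP => b.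
  rewrite summxE mxE; apply: eq_bigr => a _.
  by rewrite !mxE.
have [n [a [b [rab /near_open[W0 [oW0 W0q sW0]]]]]] := in_max_sqE eh.
have lg i : {w : (X -> k) * (X -> k) | [/\ reg_at (f q) w.1, reg_at (f q) w.2 &
    \forall q' \near q, a i q' = w.1 (f q') /\ b i q' = w.2 (f q')]}.
  apply: cid; have [ra rb _ _] := rab i.
  have [g [rg E]] := lift ra; have [g' [rg' E']] := lift rb.
  by exists (g, g'); split=> //; exact: near_and.
have /near_open[W1 [oW1 W1q sW1]] : \forall q' \near q, forall i,
    a i q' = (sval (lg i)).1 (f q') /\ b i q' = (sval (lg i)).2 (f q').
  by apply: filter_forall => i; case: (svalP (lg i)).
have oW : open (f @` (U `&` W0 `&` W1)).
  by apply: opU; [do 2 apply: openI => // | move=> r [[]]].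
apply: (diff_expand_uniq lx (f := h)); last first.
  apply: in_max_sqP; exists n, (fun i => (sval (lg i)).1), (fun i => (sval (lg i)).2).
  split.
    move=> i; have [rg rg' _] := svalP (lg i); have [_ _ a0 b0] := rab i.
    by have [e1 e2] := sW1 _ W1q i; split=> //; rewrite -?e1 -?e2.
  apply/near_open; exists (f @` (U `&` W0 `&` W1)); split=> //; first by exists q.
  move=> _ [r [[Ur W0r] W1r] <-] /=.
  have := sW0 r W0r; rewrite /= [X in _ - X = _]big1 ?subr0 => [E|b' _]; last first.
    by rewrite mxE mul0r.
  rewrite [X in _ - X = _]big1 ?subr0 => [|b' _]; last by rewrite mxE mul0r.
  rewrite -/(h (f r)) -/(h (f q)) E.
  by apply: eq_bigr => i _; have [-> ->] := sW1 r W1r i.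
have := diff_expand_sum (index_enum 'I_N)
  (fun a => diff_expand_scale (c 0 a) (diff_expand_coord x (f q) a)).
by rewrite -row_sum_delta.
Qed.

End Lifting.

Section CanonicalEffective.
Variables (k : fieldType) (X S : kspace k) (f : morphism S X).
Variables (n m : nat) (eX : morphism X (projsp k n)) (eS : morphism S (projsp k m)).
Hypotheses (iX : immersion eX) (irX : irreducible_set [set: X]).
Hypotheses (iS : immersion eS) (irS : irreducible_set [set: S]).
Variables (K : line_bundle X) (K' : line_bundle S).
Hypotheses (cK : canonical_bundle K) (cK' : canonical_bundle K').

Lemma canonical_effective (q : S) : germs_lift f q ->
  (forall N (x : 'I_N -> X -> k), local_coordinates (f q) x ->
     (forall xi, exists D, [/\ derivation D, D_stable eX D &
        forall a, tau eX D (f q) (x a) = xi a]) \/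
     (forall d (y : 'I_d -> S -> k), local_coordinates q y -> (N <= d)%N)) ->
  exists M, effective_divisor_bundle M /\ lb_iso (lb_tensor (lb_pullback f K) M) K'.
Proof.
move=> lift alt.
exists (lb_tensor (lb_dual (lb_pullback f K)) K'); split; last exact: lb_tensor_dual.
have [N _ [x [rx lx tx]]] := cK; have [d _ [y [ry ly ty]]] := cK'.
have [i0 i0q] := lb_cover K (f q); have [j0 j0q] := lb_cover K' q.
have lxq := lx _ _ i0q; have lyq := ly _ _ j0q.
have [C CV] := differential_left_inverse lift lxq lyq.
have leN := mulmx1_min CV; have [e NE] : exists e, N = (d + e)%N.
  by exists (N - d)%N; rewrite subnKC.
subst N; have [W nW] := complete_columns CV.
have [D [derD stD tD]] : exists D : 'I_e -> k -> k,
    [/\ forall c, derivation (D c), forall c, D_stable eX (D c) &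
        forall a c, tau eX (D c) (f q) (x i0 a) = W a c].
  (* Either D_c realizes column c of the completion W as tangent vector, or N = d and there is no
     column to fill. *)
  have [H|H] := alt _ _ lxq.
    have [D HD] := choice (fun c => H (fun a => W a c)).
    by exists D; split=> [c|c|a c]; case: (HD c).
  have e0 : e = 0%N by have := H d _ lyq; lia.
  by subst e; exists (fun _ _ => 0); split=> [[]//|[]//|a []].
apply: (canonical_difference_effective iX irX iS irS derD stD lx tx ly ty i0q j0q).
rewrite /jac; congr (\det (row_mx _ _) != 0): nW.
by apply/matrixP => a c; rewrite !mxE tD.
Qed.

End CanonicalEffective.

(** * Pullback of pseudo-effective classes *)
Import numFieldNormedType.Exports.

Section EffectiveCones.
Variables (R : realType) (k : fieldType).

Lemma linear_rV_continuous (r s : nat) (psi : {linear 'rV[R]_r -> 'rV[R]_s}) :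
  continuous (psi : 'rV[R]_r -> 'rV[R]_s).
Proof.
have -> : (psi : 'rV[R]_r -> 'rV[R]_s) =
    fun w : 'rV[R]_r => \sum_i (w 0 i) *: psi (delta_mx 0 i).
  apply/funext => w; rewrite {1}(row_sum_delta w) linear_sum.
  by apply: eq_bigr => i _; rewrite linearZ.
elim: (index_enum _) => [|i l IH] v.
  have -> : (fun w : 'rV[R]_r => \sum_(i <- [::]) (w 0 i) *: psi (delta_mx 0 i)) =
      fun=> 0 by apply/funext => w; rewrite big_nil.
  exact: cst_continuous.
have -> : (fun w : 'rV[R]_r => \sum_(j <- i :: l) (w 0 j) *: psi (delta_mx 0 j)) =
    fun w => w 0 i *: psi (delta_mx 0 i) + \sum_(j <- l) (w 0 j) *: psi (delta_mx 0 j).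
  by apply/funext => w; rewrite big_cons.
have c1 : (fun w : 'rV[R]_r => w 0 i *: psi (delta_mx 0 i)) @ v -->
    v 0 i *: psi (delta_mx 0 i).
  have cc : (fun w : 'rV[R]_r => w 0 i) @ v --> v 0 i := @coord_continuous R 1 r 0 i v.
  exact: cvgZr_tmp cc.
exact: cvgD c1 (IH v).
Qed.

Lemma natSinv_lt (e : R) : 0 < e -> exists m : nat, m.+1%:R^-1 < e.
Proof.
move=> e0; have [N _ H] := near_infty_natSinv_lt (PosNum e0).
by exists N; exact: (H N (leqnn N)).
Qed.

Variable S : kspace k.

Lemma effective_add r (c : line_bundle S -> 'rV[R]_r) v w :
  effective_cone c v -> effective_cone c w -> effective_cone c (v + w).
Proof.
move=> [m [a [M [a0 eM ->]]]] [m' [a' [M' [a'0 eM' ->]]]].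
exists (m + m')%N, (fun i => match fintype.split i with inl j => a j | inr j => a' j end),
  (fun i => match fintype.split i with inl j => M j | inr j => M' j end); split.
- by move=> i; case: (fintype.split i).
- by move=> i; case: (fintype.split i).
by rewrite big_split_ord /=; congr (_ + _); apply: eq_bigr => i _;
  rewrite ?(unsplitK (inl i)) ?(unsplitK (inr i)).
Qed.

(** Translation by w is continuous and preserves the effective cone, hence also its closure. *)
Lemma psef_add_effective r (c : line_bundle S -> 'rV[R]_r) v w :
  psef_cone c v -> effective_cone c w -> psef_cone c (v + w).
Proof.
move=> pv ew B nB.
have cw : {for v, continuous (fun u : 'rV[R]_r => u + w)}.
  have c1 : (fun u : 'rV[R]_r => u) @ v --> v by exact: cvg_id.
  have c2 : (fun u : 'rV[R]_r => w) @ v --> w by exact: cst_continuous.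
  exact: cvgD c1 c2.
have [u [eu Bu]] := pv _ (cw B nB).
by exists (u + w); split=> //; exact: effective_add.
Qed.

Lemma effective_one r (c : line_bundle S -> 'rV[R]_r) M :
  effective_divisor_bundle M -> effective_cone c (c M).
Proof.
move=> eM; exists 1%N, (fun=> 1), (fun=> M); split=> //.
by rewrite big_ord1 scale1r.
Qed.

End EffectiveCones.

Definition zero_locus (k : fieldType) (X : kspace k) (M : line_bundle X)
    (s : lb_idx M -> X -> k) : set X :=
  [set p | forall i, lb_cov i p -> s i p = 0].

Lemma closed_zero_locus (k : fieldType) (X : kspace k) (M : line_bundle X)
    (s : lb_idx M -> X -> k) : (forall i, reg X (lb_cov i) (s i)) ->
  closed (zero_locus s).
Proof.
move=> rs; rewrite -openC.
have -> : ~` zero_locus s = \bigcup_i (lb_cov i `&` [set p | s i p != 0]).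
  apply/seteqP; split=> p.
    move=> /existsNP[i /not_implyP[ip /eqP np]]; exists i => //.
  by move=> [i _ [ip /= /eqP np]] /(_ i ip).
by apply: bigcup_open => i _; have [] := reg_inv (@lb_open _ _ M i) (rs i).
Qed.

(* A pseudo-effective class is a limit of countably many effective divisors;
   outside their supports it pulls back to a pseudo-effective class. *)
Lemma psef_pull (R : realType) (k : fieldType) (X : kspace k) r
    (c : line_bundle X -> 'rV[R]_r) v : [set: X] !=set0 -> psef_cone c v ->
  exists V : nat -> set X, (forall i, closed (V i) /\ V i <> setT) /\
    forall (S : kspace k) (f : morphism S X) s (c' : line_bundle S -> 'rV[R]_s)
      (psi : {linear 'rV[R]_r -> 'rV[R]_s}),
      irreducible_set [set: S] -> (forall i, exists q, ~ V i (f q)) ->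
      (forall M, psi (c M) = c' (lb_pullback f M)) -> psef_cone c' (psi v).
Proof.
move=> [x0 _] pv.
have hE m : {w | effective_cone c w /\ ball v m.+1%:R^-1 w}.
  apply: cid; have nb : nbhs v (ball v m.+1%:R^-1).
    by apply: nbhsx_ballx; rewrite invr_gt0 ltr0n.
  by have [w [ew bw]] := pv _ nb; exists w.
(* The sets w i are the zero loci of sections defining the divisors of the m-th approximation,
   padded by empty sets. A map not landing in w i pulls the i-th section back to a nonzero one. *)
have hV m : {w : nat -> set X | (forall i, closed (w i) /\ w i <> setT) /\
    forall (S : kspace k) (f : morphism S X) s (c' : line_bundle S -> 'rV[R]_s)
      (psi : {linear 'rV[R]_r -> 'rV[R]_s}),
      irreducible_set [set: S] -> (forall i, exists q, ~ w i (f q)) ->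
      (forall M, psi (c M) = c' (lb_pullback f M)) ->
      effective_cone c' (psi (sval (hE m)))}.
  apply: cid; have [[N [a [M [a0 eM E]]]] _] := svalP (hE m).
  have hs i : {s : lb_idx (M i) -> X -> k | [/\
      forall j, reg X (lb_cov j) (s j),
      forall j l p, lb_cov j p -> lb_cov l p -> s j p = lb_trans j l p * s l p &
      zero_locus s <> setT]}.
    apply: cid; have [s [rs ns cs]] := eM i; exists s; split=> //.
    move=> zT; have [j jx] := lb_cover (M i) x0.
    have [|//|p jp np] := ns j (lb_cov j) (lb_open j); first by exists x0.
    have : zero_locus s p by rewrite zT.
    by move=> /(_ j jp) e0; rewrite e0 eqxx in np.
  exists (fun i => if insub i is Some j then zero_locus (sval (hs j)) else set0).
  split.
    move=> i; case: insubP => [j _ _|_]; last first.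
      split; first exact: closed0.
      by move=> e; have : [set: X] x0 by []; rewrite -e.
    by have [rs _ nT] := svalP (hs j); split=> //; exact: closed_zero_locus.
  move=> S f s c' psi irS dense psiE; rewrite E linear_sum.
  exists N, a, (fun i => lb_pullback f (M i)); split=> //; last first.
    by apply: eq_bigr => i _; rewrite linearZ psiE.
  move=> i; have [rs cs _] := svalP (hs i).
  apply: (@section_effective _ _ (lb_pullback f (M i))
     (fun j => sval (hs i) j \o f)) => //.
  - by move=> j; apply: mor_reg; [exact: lb_open|exact: rs].
  - by move=> j l p jp lp; exact: cs jp lp.
  have [q] := dense i; rewrite valK => /existsNP[j /not_implyP[jq /eqP nq]].
  by exists j, q.
exists (fun n => if @unpickle (nat * nat)%type n is Some mi
                 then sval (hV mi.1) mi.2 else set0); split.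
  move=> n; case: unpickle => [[m i]|]; first by case: (svalP (hV m)) => + _; exact.
  split; first exact: closed0.
  by move=> e; have : [set: X] x0 by []; rewrite -e.
move=> S f s c' psi irS dense psiE B nB.
have nB' := linear_rV_continuous nB.
have [e /= e0 eB] := (nbhs_ballP _ _).1 nB'.
have [m me] := natSinv_lt e0.
exists (psi (sval (hE m))); split; last first.
  apply: eB; apply: le_ball (ltW me) _ _; exact: (svalP (hE m)).2.
have [_ H] := svalP (hV m); apply: H => // i.
by have := dense (pickle (m, i)); rewrite pickleK.
Qed.

(** * The exceptional set *)

(** Near q the map [res] is an isomorphism onto an open subset of Y, so germs descend to Y, and from
    there extend to X by the immersion. *)
Lemma birational_lift (k : fieldType) (S Y X : kspace k) (res : morphism S Y)
    (iota : morphism Y X) (U : set S) (q : S) :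
  immersion iota -> open U -> U q ->
  (forall W : set S, open W -> W `<=` U -> open (res @` W) /\
     forall h, reg S W h ->
       exists2 g, reg Y (res @` W) g & forall p, W p -> h p = g (res p)) ->
  germs_lift (comp_mor res iota) q.
Proof.
move=> ii oU Uq bir h [W [oW Wq rh]].
have oUW := openI oU oW.
have [|oR lR] := bir (U `&` W) oUW; first by move=> p [].
have [|g rg hg] := lR h; first by apply: (reg_sub oW oUW) => // p [].
have Rq : (res @` (U `&` W)) (res q) by exists q.
have [g' [rg' E]] := immersion_germ ii (reg_atW oR rg Rq).
exists g'; split=> //.
apply: near_sub2 (near_of_open oUW (conj Uq Wq)) (near_pull E) => p UWp /= Ep.
by rewrite hg // Ep.
Qed.

Section VeryGeneral.
Variables (k : closedFieldType) (X Y : kspace k) (n : nat).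
Variables (e : morphism X (projsp k n)) (iota : morphism Y X).
Hypotheses (ce : closed_immersion e) (ci : closed_immersion iota).
Hypothesis irY : irreducible_set [set: Y].

Lemma range_comp_closed : closed (range (comp_mor iota e)).
Proof.
have [[je oe _] cre] := ce; have [_ cri] := ci.
have [W oW WE] := oe _ (closed_openC cri).
have -> : range (comp_mor iota e) = range e `&` ~` W.
  apply/seteqP; split=> l.
    move=> [y _ <-]; split; first by exists (iota y).
    move=> Wy; have : (~` range iota) (iota y) by rewrite WE.
    by apply; exists y.
  move=> [[x _ <-] nW]; have [[y _ yx]|nr] := pselect (range iota x).
    by exists y => //=; rewrite yx.
  by case: nW; move: nr; rewrite -[~ _]/((~` range iota) x) WE.
by apply: closedI => //; exact: open_closedC.
Qed.

Lemma range_comp_irreducible : irreducible_set (range (comp_mor iota e)).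
Proof.
have [[y0 _] iY] := irY; split; first by exists (comp_mor iota e y0); exists y0.
move=> B C cB cC sBC.
have cl D : closed D -> closed ((comp_mor iota e) @^-1` D).
  by move=> cD; rewrite -openC preimage_setC; apply: mor_open; rewrite openC.
have [|BY|CY] := iY _ _ (cl _ cB) (cl _ cC).
- by move=> y _; apply: (sBC _); exists y.
- by left=> _ [y _ <-]; exact: BY.
- by right=> _ [y _ <-]; exact: CY.
Qed.

Lemma very_general_point (V : nat -> set X) (U : set Y) :
  ~ countable [set: k] -> (forall i, closed (V i)) ->
  (forall i, exists y, ~ V i (iota y)) -> open U -> U !=set0 ->
  exists2 y, U y & forall i, ~ V i (iota y).
Proof.
move=> unc cV nV oU [y0 Uy0].
have [[je oe _] cre] := ce; have [[ji oi _] cri] := ci.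
have hO (i : nat) : {W : set (projsp k n) | open W /\ ~` V i = e @^-1` W}.
  by apply: cid; have [W oW WE] := oe _ (closed_openC (cV i)); exists W.
have [U1 oU1 U1E] := oi _ oU; have [U2 oU2 U2E] := oe _ oU1.
(* Index 0 places the point in U, index j+1 takes it out of V j. *)
pose O (i : nat) := if i is j.+1 then sval (hO j) else U2.
have [|l [[y _ yl] Ol]] :=
    projective_baire (O := O) unc range_comp_closed range_comp_irreducible.
  case=> [|j] /=.
    split=> //; exists (comp_mor iota e y0); split; first by exists y0.
    by rewrite /= -[U2 _]/((e @^-1` U2) (iota y0)) -U2E -[U1 _]/((iota @^-1` U1) y0) -U1E.
  have [oW WE] := svalP (hO j); split=> //; have [y ny] := nV j.
  exists (comp_mor iota e y); split; first by exists y.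
  by rewrite -[sval _ _]/((e @^-1` sval (hO j)) (iota y)) -WE.
exists y.
  rewrite U1E /= -[U1 _]/(U1 (iota y)) U2E /=.
  by have := Ol 0%N; rewrite /O -yl.
move=> i; have := Ol i.+1; rewrite /O -yl.
by rewrite -[sval _ _]/((e @^-1` sval (hO i)) (iota y)) -(svalP (hO i)).2.
Qed.

End VeryGeneral.

(** The hyperplane at infinity of the chart is included to make the set closed in X; F is any
    polynomial in the affine coordinates, the shape in which genericity is used by [exists_tau]. *)
Definition affine_locus (k : fieldType) (X : kspace k) n (e : morphism X (projsp k n))
    (F : mpoly.mpoly n.+1 k) (i0 : 'I_n.+1) : set X :=
  [set p | hcoord (e p) i0 = 0 \/ mpoly.meval (affc i0 (e p)) F = 0].

Lemma closed_affine_locus (k : fieldType) (X : kspace k) n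
    (e : morphism X (projsp k n)) (F : mpoly.mpoly n.+1 k) i0 :
  closed (affine_locus e F i0).
Proof.
rewrite -openC.
have -> : ~` affine_locus e F i0 = e @^-1` [set l | hcoord l i0 != 0 /\
    mpoly.meval (affc i0 l) F != 0].
  apply/seteqP; split=> p; rewrite /affine_locus /=.
    by move=> /not_orP[/eqP h1 /eqP h2]; split.
  by move=> [/eqP h1 /eqP h2] [].
by apply: mor_open; exact: open_affine.
Qed.

Section Comparison.
Variables (k : closedFieldType) (char0 : [pchar k] =i pred0).
Variables (X Y S : kspace k) (iota : morphism Y X) (res : morphism S Y).
Variables (n m : nat) (e : morphism X (projsp k n)) (eS : morphism S (projsp k m)).
Hypotheses (ce : closed_immersion e) (irX : irreducible_set [set: X]).
Hypotheses (iS : immersion eS) (irS : irreducible_set [set: S]).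
Hypotheses (ci : closed_immersion iota) (irY : irreducible_set [set: Y]).
Hypothesis bir : birational res.
Variables (k0 : set k) (rk0 : is_subring k0).
Hypothesis full : countable [set: k] -> forall c, k0 c.
Hypothesis stk0 : forall D, derivation D -> (forall c, k0 c -> D c = 0) -> D_stable e D.
Variable V : nat -> set X.
Hypothesis cV : forall i, closed (V i).
Hypothesis nV : forall i, exists y, ~ V i (iota y).
Hypothesis genV : forall F i0, poly_over k0 F -> affine_locus e F i0 <> setT ->
  exists i, affine_locus e F i0 = V i.
Variables (K : line_bundle X) (K' : line_bundle S).
Hypotheses (cK : canonical_bundle K) (cK' : canonical_bundle K').

Lemma canonical_comparison : exists M, effective_divisor_bundle M /\
  lb_iso (lb_tensor (lb_pullback (comp_mor res iota) K) M) K'.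
Proof.
have [U [oU [q1 Uq1] injU birU]] := bir.
have [ie cre] := ce; have [ii cri] := ci.
have [cnt|unc] := pselect (countable [set: k]).
- (* Here V contains all hypersurface sections, so Y = X and dim S = dim X. *)
  have sur : range iota = setT.
    apply: contrapT => nr.
    have [p0 np0] : exists p0, ~ range iota p0.
      apply: contrapT => h; apply: nr; apply/seteqP; split=> // p _.
      by apply: contrapT => np; apply: h; exists p.
    have [_ oe _] := ie; have [W oW WE] := oe _ (closed_openC cri).
    have Wp : W (e p0) by rewrite -[W _]/((e @^-1` W) p0) -WE.
    (* Some form G vanishes on Y but not at p0. As k0 = k here, its locus is a proper closed set of
       the list V and contains Y, against [nV]. *)
    move: (oW); rewrite proj_openE => -[I [hI IE]].
    move: Wp; rewrite IE => -[G IG nG]; have [d hG] := hI G IG.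
    have [i0 n0] := hcoord_neq0 (e p0).
    have [||i Vi] := genV (F := G) (i0 := i0).
    + by move=> l; exact: full.
    + move=> T; have : affine_locus e G i0 p0 by rewrite T.
      case=> [/eqP|z0]; first by rewrite (negbTE n0).
      by move: nG; rewrite (heval_affc hG n0) z0 mulr0 eqxx.
    have [y ny] := nV i; apply: ny; rewrite -Vi.
    have [h0|nh0] := eqVneq (hcoord (e (iota y)) i0) 0; first by left.
    right; apply/eqP/negPn/negP => nz.
    have : (~` range iota) (iota y).
      rewrite WE /= IE; exists G => //.
      by rewrite (heval_affc hG nh0) mulf_neq0 // expf_neq0.
    by apply; exists y.
  apply: (canonical_effective ie irX iS irS cK cK' (birational_lift ii oU Uq1 birU)).
  move=> N x lx; right => d y ly.
  apply: (differential_right_injective (birational_lift ii oU Uq1 birU) lx ly).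
  exists U; split=> // W oW WU; have [oR _] := birU W oW WU.
  have [_ oi _] := ii; have [W' oW' WE] := oi _ oR.
  have -> : comp_mor res iota @` W = W'; last by [].
  apply/seteqP; split=> p.
    move=> [q Wq <-] /=; rewrite -[W' _]/((iota @^-1` W') (res q)) -WE.
    by exists q.
  move=> W'p; have : range iota p by rewrite sur.
  move=> [y' _ yp]; have : (res @` W) y' by rewrite WE /= yp.
  by move=> [q Wq qy]; exists q => //=; rewrite qy.
- have [oR _] := birU U oU (fun _ h => h).
  (* The point is sought in the open image of U, so that it lifts to a q at which f is an
     immersion. *)
  have [|y [q Uq qy] yV] := very_general_point ce ci irY unc cV nV oR.
    by exists (res q1); exists q1.
  have lift := birational_lift ii oU Uq birU.
  apply: (canonical_effective ie irX iS irS cK cK' lift) => N x lx; left => xi.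
  apply: (exists_tau char0 xi ie irX rk0 stk0 _ lx) => F i0 kF n0 F0.
  have [T|nT] := pselect (affine_locus e F i0 = setT).
    apply: near_sub (near_chart n0) => p np.
    have : affine_locus e F i0 p by rewrite T.
    by case=> // h; rewrite h eqxx in np.
  have [i Vi] := genV kF nT; case: (yV i); rewrite -Vi -qy; right.
  exact: F0.
Qed.

End Comparison.

Theorem theorem1p2 (R : realType) (k : closedFieldType)
    (k_char0 : [pchar k] =i pred0)
    (X : kspace k) (X_var : projective_variety X) (X_smooth : smooth_variety X)
    (L : line_bundle X) (L_ample : ample L) :
  exists V : nat -> set X,
    (forall i, closed (V i) /\ V i <> setT) /\
    forall (Y : kspace k) (iota : morphism Y X),
      irreducible_set [set: Y] -> closed_immersion iota ->
      positive_dimensional Y ->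
      forall aX aY : R,
        is_a_smooth L aX -> is_a (lb_pullback iota L) aY -> aX < aY ->
        contained_in_union (range iota) V.
Proof.
have [irX [n [e ce]]] := X_var.
have [x0 _] := irX.1.
have set0T : set0 <> [set: X] by move=> E; have : [set: X] x0 by []; rewrite -E.
have [C [cC stC]] := D_stable_countable e.
(* For countable k the ring k0 is k itself. *)
have [k0 [ck0 Ck0 rk0 full]] : exists k0 : set k, [/\ countable k0, C `<=` k0,
    is_subring k0 & countable [set: k] -> forall c, k0 c].
  have [cnt|unc] := pselect (countable [set: k]); first by exists setT.
  by have [k0 [ck0 Ck0 rk0]] := countable_subring cC; exists k0.
have stk0 D : derivation D -> (forall c, k0 c -> D c = 0) -> D_stable e D.
  by move=> dD Dk0; apply: stC => // c /Ck0; exact: Dk0.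
have [g gk0] := countable_enum 0 ck0.
pose code := (seq (nat * mpoly.multinom n.+1) * 'I_n.+1)%type.
pose VA (w : code) : set X :=
  let A := affine_locus e (poly_of_code g w.1) w.2 in
  if pselect (A = setT) then set0 else A.
(* V must be fixed before aX, and each [is_a_smooth] brings its own Neron-Severi space and canonical
   bundle. So for every rational rho above some value of the invariant, one value a' below rho is
   frozen together with its [c] and [K]. A rational between aX and aY then selects such data without
   comparing two choices. *)
have hB (rho : rat) : {V : nat -> set X | (forall i, closed (V i) /\ V i <> setT) /\
    forall a : R, is_a_smooth L a -> a < ratr rho ->
    exists (a' : R) r (c : line_bundle X -> 'rV[R]_r) (K : line_bundle X),
      [/\ a' < ratr rho, NS_space c, canonical_bundle K &
        forall (S : kspace k) (f : morphism S X) s (c' : line_bundle S -> 'rV[R]_s)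
          (psi : {linear 'rV[R]_r -> 'rV[R]_s}),
          irreducible_set [set: S] -> (forall i, exists q, ~ V i (f q)) ->
          (forall M, psi (c M) = c' (lb_pullback f M)) ->
          psef_cone c' (psi (a' *: c L + c K))]}.
  apply: cid.
  have [[a [[r [c [K [NSc cK pc _]]]] lta]]|na] :=
    pselect (exists a : R, is_a_smooth L a /\ a < ratr rho); last first.
    exists (fun=> set0); split=> [i|a sa lta]; last by case: na; exists a.
    by split; [exact: closed0|].
  have [V [cV pV]] := psef_pull irX.1 pc.
  by exists V; split=> // a'' _ _; exists a, r, c, K.
pose V (i : nat) : set X := match @unpickle (code + rat * nat)%type i with
  | Some (inl w) => VA w
  | Some (inr w) => sval (hB w.1) w.2
  | None => set0
  end.
have VP i : closed (V i) /\ V i <> setT.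
  rewrite /V; case: unpickle => [[w|[rho j]]|]; last by split; [exact: closed0|].
    rewrite /VA; case: pselect => h; first by split; [exact: closed0|].
    by split=> //; exact: closed_affine_locus.
  by have [h _] := svalP (hB rho).
exists V; split=> // Y iota irY ci _ aX aY saX saY lt_a.
have [[i sV]|nV0] := pselect (exists i, range iota `<=` V i).
  by move=> P _ _ sP; exists i; exact: subset_trans sV.
have nV i : exists y, ~ V i (iota y).
  apply: contrapT => h; apply: nV0; exists i => _ [y _ <-].
  by apply: contrapT => h'; apply: h; exists y.
exfalso; have [rho] := rat_in_itvoo lt_a; rewrite in_itv /= => /andP[lt1 lt2].
have [_ HB] := svalP (hB rho).
have [a' [r [c [K [lta' NSc cK psefc]]]]] := HB aX saX lt1.
have [S [res [[varS _ bir] [r' [c' [K' [NSc' cK' _ minc']]]]]]] := saY.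
have [irS [m [eS [iS _]]]] := varS.
have qpS := quasi_projective_of_variety varS.
pose f := comp_mor res iota.
have [psi psiE] : exists psi : {linear 'rV[R]_r -> 'rV[R]_r'},
    forall M, psi (c M) = c' (lb_pullback f M).
  have [|psi _] := NSc.2 _ (fun M => c' (lb_pullback f M)) _; last exact: psi.
  exact: NS_hom_pull NSc'.1.
(* The image of S contains a nonempty open subset of the irreducible Y, which must meet the
   complement of V i. *)
have dense i : exists q, ~ V i (f q).
  have [y ny] := nV i; have [U [oU Une _ birU]] := bir.
  have [oR _] := birU U oU (fun _ h => h).
  have oV : open (iota @^-1` ~` V i) by apply: mor_open; rewrite openC; case: (VP i).
  have m1 : [set: Y] `&` (res @` U) !=set0.
    by case: Une => q Uq; exists (res q); split=> //; exists q.
  have m2 : [set: Y] `&` (iota @^-1` ~` V i) !=set0 by exists y.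
  have [_ [_ [[q Uq <-] nq]]] := irreducible_meet irY oR oV m1 m2.
  by exists q.
have p1 : psef_cone c' (a' *: c' (lb_pullback f L) + c' (lb_pullback f K)).
  rewrite -!psiE -linearZ -linearD; apply: psefc => // i.
  by have := dense (pickle (inr (rho, i) : code + rat * nat)%type); rewrite /V pickleK.
have genV F i0 : poly_over k0 F -> affine_locus e F i0 <> setT ->
    exists i, affine_locus e F i0 = V i.
  move=> kF nT; have [s sE] := poly_of_codeP gk0 kF.
  exists (pickle (inl (s, i0) : code + rat * nat)%type).
  by rewrite /V pickleK /VA /= -sE; case: pselect.
have [M [eM isoM]] := canonical_comparison k_char0 ce irX iS irS ci irY bir rk0 full
  stk0 (fun i => (VP i).1) nV genV cK cK'.
have K'E : c' K' = c' (lb_pullback f K) + c' M.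
  by rewrite -NSc'.1.1; apply/esym; exact: (NS_hom_iso qpS NSc'.1 isoM).
have LE : c' (lb_pullback res (lb_pullback iota L)) = c' (lb_pullback f L).
  by apply: (NS_hom_iso qpS NSc'.1); exact: (@lb_iso_same _ _ _ (lb_pullback f L) id id).
(* On S, a' L + K_S is the pullback of the pseudo-effective a' L + K_X plus an effective class, so
   minimality of aY applies; but a' < rho < aY. *)
have : aY <= a'.
  apply: minc'; rewrite LE K'E addrA.
  by apply: psef_add_effective p1 _; exact: effective_one.
by rewrite leNgt (lt_trans lta' lt2).
Qed.
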